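(* Let $n$ be a positive integer and let $X(n)$ be the $n\times n$ lower triangular random matrix whose elements $X_{i,j}$, $1\le j\le i\le n$, are i.i.d. standard complex normal random variables (and whose elements above the diagonal are $0$). Let $\lambda_1^{(n)}\ge\lambda_2^{(n)}\ge\dots\ge\lambda_n^{(n)}$ be the eigenvalues of $X(n)X(n)^*$. 1. The vector $\Lambda_n:=(\lambda_1^{(n)},\lambda_2^{(n)},\dots,\lambda_n^{(n)})$ has density (with respect to Lebesgue measure on $\mathbb{R}^n$) given by $$f_{\Lambda_n}(x_1,\dots,x_n)=\frac{1}{\prod_{j=1}^{n-1}j!}\,e^{-\sum_{j=1}^nx_j}\prod_{1\le i<j\le n}(x_i-x_j)(\log x_i-\log x_j)\,\mathbf{1}_{x_1>x_2>\cdots>x_n>0}.$$ 2. The point process $\{\lambda_1^{(n)},\lambda_2^{(n)},\dots,\lambda_n^{(n)}\}$ is determinantal.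
   Context: A standard complex normal random variable has density $\frac1\pi e^{-|z|^2}$ on $\mathbb{C}$. A point process on $(0,\infty)$ is determinantal if there is a kernel $K:(0,\infty)^2\to\mathbb{R}$ such that for every $m\ge1$ its $m$-point correlation function with respect to Lebesgue measure is $\rho_m(x_1,\dots,x_m)=\det(K(x_i,x_j))_{1\le i,j\le m}$. *)

(* Defs.v *)
From HB Require Import structures.
From mathcomp Require Import all_boot all_order all_algebra.
From mathcomp Require Import all_classical all_reals all_analysis.
From mathcomp Require Import complex.

Set Implicit Arguments.
Unset Strict Implicit.
Unset Printing Implicit Defensive.

Import Order.TTheory GRing.Theory Num.Theory.

Local Open Scope classical_set_scope.
Local Open Scope ring_scope.
Local Open Scope sesquilinear_scope.

Section ConsMeasure.
Context {R : realType} (n : nat).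
Variable nu : {sigma_finite_measure set (n.-tuple R) -> \bar R}.

Definition tcons (p : R * n.-tuple R) : n.+1.-tuple R := [tuple of p.1 :: p.2].

Lemma measurable_tcons : measurable_fun [set: R * n.-tuple R] tcons.
Proof. exact: measurable_cons. Qed.

(* The image of the product of the Lebesgue measure on R and of nu under the
   identification of R * R^n with R^(n+1). *)
Definition cons_measure : set (n.+1.-tuple R) -> \bar R :=
  pushforward (@lebesgue_measure R \x nu)%E tcons.

Let cons_measure0 : cons_measure set0 = 0%E.
Proof. by rewrite /cons_measure /pushforward preimage_set0 measure0. Qed.

Let cons_measure_ge0 A : (0 <= cons_measure A)%E.
Proof. by rewrite /cons_measure /pushforward; exact: measure_ge0. Qed.

Let cons_measure_sigma_additive : semi_sigma_additive cons_measure.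
Proof.
move=> F mF tF mUF; rewrite /cons_measure /pushforward preimage_bigcup.
apply: measure_semi_sigma_additive.
- by move=> k; rewrite -[X in measurable X]setTI; exact: measurable_tcons.
- apply/trivIsetP => /= i j _ _ ij; rewrite -preimage_setI.
  by move/trivIsetP : tF => /(_ _ _ _ _ ij) ->//; rewrite preimage_set0.
- by rewrite -preimage_bigcup -[X in measurable X]setTI;
    exact: measurable_tcons.
Qed.

HB.instance Definition _ := isMeasure.Build _ _ _ cons_measure
  cons_measure0 cons_measure_ge0 cons_measure_sigma_additive.

Let cons_measure_sigma_finite : sigma_finite setT cons_measure.
Proof.
have /sigma_finiteP[F [TF ndF Foo]] := sigma_finiteT (@lebesgue_measure R).
have /sigma_finiteP[G [TG ndG Goo]] := sigma_finiteT nu.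
pose u (t : n.+1.-tuple R) : R * n.-tuple R := (thead t, [tuple of behead t]).
have mu_ : measurable_fun [set: n.+1.-tuple R] u.
  apply/measurable_fun_pair; last exact: measurable_behead.
  exact: measurable_tnth.
have uK : cancel tcons u.
  by move=> [x y]; rewrite /u/= theadE; congr pair; exact/val_inj.
exists (fun k => u @^-1` (F k `*` G k)).
  rewrite -preimage_bigcup (_ : \bigcup_k _ = setT) ?preimage_setT//.
  rewrite -subTset -setXTT TF TG => -[x y] [/= [j _ Fjx] [k _ Gky]].
  exists (maxn j k) => //; split => /=.
  - by move: x Fjx; exact/subsetPset/ndF/leq_maxl.
  - by move: y Gky; exact/subsetPset/ndG/leq_maxr.
move=> k; have [mF Fk] := Foo k; have [mG Gk] := Goo k; split.
  by rewrite -[X in measurable X]setTI; apply: mu_ => //; exact: measurableX.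
rewrite /cons_measure /pushforward -comp_preimage.
rewrite (_ : u \o tcons = id); last by apply/funext => p /=; rewrite uK.
by rewrite preimage_id product_measure1E// lte_mul_pinfty// ge0_fin_numE.
Qed.

HB.instance Definition _ := Measure_isSigmaFinite.Build _ _ _ cons_measure
  cons_measure_sigma_finite.

End ConsMeasure.

(* Lebesgue measure on R^n, with R^n encoded as n.-tuple R (product
   sigma-algebra). *)
Fixpoint lebesgue_tuple (R : realType) (n : nat) :
    {sigma_finite_measure set (n.-tuple R) -> \bar R} :=
  match n with
  | 0 => @dirac _ (0.-tuple R) [tuple] R
  | m.+1 => cons_measure (lebesgue_tuple R m)
  end.

(* Y is a random element of S with density f with respect to mu. *)
Definition has_density (R : realType) d (T : measurableType d)
    (P : probability T R) d' (S : measurableType d')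
    (mu : {measure set S -> \bar R}) (Y : T -> S) (f : S -> R) : Prop :=
  [/\ measurable_fun [set: T] Y,
      measurable_fun [set: S] f,
      (forall y, 0 <= f y) &
      forall A, measurable A -> P (Y @^-1` A) = (\int[mu]_(y in A) (f y)%:E)%E].

Definition mutually_independent (R : realType) d (T : measurableType d)
    (P : probability T R) (I : finType) (D : {set I})
    d' (S : measurableType d') (Y : I -> T -> S) : Prop :=
  forall (J : {set I}) (A : I -> set S), J \subset D ->
    (forall i, measurable (A i)) ->
    P [set w | forall i, i \in J -> A i (Y i w)] =
      (\prod_(i in J) P (Y i @^-1` A i))%E.

(* The identification of the complex plane with R * R, used for its Borel
   structure and its Lebesgue measure. *)
Definition reim (R : realType) (z : R[i]) : R * R := (complex.Re z, complex.Im z).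

Definition std_complex_normal (R : realType) d (T : measurableType d)
    (P : probability T R) (Z : T -> R[i]) : Prop :=
  has_density P (@lebesgue_measure R \x @lebesgue_measure R)%E
    (fun w => reim (Z w))
    (fun p => pi^-1 * expR (- ComplexField.Normc.normc (p.1 +i* p.2)%C ^+ 2)).

Definition lower_triangular_gaussian (R : realType) d (T : measurableType d)
    (P : probability T R) (n : nat) (X : T -> 'M[R[i]]_n) : Prop :=
  [/\ forall w, is_trig_mx (X w),
      forall i j : 'I_n, (j <= i)%N -> std_complex_normal P (fun w => X w i j) &
      mutually_independent P [set ij : 'I_n * 'I_n | (ij.2 <= ij.1)%N]%SET
        (fun ij w => reim (X w ij.1 ij.2))].

(* x lists the eigenvalues of A, all real, with multiplicity and in
   nonincreasing order. *)
Definition ordered_eigenvalues (R : realType) (n : nat) (A : 'M[R[i]]_n)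
    (x : n.-tuple R) : Prop :=
  (forall i j : 'I_n, (i <= j)%N -> tnth x j <= tnth x i) /\
  char_poly A = \prod_(i < n) ('X - ((tnth x i)%:C%C)%:P).

Definition eigenvalue_density (R : realType) (n : nat) (x : n.-tuple R) : R :=
  (\prod_(1 <= j < n) (j`!)%:R)^-1 * expR (- \sum_(j < n) tnth x j) *
  (\prod_(i < n) \prod_(j < n | (i < j)%N)
     ((tnth x i - tnth x j) * (ln (tnth x i) - ln (tnth x j)))) *
  \1_[set y : n.-tuple R | (forall i j : 'I_n, (i < j)%N -> tnth y j < tnth y i)
                           /\ (forall i, 0 < tnth y i)] x.

Definition pos_orthant (R : realType) (m : nat) : set (m.-tuple R) :=
  [set y | forall i, 0 < tnth y i].
Arguments pos_orthant : clear implicits.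

(* A point process on (0, +oo) with N points: these are random variables that
   are almost surely positive, of which only the unordered collection matters
   in the definitions below. *)
Definition finite_point_process (R : realType) d (T : measurableType d)
    (P : probability T R) (N : nat) (x : 'I_N -> T -> R) : Prop :=
  (forall i, measurable_fun [set: T] (x i)) /\
  {ae P, forall w, forall i, 0 < x i w}.

(* rho is the m-point correlation function: the density, with respect to
   Lebesgue measure, of the m-th factorial moment measure
   B |-> E #{m-tuples of distinct points lying in B}. The values of rho outside
   of (0, +oo)^m are irrelevant. *)
Definition is_correlation_function (R : realType) d (T : measurableType d)
    (P : probability T R) (N : nat) (x : 'I_N -> T -> R)
    (m : nat) (rho : m.-tuple R -> R) : Prop :=
  [/\ measurable_fun (pos_orthant R m) rho,
      (forall y, pos_orthant R m y -> 0 <= rho y) &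
      forall B, measurable B -> B `<=` pos_orthant R m ->
        (\int[P]_w (\sum_(s : {ffun 'I_m -> 'I_N} | injectiveb s)
                      \1_B [tuple x (s k) w | k < m])%:E =
         \int[lebesgue_tuple R m]_(y in B) (rho y)%:E)%E].

Definition determinantal (R : realType) d (T : measurableType d)
    (P : probability T R) (N : nat) (x : 'I_N -> T -> R) : Prop :=
  finite_point_process P x /\
  exists K : R -> R -> R, forall m : nat, (1 <= m)%N ->
    is_correlation_function P x
      (fun y : m.-tuple R => \det (\matrix_(i < m, j < m) K (tnth y i) (tnth y j))).

(* Main.v *)
(* Peel off the first column u of X, and let A be the remaining lower triangular
   block of size n - 1. Then XX^* is u u^* plus AA^* bordered by a zero row and
   column, so its characteristic polynomial is the secular polynomial
   prod_i (x - d_i) - sum_i q_i prod_{j <> i} (x - d_j), where d = (0, a), a lists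
   the eigenvalues of AA^*, and q_i = |(Wu)_i|^2 for a unitary W depending on A
   only. Since u is Gaussian and independent of A, given A the q_i are i.i.d.
   exponential; the change of variables from q to the roots l of the secular
   polynomial has a Vandermonde Jacobian, and gives the conditional density
   vand(l) e^{sum a - sum l} / (vand(a) prod a) on the l interlacing a. Multiplied
   by the density of a, this leaves the integral of vand(log a) / prod a over the
   interlacing a, which is a determinant of one-dimensional integrals, equal to
   vand(log l) / (n - 1)!.

   The symmetrized density is then c det(phi_i(x_a)) det(psi_j(x_a)), so the
   kernel K = sum phi_i (G^-1)_ij psi_j, with G the Gram matrix of the phi_i and
   psi_j, reproduces itself, and the correlation functions follow by integrating
   out one point at a time. *)
Require Import Defs.
From HB Require Import structures.
From mathcomp Require Import all_boot all_order all_algebra fingroup perm.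
From mathcomp Require Import all_classical all_reals all_analysis.
From mathcomp Require Import measurable_realfun complex ring lra.
Set Implicit Arguments.
Unset Strict Implicit.
Unset Printing Implicit Defensive.
Import Order.TTheory GRing.Theory Num.Theory.
Import numFieldNormedType.Exports.
Local Open Scope classical_set_scope.
Local Open Scope ring_scope.

(** * Measures on spaces of tuples *)

(** The only nonlinear substitutions are in one variable. Passing from roots to coefficients is done
    one root at a time: once the largest root [x] is fixed, the higher coefficients differ from
    those of the quotient by [X - x] by a unimodular shear, and for fixed higher coefficients the
    constant one is a decreasing polynomial function of [x]. That [x] is the largest root is
    expressed by positivity of all derivatives at [x], a condition on coefficients that yields both
    monotonicity and measurability. Constants are found by testing an identity on a function of
    known integral: the angular factor [pi], the determinant of the real form of a unitary matrix,
    and the Gram determinant, which comes from the total probability. Interlacing is a matter of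
    signs: positive [q_i] force the secular polynomial to alternate at the entries of [(0, a)],
    hence to have a root in each gap. The eigenvalues of the block are simple and positive only
    almost surely. Results for fixed [a] therefore assume it, and the exceptional null set is
    discarded when the two laws are composed. *)

Section Boxes.
Context d (T : measurableType d) (n : nat).

Definition box (A : 'I_n -> set T) : set (n.-tuple T) :=
  [set t | forall i, A i (tnth t i)].

Lemma boxE (A : 'I_n -> set T) :
  box A = \bigcap_(i in [set: 'I_n]) ((@tnth n T)^~ i @^-1` A i).
Proof. by apply/seteqP; split => t /= h i; [move=> _; exact: h|exact: h]. Qed.

Lemma measurable_box (A : 'I_n -> set T) :
  (forall i, measurable (A i)) -> measurable (box A).
Proof.
move=> mA; rewrite boxE; apply: fin_bigcap_measurable => // i _.
by rewrite -[X in measurable X]setTI; exact: measurable_tnth.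
Qed.

Lemma measurable_tuple_boxes :
  (@measurable _ (n.-tuple T)) =
  <<s [set box A | A in [set A | forall i, measurable (A i)]] >>.
Proof.
apply/seteqP; split.
- apply: smallest_sub; first exact: smallest_sigma_algebra.
  move=> B; rewrite -bigcup_seq => -[i /= _ [C mC]]; rewrite setTI => <-.
  apply: sub_sigma_algebra.
  exists (fun j => if j == i then C else setT).
    by move=> j /=; case: ifP.
  apply/seteqP; split => t /=.
  + by move=> /(_ i); rewrite eqxx.
  + by move=> Ct j; case: eqP => [->|].
- apply: smallest_sub; first exact: sigma_algebra_measurable.
  by move=> _ [A mA <-]; exact: measurable_box.
Qed.

(** Boxes are stable under intersection and generate the product sigma-algebra, so measures are
    determined by their values on them; the cubes over [g k] give the required exhaustion by sets of
    finite measure. *)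
Lemma tuple_measure_unique (R : realType)
    (m1 m2 : {measure set (n.-tuple T) -> \bar R}) (g : (set T)^nat) :
  (forall k, measurable (g k)) -> {homo g : k l / (k <= l)%N >-> k `<=` l} ->
  \bigcup_k g k = setT ->
  (forall k, (m1 (box (fun=> g k)) < +oo)%E) ->
  (forall A, (forall i, measurable (A i)) -> m1 (box A) = m2 (box A)) ->
  forall B, measurable B -> m1 B = m2 B.
Proof.
move=> mg ndg Ug goo m12 B mB.
apply: (measure_unique [set box A | A in [set A | forall i, measurable (A i)]]
  (fun k => box (fun=> g k))) => //.
- exact: measurable_tuple_boxes.
- move=> _ _ [A mA <-] [C mC <-]; exists (fun i => A i `&` C i).
    by move=> i; exact: measurableI.
  apply/seteqP; split => t /=; first by move=> h; split=> i; case: (h i).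
  by move=> -[h1 h2] i; split.
- by move=> k; exists (fun=> g k).
- apply/seteqP; split => // t _.
  have /choice[k kP] : forall i, exists k, g k (tnth t i).
    move=> i; have : [set: T] (tnth t i) by [].
    by rewrite -Ug => -[k _ gk]; exists k.
  exists (\max_(i < n) k i)%N => // i.
  by apply: ndg (kP i); exact: leq_bigmax.
- by move=> _ [A mA <-]; exact: m12.
Qed.
End Boxes.

(** * Weighted image measures *)

Section WeightedPushforward.
Context d1 d2 (X : measurableType d1) (Y : measurableType d2) (R : realType).
Variables (mu : {measure set X -> \bar R}) (phi : X -> Y) (w : X -> R).

(** The image under [phi] of the measure with density [w]. The three proofs are arguments so that a
    measure structure can be attached to the resulting function. *)
Definition wpush of measurable_fun setT phi & measurable_fun setT w &
  (forall x, 0 <= w x) :=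
  fun A : set Y => (\int[mu]_(x in phi @^-1` A) (w x)%:E)%E.

Hypotheses (mphi : measurable_fun setT phi) (mw : measurable_fun setT w)
  (w0 : forall x, 0 <= w x).

Let m := wpush mphi mw w0.

Let m0 : m set0 = 0%E.
Proof. by rewrite /m /wpush preimage_set0 integral_set0. Qed.

Let m_ge0 A : (0 <= m A)%E.
Proof. by apply: integral_ge0 => x _; rewrite lee_fin. Qed.

Let mpre A : measurable A -> measurable (phi @^-1` A).
Proof. by move=> mA; rewrite -[X in measurable X]setTI; exact: mphi. Qed.

Let m_sigma_additive : semi_sigma_additive m.
Proof.
move=> F mF tF mUF; rewrite /m /wpush preimage_bigcup.
rewrite ge0_integral_bigcup//.
- apply: is_cvg_ereal_nneg_natsum_cond => k _ _.
  by apply: integral_ge0 => x _; rewrite lee_fin.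
- by move=> k; exact: mpre.
- by apply: measurable_funTS; exact/measurable_EFinP.
- by move=> x _; rewrite lee_fin.
- apply/trivIsetP => /= i j _ _ ij; rewrite -preimage_setI.
  by move/trivIsetP : tF => /(_ _ _ _ _ ij) ->//; rewrite preimage_set0.
Qed.

HB.instance Definition _ := isMeasure.Build _ _ _ (wpush mphi mw w0)
  m0 m_ge0 m_sigma_additive.

Import HBNNSimple.
(** The simple approximations of [f] reduce the claim to indicators, and monotone convergence on
    both sides gives the limit. *)
Lemma integral_wpush (f : Y -> \bar R) :
  measurable_fun setT f -> (forall y, (0 <= f y)%E) ->
  (\int[wpush mphi mw w0]_y f y = \int[mu]_x ((w x)%:E * f (phi x)))%E.
Proof.
move=> mf f0.
pose f_ := nnsfun_approx measurableT mf.
have mfphi n : measurable_fun setT (f_ n \o phi).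
  exact: measurableT_comp.
transitivity (limn (fun n => \int[wpush mphi mw w0]_y (f_ n y)%:E)%E).
  rewrite -monotone_convergence//.
  - by apply: eq_integral => y _; apply/esym/cvg_lim => //; exact: cvg_nnsfun_approx.
  - by move=> n; exact/measurable_EFinP.
  - by move=> n y _; rewrite lee_fin.
  - by move=> y _ p q pq; rewrite lee_fin; exact/lefP/nd_nnsfun_approx.
rewrite [X in limn X](_ : _ =
    (fun n => \int[mu]_x ((w x)%:E * (f_ n (phi x))%:E))%E); last first.
  apply/funext => n.
  transitivity (\sum_(k \in range (f_ n)) \int[wpush mphi mw w0]_y
      (k * \1_(f_ n @^-1` [set k]) y)%:E)%E.
    under eq_integral do rewrite fimfunE -fsumEFin//.
    rewrite ge0_integral_fsum//.
    - by move=> y; exact/measurable_EFinP/measurable_funM.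
    - by move=> y x _; rewrite nnfun_muleindic_ge0.
  transitivity (\sum_(k \in range (f_ n)) \int[mu]_x
      ((w x)%:E * (k * \1_(f_ n @^-1` [set k]) (phi x))%:E))%E.
    apply: eq_fsbigr => r; rewrite inE => -[y0 _ fr].
    have r0 : 0 <= r by rewrite -fr.
    rewrite integralZl_indic_nnsfun// integral_indic//=.
    rewrite setIT /wpush integral_mkcond -ge0_integralZl//; last 2 first.
    - apply/(measurable_restrictT (EFin \o w)); first by apply: mpre; rewrite -[X in measurable X]setTI; exact: measurable_funPT.
      by apply: measurable_funTS; exact/measurable_EFinP.
    - by move=> x _; apply: erestrict_ge0 => z _; rewrite lee_fin.
    apply: eq_integral => x _; rewrite /patch indicE.
    have -> : (x \in phi @^-1` (f_ n @^-1` [set r])) =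
              (phi x \in f_ n @^-1` [set r]).
      by apply/idP/idP; rewrite !inE.
    case: ifPn => _; last by rewrite mulr0 !mule0.
    by rewrite mulr1 muleC.
  rewrite -ge0_integral_fsum//.
  - apply: eq_integral => x _.
    rewrite -ge0_mule_fsumr; last by move=> r; rewrite nnfun_muleindic_ge0.
    by rewrite fsumEFin// -fimfunE.
  - move=> r; apply: emeasurable_funM; first exact/measurable_EFinP.
    apply/measurable_EFinP; apply: measurable_funM => //.
    by apply: (measurableT_comp _ mphi).
  - move=> r x _; apply: mule_ge0; first by rewrite lee_fin.
    exact: nnfun_muleindic_ge0.
rewrite -monotone_convergence//.
- apply: eq_integral => x _; apply/cvg_lim => //.
  by apply: cvgeZl => //; exact: cvg_nnsfun_approx.
- move=> n; apply: emeasurable_funM; first exact/measurable_EFinP.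
  by apply/measurable_EFinP; exact: mfphi.
- by move=> n x _; rewrite mule_ge0 ?lee_fin.
- move=> x _ p q pq; rewrite lee_wpmul2l ?lee_fin//.
  exact/lefP/nd_nnsfun_approx.
Qed.
End WeightedPushforward.

(** The common form of the changes of variables below: a Jacobian enters as one of the weights, and
    only sets, in practice intervals or boxes, have to be compared. *)
Lemma ge0_integral_transfer (R : realType) d d1 d2 (Y : measurableType d)
    (X1 : measurableType d1) (X2 : measurableType d2)
    (mu1 : {measure set X1 -> \bar R}) (mu2 : {measure set X2 -> \bar R})
    (phi1 : X1 -> Y) (phi2 : X2 -> Y) (w1 : X1 -> R) (w2 : X2 -> R) :
  measurable_fun setT phi1 -> measurable_fun setT phi2 ->
  measurable_fun setT w1 -> measurable_fun setT w2 ->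
  (forall x, 0 <= w1 x) -> (forall x, 0 <= w2 x) ->
  (forall A, measurable A -> \int[mu1]_(x in phi1 @^-1` A) (w1 x)%:E =
                            \int[mu2]_(x in phi2 @^-1` A) (w2 x)%:E)%E ->
  forall f : Y -> \bar R, measurable_fun setT f -> (forall y, 0 <= f y)%E ->
  (\int[mu1]_x ((w1 x)%:E * f (phi1 x)) =
   \int[mu2]_x ((w2 x)%:E * f (phi2 x)))%E.
Proof.
move=> mphi1 mphi2 mw1 mw2 w10 w20 eq12 f mf f0.
rewrite -(integral_wpush mu1 mphi1 mw1 w10)//.
rewrite -(integral_wpush mu2 mphi2 mw2 w20)//.
by apply: eq_measure_integral => A mA _; exact: eq12.
Qed.

Section LebesgueTuple.
Context (R : realType).

Lemma ge0_integral_tcons n (f : n.+1.-tuple R -> \bar R) :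
  measurable_fun setT f -> (forall t, 0 <= f t)%E ->
  (\int[lebesgue_tuple R n.+1]_t f t =
   \int[@lebesgue_measure R \x lebesgue_tuple R n]_x f (tcons x))%E.
Proof.
move=> mf f0.
pose mu : {measure set (measurableTypeR R * n.-tuple R) -> \bar R} :=
  (@lebesgue_measure R \x lebesgue_tuple R n)%E.
have mt : measurable_fun [set: measurableTypeR R * n.-tuple R] (@tcons R n).
  exact: measurable_tcons.
have := @ge0_integral_pushforward _ _ _ _ _ _ mt mu setT f measurableT mf.
by rewrite preimage_setT => <-.
Qed.

Lemma integral_lebesgue_tupleS n (f : n.+1.-tuple R -> \bar R) :
  measurable_fun setT f -> (forall t, 0 <= f t)%E ->
  (\int[lebesgue_tuple R n.+1]_t f t =
   \int[lebesgue_measure]_x \int[lebesgue_tuple R n]_t f [tuple of x :: t])%E.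
Proof.
move=> mf f0; rewrite ge0_integral_tcons// fubini_tonelli1//.
by apply: measurableT_comp mf _; exact: measurable_tcons.
Qed.

Lemma integral_lebesgue_tupleS2 n (f : n.+1.-tuple R -> \bar R) :
  measurable_fun setT f -> (forall t, 0 <= f t)%E ->
  (\int[lebesgue_tuple R n.+1]_t f t =
   \int[lebesgue_tuple R n]_t \int[lebesgue_measure]_x f [tuple of x :: t])%E.
Proof.
move=> mf f0; rewrite ge0_integral_tcons// fubini_tonelli2//.
by apply: measurableT_comp mf _; exact: measurable_tcons.
Qed.

Lemma integral_lebesgue_tuple0 (f : 0.-tuple R -> \bar R) :
  measurable_fun setT f -> (\int[lebesgue_tuple R 0]_t f t = f [tuple])%E.
Proof. by move=> mf; rewrite [LHS]integral_dirac// diracT mul1e. Qed.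

Lemma measurable_integral_tuple n (f : R * n.-tuple R -> \bar R) :
  measurable_fun setT f -> (forall t, 0 <= f t)%E ->
  measurable_fun setT (fun x => \int[lebesgue_tuple R n]_t f (x, t))%E.
Proof. by move=> mf f0; exact: measurable_fun_fubini_tonelli_F. Qed.

Lemma lebesgue_tuple_box n (A : 'I_n -> set R) :
  (forall i, measurable (A i)) ->
  (lebesgue_tuple R n (box A) = \prod_(i < n) lebesgue_measure (A i))%E.
Proof.
elim: n A => [|n IH] A mA.
  rewrite big_ord0 /= diracE mem_set// => -[] //.
rewrite big_ord_recl -IH//.
rewrite /= /cons_measure /pushforward.
rewrite (_ : _ @^-1` _ = A ord0 `*` box (fun i => A (lift ord0 i))).
  have mB : measurable (box (fun i : 'I_n => A (lift ord0 i))).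
    by apply: measurable_box => i; exact: mA.
  rewrite product_measure1E//; exact: (mA ord0).
apply/seteqP; split => -[x t] /=.
- move=> h; split; first by have := h ord0; rewrite tnth0.
  by move=> i; have := h (lift ord0 i); rewrite tnthS.
- move=> [Ax At] i; case: (unliftP ord0 i) => [j ->|->]; last by rewrite tnth0.
  by rewrite tnthS; exact: At.
Qed.

(** The cubes over [[-k, k]] have the finite measure [(2k)^n], which makes uniqueness on boxes
    applicable. *)
Lemma lebesgue_tuple_unique n (m : {measure set (n.-tuple R) -> \bar R}) :
  (forall A, (forall i, measurable (A i)) ->
     (m (box A) = \prod_(i < n) lebesgue_measure (A i : set R))%E) ->
  forall B, measurable B -> lebesgue_tuple R n B = m B.
Proof.
move=> mE B mB.
apply: (@tuple_measure_unique _ _ _ _ _ _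
   (fun k => `[- (k%:R : R), k%:R]%classic)) mB => //.
- move=> k l kl; apply: subset_itv; rewrite bnd_simp ?lerN2 ler_nat//.
- apply/seteqP; split => // x _.
  exists (Num.truncn `|x|).+1 => //=; rewrite in_itv/= -ler_norml ltW//.
  exact: truncnS_gt.
- move=> k; pose I := `[- (k%:R : R), k%:R]%classic.
  have H := @lebesgue_tuple_box n (fun=> I) (fun=> measurable_itv _).
  apply: (eq_ind_r (fun z => (z < +oo)%E) _ H).
  rewrite (eq_bigr (fun=> (k%:R *+ 2)%:E)); last first.
    move=> i _; rewrite lebesgue_measure_itv/= lte_fin.
    case: ltP => [_|]; first by rewrite -EFinB opprK -mulr2n.
    by case: k {I H} => [|k] /=; [rewrite mul0rn|rewrite leNgt gtrN].
  by rewrite -(big_morph EFin (@EFinM R) erefl) ltry.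
- by move=> A mA; rewrite mE//; exact: lebesgue_tuple_box.
Qed.
End LebesgueTuple.

(** * Changes of variables *)

Section LinearChange.
Context (R : realType).

(** Both sides define measures, compared on the intervals []u, v]]. A negative [a] reverses the
    interval, so that the preimage is closed on the left instead, with the same length. *)
Lemma ge0_integral_affine (a b : R) (f : R -> \bar R) : a != 0 ->
  measurable_fun setT f -> (forall x, 0 <= f x)%E ->
  (`|a|%:E * \int[lebesgue_measure]_x f (a * x + b)%R =
   \int[lebesgue_measure]_x f x)%E.
Proof.
move=> a0 mf f0.
pose phi : measurableTypeR R -> measurableTypeR R := fun x : R => a * x + b.
have mphi : measurable_fun setT phi.
  by apply: measurable_funD => //; exact: measurable_funM.
have mw : measurable_fun [set: measurableTypeR R] (fun=> `|a|) by [].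
have := @ge0_integral_transfer R _ _ _ (measurableTypeR R) _ _
  lebesgue_measure lebesgue_measure phi id (fun=> `|a|) (fun=> 1) mphi
  (@measurable_id _ _ _) mw (measurable_cst _) (fun=> normr_ge0 _)
  (fun=> ler01) _ f mf f0.
rewrite ge0_integralZl//; first last.
- by apply: measurableT_comp.
move=> ->; first by under eq_integral do rewrite mul1e.
move=> A mA; rewrite preimage_id (integral_cst lebesgue_measure mA 1) mul1e.
apply/esym; pose m := wpush lebesgue_measure mphi mw (fun=> normr_ge0 _).
apply: (@lebesgue_measure_unique R m) => // _ [[u v] _ <-].
rewrite /m /= /wpush /=.
have vuE : (`|a|%:E * ((v - u) / `|a|)%:E = (v - u)%:E)%E.
  by rewrite -EFinM mulrC divfK// normr_eq0.
have mulpos (x y c : R) : 0 < c -> (x / c < y / c) = (x < y).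
  by move=> c0; rewrite ltr_pM2r// invr_gt0.
have mulneg (x y c : R) : c < 0 -> (x / c < y / c) = (y < x).
  by move=> c0; rewrite ltr_nM2r// invr_lt0.
have [a_gt0|a_le0] := ltrP 0 a.
  have -> : phi @^-1` `]u, v] = `](u - b) / a, (v - b) / a]%classic :> set R.
    rewrite predeqE => x /=; rewrite !in_itv/= ltr_pdivrMr// ler_pdivlMr//.
    by rewrite ltrBlDr lerBrDr !(mulrC x).
  rewrite [RHS]integral_cst//= !lebesgue_measure_itv/= !lte_fin mulpos// ltrD2r.
  case: ifPn => _; last by rewrite mule0.
  rewrite -EFinB -vuE gtr0_norm//; congr (_ * _%:E)%E.
  by rewrite -mulrBl opprB addrA subrK.
have a_lt0 : a < 0 by rewrite lt_neqAle a0.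
have -> : phi @^-1` `]u, v] = `[(v - b) / a, (u - b) / a[%classic :> set R.
  rewrite predeqE => x /=; rewrite !in_itv/= ler_ndivrMr// ltr_ndivlMr//.
  by rewrite ltrBlDr lerBrDr !(mulrC x) andbC.
rewrite [RHS]integral_cst//= !lebesgue_measure_itv/= !lte_fin mulneg// ltrD2r.
case: ifPn => _; last by rewrite mule0.
rewrite -EFinB -vuE ltr0_norm//; congr (_ * _%:E)%E.
by rewrite -mulrBl opprB addrA subrK invrN mulrN -mulNr opprB.
Qed.

Definition affact n (A : 'M[R]_n) (c : 'I_n -> R) (t : n.-tuple R) :
  n.-tuple R := [tuple \sum_j A i j * tnth t j + c i | i < n].

Lemma measurable_affact n (A : 'M[R]_n) c : measurable_fun setT (affact A c).
Proof.
apply/measurable_fun_tnthP => i /=.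
rewrite (_ : _ \o _ = fun t => \sum_j A i j * tnth t j + c i); last first.
  by apply/funext => t /=; rewrite tnth_mktuple.
apply: measurable_funD => //; apply: measurable_sum => j.
by apply: measurable_funM => //; exact: measurable_tnth.
Qed.

Lemma affact_lower n (A : 'M[R]_n.+1) c x (t : n.-tuple R) :
  (forall j, A ord0 (lift ord0 j) = 0) ->
  affact A c [tuple of x :: t] = [tuple of (A ord0 ord0 * x + c ord0) ::
    affact (\matrix_(i, j) A (lift ord0 i) (lift ord0 j))
      (fun i => A (lift ord0 i) ord0 * x + c (lift ord0 i)) t].
Proof.
move=> A0; apply: eq_from_tnth => i; rewrite tnth_mktuple big_ord_recl tnth0.
case: (unliftP ord0 i) => [k ->|->].
  rewrite tnthS tnth_mktuple [X in X + _ = _]addrC -addrA; congr (_ + _).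
  by apply: eq_bigr => j _; rewrite tnthS mxE.
rewrite tnth0; congr (_ + _).
by rewrite big1 ?addr0// => j _; rewrite A0 mul0r.
Qed.

Lemma affact_upper n (A : 'M[R]_n.+1) c x (t : n.-tuple R) :
  (forall j, A (lift ord0 j) ord0 = 0) ->
  affact A c [tuple of x :: t] = [tuple of (A ord0 ord0 * x +
      (\sum_j A ord0 (lift ord0 j) * tnth t j + c ord0)) ::
    affact (\matrix_(i, j) A (lift ord0 i) (lift ord0 j))
      (fun i => c (lift ord0 i)) t].
Proof.
move=> A0; apply: eq_from_tnth => i; rewrite tnth_mktuple big_ord_recl tnth0.
case: (unliftP ord0 i) => [k ->|->].
  rewrite tnthS tnth_mktuple A0 mul0r add0r; congr (_ + _).
  by apply: eq_bigr => j _; rewrite tnthS mxE.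
rewrite tnth0 -addrA; congr (_ + (_ + _)).
by apply: eq_bigr => j _; rewrite tnthS.
Qed.

Lemma measurable_tuple_cons n (x : R) :
  measurable_fun setT (fun t : n.-tuple R => [tuple of x :: t]).
Proof. exact: (@measurable_cons _ _ _ _ (cst x) _ id). Qed.

Lemma measurable_tuple_cons1 n (t : n.-tuple R) :
  measurable_fun setT (fun x : R => [tuple of x :: t]).
Proof. exact: (@measurable_cons _ _ _ _ id _ (cst t)). Qed.

(** The first image coordinate depends on the first variable alone, which otherwise only translates
    the tail. Integrating the tail for a fixed head leaves a problem of size [n] and one affine
    substitution. *)
Lemma ge0_integral_lower n (A : 'M[R]_n) c (f : n.-tuple R -> \bar R) :
  (forall i j : 'I_n, (i < j)%N -> A i j = 0) -> (forall i, A i i != 0) ->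
  measurable_fun setT f -> (forall t, 0 <= f t)%E ->
  (`|\prod_i A i i|%:E * \int[lebesgue_tuple R n]_t f (affact A c t) =
   \int[lebesgue_tuple R n]_t f t)%E.
Proof.
elim: n A c f => [|n IH] A c f Al Ad mf f0.
  rewrite !integral_lebesgue_tuple0//; last first.
    by apply: measurableT_comp => //; exact: measurable_affact.
  by rewrite big_ord0 normr1 mul1e (tuple0 (affact _ _ _)).
have mfA : measurable_fun setT (f \o affact A c).
  by apply: measurableT_comp => //; exact: measurable_affact.
rewrite !integral_lebesgue_tupleS//.
pose A' := \matrix_(i, j) A (lift ord0 i) (lift ord0 j) : 'M[R]_n.
pose F x : \bar R := (\int[lebesgue_tuple R n]_t f [tuple of x :: t])%E.
have mF : measurable_fun setT F.
  apply: (@measurable_integral_tuple _ _ (f \o @tcons R n)).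
    exact: measurableT_comp mf (@measurable_tcons R n).
  by move=> t; exact: f0.
have F0 x : (0 <= F x)%E by exact: integral_ge0.
rewrite -(ge0_integral_affine (c ord0) (Ad ord0) mF F0).
rewrite big_ord_recl normrM EFinM -muleA; congr (_ * _)%E.
rewrite -ge0_integralZl//; last 2 first.
- apply: (@measurable_integral_tuple _ _ ((f \o affact A c) \o @tcons R n)).
    exact: measurableT_comp mfA (@measurable_tcons R n).
  by move=> t; exact: f0.
- by move=> x _; exact: integral_ge0.
apply: eq_integral => x _.
have Al0 j : A ord0 (lift ord0 j) = 0 by exact: Al.
under eq_integral => t _ do rewrite (affact_lower c x t Al0).
rewrite /F -[in RHS](IH A' (fun i => A (lift ord0 i) ord0 * x + c (lift ord0 i))).
- by congr (`|_|%:E * _)%E; apply: eq_bigr => i _; rewrite mxE.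
- by move=> i j ij; rewrite mxE Al.
- by move=> i; rewrite mxE.
- exact: measurableT_comp mf (measurable_tuple_cons _).
- by move=> t; exact: f0.
Qed.

(** The same induction with the roles exchanged: the tail transforms by itself and translates the
    head, so the head is integrated first. *)
Lemma ge0_integral_upper n (A : 'M[R]_n) c (f : n.-tuple R -> \bar R) :
  (forall i j : 'I_n, (j < i)%N -> A i j = 0) -> (forall i, A i i != 0) ->
  measurable_fun setT f -> (forall t, 0 <= f t)%E ->
  (`|\prod_i A i i|%:E * \int[lebesgue_tuple R n]_t f (affact A c t) =
   \int[lebesgue_tuple R n]_t f t)%E.
Proof.
elim: n A c f => [|n IH] A c f Al Ad mf f0.
  rewrite !integral_lebesgue_tuple0//; last first.
    by apply: measurableT_comp => //; exact: measurable_affact.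
  by rewrite big_ord0 normr1 mul1e (tuple0 (affact _ _ _)).
have mfA : measurable_fun setT (f \o affact A c).
  by apply: measurableT_comp => //; exact: measurable_affact.
rewrite !integral_lebesgue_tupleS2//.
pose A' := \matrix_(i, j) A (lift ord0 i) (lift ord0 j) : 'M[R]_n.
pose F (t : n.-tuple R) : \bar R := (\int[lebesgue_measure]_x f [tuple of x :: t])%E.
have mF : measurable_fun setT F.
  apply: (@measurable_fun_fubini_tonelli_G _ _ (measurableTypeR R) _ _
    lebesgue_measure (f \o @tcons R n)).
    exact: measurableT_comp mf (@measurable_tcons R n).
  by move=> t; exact: f0.
have F0 t : (0 <= F t)%E by exact: integral_ge0.
have A'0 (i j : 'I_n) : (j < i)%N -> A' i j = 0 by move=> ij; rewrite mxE Al.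
have A'd i : A' i i != 0 by rewrite mxE.
rewrite -[RHS](IH A' (fun i => c (lift ord0 i)) F A'0 A'd mF F0).
rewrite big_ord_recl normrM EFinM (muleC `|_|%:E) -muleA; congr (_ * _)%E.
  by congr (`|_|%:E); apply: eq_bigr => i _; rewrite mxE.
rewrite -ge0_integralZl//; last 2 first.
- apply: (@measurable_fun_fubini_tonelli_G _ _ (measurableTypeR R) _ _
    lebesgue_measure ((f \o affact A c) \o @tcons R n)).
    exact: measurableT_comp mfA (@measurable_tcons R n).
  by move=> t; exact: f0.
- by move=> x _; exact: integral_ge0.
apply: eq_integral => t _.
have Al0 j : A (lift ord0 j) ord0 = 0 by exact: Al.
under eq_integral => x _ do rewrite (affact_upper c x t Al0).
rewrite /F -[RHS](ge0_integral_affine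
  (\sum_j A ord0 (lift ord0 j) * tnth t j + c ord0) (Ad ord0))//.
exact: measurableT_comp mf (measurable_tuple_cons1 _).
Qed.

Definition tperm_tuple n (s : {perm 'I_n}) (t : n.-tuple R) : n.-tuple R :=
  [tuple tnth t (s i) | i < n].

Lemma measurable_tperm_tuple n (s : {perm 'I_n}) : measurable_fun setT (tperm_tuple s).
Proof.
apply/measurable_fun_tnthP => i /=.
rewrite (_ : _ \o _ = (fun t => tnth t (s i))); first exact: measurable_tnth.
by apply/funext => t /=; rewrite tnth_mktuple.
Qed.

Lemma ge0_integral_perm n (s : {perm 'I_n}) (f : n.-tuple R -> \bar R) :
  measurable_fun setT f -> (forall t, 0 <= f t)%E ->
  (\int[lebesgue_tuple R n]_t f (tperm_tuple s t) =
   \int[lebesgue_tuple R n]_t f t)%E.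
Proof.
move=> mf f0.
have mw : measurable_fun [set: n.-tuple R] (fun=> 1 : R) by [].
have := @ge0_integral_transfer R _ _ _ (n.-tuple R) _ _
  (lebesgue_tuple R n) (lebesgue_tuple R n) (tperm_tuple s) id (fun=> 1)
  (fun=> 1) (measurable_tperm_tuple s) (@measurable_id _ _ _) mw mw
  (fun=> ler01) (fun=> ler01) _ f mf f0.
under eq_integral do rewrite mul1e.
under [in RHS]eq_integral do rewrite mul1e.
apply => A mA; rewrite preimage_id.
rewrite (integral_cst (lebesgue_tuple R n) mA 1) mul1e; apply/esym.
pose m := wpush (lebesgue_tuple R n) (measurable_tperm_tuple s) mw
  (fun=> ler01).
apply: (@lebesgue_tuple_unique R n m) => // B mB.
rewrite /m /= /wpush /= (_ : _ @^-1` _ = box (fun i => B ((s^-1)%g i))).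
  have mB' : forall i, measurable (B ((s^-1)%g i)) by move=> i; exact: mB.
  rewrite (integral_cst (lebesgue_tuple R n) (measurable_box mB') 1) mul1e.
  rewrite [LHS](lebesgue_tuple_box mB').
  rewrite [RHS](reindex_inj (@perm_inj _ (s^-1)%g)) /=.
  by apply: eq_bigr.
apply/seteqP; split => t /= h i.
  by have := h ((s^-1)%g i); rewrite tnth_mktuple permKV.
by have := h (s i); rewrite tnth_mktuple permK.
Qed.

(** After a factorization [PA = LU], the permutation and the unit lower triangular factor preserve
    Lebesgue measure, and the diagonal of [U] carries the determinant up to sign. *)
Lemma ge0_integral_linear n (A : 'M[R]_n) c (f : n.-tuple R -> \bar R) :
  A \in unitmx ->
  measurable_fun setT f -> (forall t, 0 <= f t)%E ->
  (`|\det A|%:E * \int[lebesgue_tuple R n]_t f (affact A c t) =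
   \int[lebesgue_tuple R n]_t f t)%E.
Proof.
case: n A c f => [|n] A c f uA mf f0.
  rewrite !integral_lebesgue_tuple0//; last first.
    by apply: measurableT_comp => //; exact: measurable_affact.
  by rewrite det_mx00 normr1 mul1e (tuple0 (affact _ _ _)).
have := cormen_lup_correct A; have := cormen_lup_perm A.
have := cormen_lup_detL A; have := @cormen_lup_lower _ _ A.
have := @cormen_lup_upper _ _ A.
case: (cormen_lup A) => [[P L] U] /= Up Lo detL /is_perm_mxP[s ->{P}] PA.
pose c' i := c (s i).
have affE t : tperm_tuple s (affact A c t) = affact L c' (affact U (fun=> 0) t).
  apply: eq_from_tnth => i; rewrite !tnth_mktuple; congr (_ + _).
  have {}PA : row_perm s A = L *m U by rewrite row_permE.
  transitivity (\sum_j (L *m U) i j * tnth t j).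
    by apply: eq_bigr => j _; rewrite -PA mxE.
  under eq_bigr do rewrite mxE mulr_suml.
  rewrite exchange_big /=; apply: eq_bigr => k _; rewrite tnth_mktuple addr0.
  by rewrite mulr_sumr; apply: eq_bigr => j _; rewrite mulrA.
have detU : \det A = (-1) ^+ s * \prod_i U i i.
  have := congr1 determinant PA.
  rewrite -!mulmxE !det_mulmx det_perm detL mul1r => /(congr1 ( *%R ((-1) ^+ s))).
  rewrite mulrA -signr_addb addbb mul1r => ->; congr (_ * _).
  rewrite -det_tr det_trig; first by apply: eq_bigr => i _; rewrite mxE.
  by apply/is_trig_mxP => i j ij; rewrite mxE Up.
have Ud : forall i, U i i != 0.
  move: uA; rewrite unitmxE unitfE detU mulf_eq0 signr_eq0 /=.
  by move=> /prodf_neq0 h i; exact: h.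
have L1 i : L i i = 1 by rewrite Lo// eqxx.
have Ld i : L i i != 0 by rewrite L1 oner_eq0.
rewrite detU normrM normrX normrN1 expr1n mul1r.
pose g := f \o tperm_tuple (s^-1)%g.
have mg : measurable_fun setT g.
  by apply: measurableT_comp mf _; exact: measurable_tperm_tuple.
have g0 t : (0 <= g t)%E by exact: f0.
have fE t : f (affact A c t) = g (affact L c' (affact U (fun=> 0) t)).
  rewrite -affE /g /=; congr f; apply: eq_from_tnth => i.
  by rewrite !tnth_mktuple permKV.
under eq_integral do rewrite fE.
have mgL : measurable_fun setT (g \o affact L c').
  by apply: measurableT_comp mg _; exact: measurable_affact.
have gL0 t : (0 <= (g \o affact L c') t)%E by exact: f0.
have Ll (i j : 'I_n.+1) : (i < j)%N -> L i j = 0.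
  by move=> ij; rewrite Lo ?(ltnW ij)// -val_eqE/= ltn_eqF.
rewrite -[RHS](ge0_integral_perm (s^-1)%g mf f0).
have -> := ge0_integral_upper (fun=> 0) Up Ud mgL gL0.
rewrite -[RHS](ge0_integral_lower c' Ll Ld mg g0).
by rewrite (eq_bigr (fun=> 1)) ?big1_eq ?normr1 ?mul1e// => i _; rewrite L1.
Qed.

End LinearChange.

(** * Substitution along a polynomial that increases on an upper ray *)

Section MonotoneSubstitution.
Context (R : realType) (P : {poly R}) (I : set R).
Hypotheses (Iup : forall s t, I s -> s <= t -> I t)
  (Iopen : forall s, I s -> exists2 r, I r & r < s)
  (dP : forall s, I s -> 0 < (P^`()).[s])
  (Pgrow : forall s c, I s -> exists2 t, s <= t & c <= P.[t]).

Let muR : {measure set (measurableTypeR R) -> \bar R} := @lebesgue_measure R.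

Let horner_incr s t : I s -> s < t -> P.[s] < P.[t].
Proof.
move=> Is st; have ct : {within `[s, t], continuous (horner P)}.
  by apply: continuous_subspaceT; exact: continuous_horner.
have dt : forall x, x \in `]s, t[ -> is_derive x 1 (horner P) (P^`()).[x].
  move=> x _; apply: DeriveDef; first exact: derivable_horner.
  by rewrite -derive1E -derivE.
have [c /[!in_itv]/= /andP[sc _] PE] := MVT st dt ct.
by rewrite -subr_gt0 PE mulr_gt0 ?subr_gt0// dP//; apply: Iup Is _; exact: ltW.
Qed.

Let horner_le s t : I s -> s <= t -> P.[s] <= P.[t].
Proof. by move=> Is; rewrite le_eqVlt => /predU1P[->//|/(horner_incr Is)/ltW]. Qed.

Let horner_lt s t : I s -> I t -> (P.[s] < P.[t]) = (s < t).
Proof.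
move=> Is It; apply/idP/idP; last exact: horner_incr.
by apply: contraTT; rewrite -!leNgt; exact: horner_le.
Qed.

Let horner_onto s c : I s -> P.[s] <= c -> exists2 t, s <= t & P.[t] = c.
Proof.
move=> Is sc; have [t st ct] := Pgrow c Is.
have := @IVT _ (horner P) s t c st.
case.
- by apply: continuous_subspaceT; exact: continuous_horner.
- by rewrite ge_min sc/= le_max ct orbT.
- by move=> x /[!in_itv]/= /andP[sx _] xc; exists x.
Qed.

Let FTC u v : u < v ->
  (\int[lebesgue_measure]_(x in `]u, v]) ((P^`()).[x])%:E = (P.[v] - P.[u])%:E)%E.
Proof.
move=> uv; rewrite integral_itv_obnd_cbnd; last first.
  by apply/measurable_EFinP; exact: measurable_poly.
rewrite (@continuous_FTC2 _ (horner P^`()) (horner P))//.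
- by apply: continuous_subspaceT; exact: continuous_horner.
- split.
  + by move=> x _; exact: derivable_horner.
  + by apply: cvg_at_right_filter; exact: continuous_horner.
  + by apply: cvg_at_left_filter; exact: continuous_horner.
- by move=> x _; rewrite -derivE.
Qed.

(** Cutting the derivative off at a point [s0] of [I] keeps the preimages of intervals inside
    compact intervals, where the fundamental theorem of calculus applies. *)
Let w s0 x : R := if s0 < x then (P^`()).[x] else 0.

Let mw s0 : measurable_fun setT (w s0).
Proof.
apply: measurable_fun_ifT; [exact: measurable_fun_ltr|exact: measurable_poly|].
exact: measurable_cst.
Qed.

Let w_ge0 s0 x : I s0 -> 0 <= w s0 x.
Proof.
by rewrite /w => Is; case: ifPn => // /ltW sx; apply/ltW/dP; exact: Iup Is sx.
Qed.

Let w2 s0 (x : R) : R := if P.[s0] < x then 1 else 0.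

Let mw2 s0 : measurable_fun setT (w2 s0).
Proof. by apply: measurable_fun_ifT => //; exact: measurable_fun_ltr. Qed.

Let w2_ge0 s0 x : 0 <= w2 s0 x.
Proof. by rewrite /w2; case: ifP. Qed.

Let substitution_ray s0 (f : R -> \bar R) : I s0 ->
  measurable_fun setT f -> (forall x, 0 <= f x)%E ->
  (\int[lebesgue_measure]_x ((w s0 x)%:E * f P.[x]) =
   \int[lebesgue_measure]_x ((w2 s0 x)%:E * f x))%E.
Proof.
move=> Is0 mf f0.
have mP : measurable_fun [set: measurableTypeR R]
    (horner P : measurableTypeR R -> measurableTypeR R).
  exact: measurable_poly.
apply: (@ge0_integral_transfer R _ _ _ (measurableTypeR R) (measurableTypeR R)
  (measurableTypeR R) muR muR (horner P) id (w s0) (w2 s0)) => //.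
- exact: mw.
- exact: mw2.
- by move=> x; exact: w_ge0.
move=> A mA.
pose m1 : {measure set (measurableTypeR R) -> \bar R} := wpush muR mP (mw s0) (fun x => w_ge0 x Is0).
pose m2 : {measure set (measurableTypeR R) -> \bar R} := wpush muR (@measurable_id _ (measurableTypeR R) setT) (mw2 s0) (@w2_ge0 s0).
have m12 a b : m1 `]a, b]%classic = m2 `]a, b]%classic /\
    (m1 `]a, b]%classic < +oo)%E.
  rewrite /m1 /m2 /= /wpush /= preimage_id.
  (* Values at or below [P.[s0]] are not taken beyond [s0], so only []a', b]] counts; its preimage
     is []u, v]], of weight [P.[v] - P.[u]]. *)
  set a' := Num.max a P.[s0].
  have [ba|ab] := leP b a'.
    rewrite !integral0_eq ?ltry// => x /=; rewrite in_itv/= => /andP[ax xb].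
      rewrite /w2; case: ifPn => // sx; exfalso.
      by move: (le_trans xb ba); rewrite leNgt gt_max ax sx.
    rewrite /w; case: ifPn => // sx; exfalso.
    move: (le_trans xb ba); rewrite leNgt gt_max ax/=.
    by rewrite horner_incr.
  have [u su Pu] : exists2 u, s0 <= u & P.[u] = a'.
    by apply: horner_onto => //; rewrite le_max lexx orbT.
  have [v uv Pv] : exists2 v, u <= v & P.[v] = b.
    by apply: horner_onto; [exact: (Iup (s := s0))|rewrite Pu ltW].
  have Iu : I u by exact: (Iup (s := s0)).
  have uv' : u < v by rewrite -(horner_lt Iu (Iup Iu uv)) Pu Pv.
  have -> : (\int[muR]_(x in horner P @^-1` `]a, b]) (w s0 x)%:E =
             \int[muR]_(x in `]u, v]) ((P^`()).[x])%:E)%E.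
    rewrite integral_mkcond [RHS]integral_mkcond; apply: eq_integral => x _.
    have xE : (x \in horner P @^-1` `]a, b]%classic) = (a < P.[x] <= b).
      by apply/idP/idP; rewrite inE /= in_itv.
    rewrite /patch xE mem_setE in_itv/= /w.
    have [sx|xs] := ltP s0 x; last first.
      by rewrite [u < x]ltNge (le_trans xs su)/=; case: ifP.
    have Ix : I x by apply: (Iup (s := s0)) => //; exact: ltW.
    rewrite -(horner_lt Iu Ix) Pu -Pv gt_max (horner_incr Is0 sx) andbT.
    by rewrite !(leNgt _ v, leNgt _ P.[v]) horner_lt//; exact: Iup uv.
  have -> : (\int[muR]_(x in `]a, b]) (w2 s0 x)%:E =
             \int[muR]_(x in `]a', b]) 1)%E.
    rewrite integral_mkcond [RHS]integral_mkcond; apply: eq_integral => x _.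
    rewrite /patch !mem_setE /= !in_itv/= /w2 gt_max.
    by case: (a < x); case: (P.[s0] < x); case: (x <= b).
  rewrite FTC// Pu Pv ltry; split => //.
  rewrite (integral_cst muR (measurable_itv `]a', b]) 1) mul1e.
  by rewrite [RHS](lebesgue_measure_itv `]a', b])/= lte_fin ab.
suff : m1 A = m2 A by [].
refine (@measure_unique _ R (measurableTypeR R) (@ocitv R)
  (fun k => `]- k%:R, k%:R]%classic) erefl (@ocitvI R) _ _ m1 m2 _ _ A mA).
- by move=> k; exact: is_ocitv.
- apply/seteqP; split => // x _; exists (Num.truncn `|x|).+1 => //=.
  have := @truncnS_gt _ `|x|; rewrite ltr_norml in_itv/= => /andP[-> /ltW].
  by [].
- by move=> _ [[a b] _ <-]; exact: (m12 a b).1.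
- by move=> k; exact: (m12 _ _).2.
Qed.

(** Take [inf I + 1/(k+1)] when [I] is bounded below and [-k] otherwise. Openness of [I] at its
    lower end puts each of its points strictly above the infimum, hence above some [s k]. *)
Let ray_sequence s0 : I s0 -> exists s : R^nat,
  [/\ forall k, I (s k), {homo s : k l / (k <= l)%N >-> l <= k} &
      forall x, I x -> exists k, s k < x].
Proof.
move=> Is0; have [hl|nl] := pselect (has_lbound I).
  have hinf : has_inf I by split => //; exists s0.
  have infI x : I x -> inf I < x.
    move=> /Iopen[r Ir rx]; apply: le_lt_trans rx.
    exact: ge_inf.
  exists (fun k => inf I + k.+1%:R^-1); split.
  - move=> k; have k0 : 0 < k.+1%:R^-1 :> R by rewrite invr_gt0.
    have [r Ir rlt] := inf_adherent k0 hinf.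
    by apply: Iup Ir _; exact: ltW.
  - by move=> k l kl; rewrite lerD2l lef_pV2 ?posrE// ler_nat.
  - move=> x /infI; rewrite -subr_gt0 => x0.
    exists (Num.truncn (x - inf I)^-1); rewrite -ltrBrDl.
    by rewrite invf_plt ?posrE// truncnS_gt.
exists (fun k => - k%:R); split.
- move=> k; apply: contrapT => nI; apply: nl; exists (- k%:R) => x Ix.
  by rewrite leNgt; apply/negP => xk; apply: nI; apply: Iup Ix _; exact: ltW.
- by move=> k l kl; rewrite lerN2 ler_nat.
- move=> x _; exists (Num.truncn `|x|).+1.
  by have := @truncnS_gt _ `|x|; rewrite ltr_norml => /andP[].
Qed.

(** Rays starting at points that decrease through [I] exhaust it, and monotone convergence passes to
    the limit on both sides. The support condition on [f] confines the right-hand integral to the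
    image of [I]. *)
Lemma ge0_integral_horner (f : R -> \bar R) :
  measurable I -> measurable_fun setT f -> (forall x, 0 <= f x)%E ->
  (forall c, f c != 0%E -> exists2 s, I s & P.[s] = c) ->
  (\int[lebesgue_measure]_x ((\1_I x * (P^`()).[x])%:E * f P.[x]) =
   \int[lebesgue_measure]_x f x)%E.
Proof.
move=> mI mf f0 fI.
have [Is0|NI] := pselect (exists s0, I s0); last first.
  have I0 x : ~ I x by move=> Ix; apply: NI; exists x.
  rewrite !integral0_eq// => x _.
    by apply/eqP; apply: contraT => /fI[s /I0].
  by rewrite indicE memNset ?mul0r ?mul0e//; exact: I0.
case: Is0 => s0 /ray_sequence[s [Is sle sI]].
transitivity (limn (fun k => \int[lebesgue_measure]_x
    ((w (s k) x)%:E * f P.[x])))%E.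
  rewrite -monotone_convergence//.
  - apply: eq_integral => x _; apply/esym/cvg_lim => //.
    have [Ix|nIx] := pselect (I x).
      rewrite indicE mem_set// mul1r; apply: cvg_near_cst.
      have [k0 kx] := sI _ Ix; exists k0 => // k /= kk.
      by rewrite /w (le_lt_trans (sle _ _ kk) kx).
    rewrite indicE memNset// mul0r; apply: cvg_near_cst; apply: nearW => k.
    rewrite /w ifF//; apply/negbTE; rewrite -leNgt leNgt; apply/negP => kx.
    by apply: nIx; apply: Iup (Is k) _; exact: ltW.
  - move=> k; apply: emeasurable_funM.
      by apply/measurable_EFinP; exact: mw.
    by apply: measurableT_comp mf _; exact: measurable_poly.
  - by move=> k x _; rewrite mule_ge0// lee_fin w_ge0.
  - move=> x _ k l kl; rewrite lee_wpmul2r// lee_fin /w.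
    case: ifPn => kx; last by case: ifPn => // lx; exact/ltW/dP/(Iup (Is l))/ltW.
    by rewrite (le_lt_trans (sle _ _ kl) kx).
under eq_fun do rewrite substitution_ray//.
rewrite -monotone_convergence//.
- apply: eq_integral => x _; apply/cvg_lim => //.
  have [fx0|/fI[t It Pt]] := eqVneq (f x) 0%E.
    by rewrite fx0; under eq_fun do rewrite mule0; exact: cvg_cst.
  have [k0 kt] := sI _ It; rewrite -[X in _ --> X]mul1e.
  apply: cvg_near_cst; exists k0 => // k /= kk.
  by rewrite /w2 -Pt horner_lt// (le_lt_trans (sle _ _ kk) kt).
- move=> k; apply: emeasurable_funM => //.
  by apply/measurable_EFinP; exact: mw2.
- by move=> k x _; rewrite mule_ge0// lee_fin w2_ge0.
- move=> x _ k l kl; rewrite lee_wpmul2r// lee_fin /w2.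
  case: ifPn => kx; last by case: ifP.
  by rewrite (le_lt_trans _ kx)// horner_le// sle.
Qed.

End MonotoneSubstitution.

(** * From roots to coefficients *)

Section PositiveDerivatives.
Context (R : realType).
Implicit Types (p q : {poly R}) (s t : R).

(** For a monic real-rooted polynomial of degree [d - 1] this says that [t] lies to the right of all
    roots ([dpos_rootp]). Unlike that condition it can be read off the coefficients, hence it is
    measurable in them. *)
Definition dpos d p t : bool := [forall k : 'I_d, 0 < (p^`(k)).[t]].

Lemma dposP d p t : reflect (forall k, (k < d)%N -> 0 < (p^`(k)).[t]) (dpos d p t).
Proof.
by apply: (iffP forallP) => [h k kd|h k]; [exact: (h (Ordinal kd))|exact: h].
Qed.

Lemma dpos_ge0 d p t : (size p <= d)%N -> dpos d p t ->
  forall k, 0 <= (p^`(k)).[t].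
Proof.
move=> pd /dposP h k; have [kd|dk] := ltnP k d; first exact/ltW/h.
by rewrite derivn_poly0 ?horner0// (leq_trans pd).
Qed.

(** All terms of the Taylor expansion at [s] are nonnegative, and the first two form the tangent
    line. *)
Lemma horner_taylor_le p s t : (forall k, 0 <= (p^`(k)).[s]) -> s <= t ->
  p.[s] + (p^`()).[s] * (t - s) <= p.[t].
Proof.
move=> h st; rewrite (_ : p.[t] = p.[s + (t - s)]); last by rewrite addrC subrK.
rewrite (@nderiv_taylor_wide _ (size p).+2) ?leqW//; last exact: mulrC.
rewrite 2!big_ord_recl /= expr0 mulr1 expr1 nderivn0 nderivn1 addrA lerDl.
apply: sumr_ge0 => i _; rewrite mulr_ge0 ?exprn_ge0 ?subr_ge0//.
have := h i.+2; rewrite nderivn_def hornerMn.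
by rewrite pmulrn_lge0// fact_gt0.
Qed.

Lemma dpos_le d p s t : (size p <= d)%N -> s <= t -> dpos d p s -> dpos d p t.
Proof.
move=> pd st ps; apply/dposP => k kd.
have h j : 0 <= ((p^`(k))^`(j)).[s].
  by rewrite /derivn -iterD; exact: (dpos_ge0 pd ps (j + k)).
have := horner_taylor_le h st; apply: lt_le_trans.
rewrite ltr_pwDl//; first exact: (dposP _ _ _ ps).
by rewrite mulr_ge0 ?subr_ge0//; exact: (h 1%N).
Qed.

Lemma dpos_open d p s : dpos d p s -> exists2 r, dpos d p r & r < s.
Proof.
move=> /forallP ps.
have : \forall r \near s^'-, (forall k : 'I_d, 0 < (p^`(k)).[r]) /\ r < s.
  apply: filterI; last exact: nbhs_left_lt.
  have near_k (k : 'I_d) : \forall r \near s^'-, 0 < (p^`(k)).[r].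
    have : (p^`(k)).[r] @[r --> s^'-] --> (p^`(k)).[s].
      by apply: cvg_at_left_filter; exact: continuous_horner.
    by move=> /cvgr_gt; apply.
  exact: (filter_forall _ near_k).
by move=> /filter_ex[r [rp rs]]; exists r => //; exact/forallP.
Qed.

Lemma dpos_grow d p s c : (size p^`() <= d)%N -> (0 < d)%N -> dpos d p^`() s ->
  exists2 t, s <= t & c <= p.[t].
Proof.
move=> pd d0 ps; set a := (p^`()).[s].
have a0 : 0 < a by exact: (dposP _ _ _ ps 0%N).
(* The point where the tangent line at [s] has risen by the distance from [p.[s]] to [c]. *)
exists (s + `|c - p.[s]| / a); first by rewrite lerDl divr_ge0// ltW.
have hk k : 0 <= ((p^`())^`(k)).[s] by exact: dpos_ge0 ps k.
have st : s <= s + `|c - p.[s]| / a by rewrite lerDl divr_ge0// ltW.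
(* Only the derivatives of [p] are known to be nonnegative at [s]; the added constant makes the
   Taylor bound applicable and cancels afterwards. *)
pose q := p + (`|p.[s]|)%:P.
have h k : 0 <= (q^`(k)).[s].
  case: k => [|k]; last first.
    by rewrite derivSn /q derivD derivC addr0; exact: hk.
  by rewrite /q derivn0 hornerD hornerC -lerBlDr sub0r lerNl ler_normr lexx orbT.
have := horner_taylor_le h st; rewrite /q derivD derivC addr0 !hornerD !hornerC.
rewrite addrAC lerD2r; apply: le_trans; rewrite -/a [s + _]addrC addrK.
by rewrite mulrC divfK ?gt_eqF// -lerBlDl ler_norm.
Qed.

(** By Leibniz, the derivative of order [k + 1] at [t] is
    [(k + 1) q^(k)(t) + (t - x) q^(k+1)(t)]. *)
Lemma dpos_XsubCM d (q : {poly R}) x t : x < t -> dpos d q t ->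
  dpos d (('X - x%:P) * q) t.
Proof.
move=> xt /dposP qt; apply/dposP => -[|k] kd.
  by rewrite derivn0 hornerM hornerXsubC mulr_gt0 ?subr_gt0//; exact: (qt 0%N).
rewrite mulrBl mulrC mul_polyC derivnB derivnZ.
have := derivnMXaddC k q 0; rewrite polyC0 addr0 => ->.
have -> : (q^`(k) *+ k.+1 + q^`(k.+1) * 'X - x *: q^`(k.+1)).[t] =
    (q^`(k)).[t] *+ k.+1 + (t - x) * (q^`(k.+1)).[t].
  by rewrite !(hornerD, hornerN, hornerZ, hornerM, hornerX, hornerMn); ring.
rewrite addr_gt0//.
  by rewrite pmulrn_lgt0//; apply: qt; exact: ltnW.
by rewrite mulr_gt0 ?subr_gt0//; exact: qt.
Qed.

End PositiveDerivatives.

Section RealRootedPolynomials.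
Context (R : realType).
Implicit Types (m : nat) (p q : {poly R}) (x t : R).

Definition mpoly m (c : m.-tuple R) : {poly R} :=
  'X^m + \sum_(i < m) tnth c i *: 'X^i.

Lemma coef_sum_scaleX m (c : m.-tuple R) i :
  (\sum_(i < m) tnth c i *: 'X^i)`_i = nth 0 c i.
Proof.
rewrite coef_sum; have [im|mi] := ltnP i m; last first.
  rewrite nth_default ?size_tuple// big1// => j _.
  by rewrite coefZ coefXn gtn_eqF ?mulr0// (leq_trans (ltn_ord j)).
rewrite (bigD1 (Ordinal im))//= coefZ coefXn eqxx mulr1 big1 ?addr0.
  by rewrite (tnth_nth 0).
move=> j; rewrite -val_eqE/= => ji; rewrite coefZ coefXn.
by rewrite eq_sym (negbTE ji) mulr0.
Qed.

Lemma coef_mpoly m (c : m.-tuple R) (i : 'I_m) : (mpoly c)`_i = tnth c i.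
Proof.
rewrite coefD coefXn ltn_eqF// add0r coef_sum_scaleX.
by rewrite (tnth_nth 0).
Qed.

Lemma size_mpoly m (c : m.-tuple R) : size (mpoly c) = m.+1.
Proof.
rewrite size_addl size_polyXn// ltnS.
apply: (leq_trans (size_sum _ _ _)); apply/bigmax_leqP => i _.
by apply: (leq_trans (size_scale_leq _ _)); rewrite size_polyXn.
Qed.

Lemma monic_mpoly m (c : m.-tuple R) : mpoly c \is monic.
Proof.
rewrite monicE lead_coefE size_mpoly/= coefD coefXn eqxx coef_sum_scaleX.
by rewrite nth_default ?addr0// size_tuple.
Qed.

Lemma mpolyP m p : p \is monic -> size p = m.+1 ->
  mpoly [tuple p`_i | i < m] = p.
Proof.
move=> pm ps; apply/polyP => i; rewrite coefD coefXn coef_sum_scaleX.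
have [im|mi|->] := ltngtP i m.
- by rewrite add0r -(tnth_nth 0 _ (Ordinal im)) tnth_mktuple.
- by rewrite add0r !nth_default// ?ps// size_tuple ltnW.
- move: pm; rewrite monicE lead_coefE ps => /eqP ->.
  by rewrite nth_default ?addr0// size_tuple.
Qed.

Lemma mpoly_inj m : injective (@mpoly m).
Proof.
by move=> c1 c2 c12; apply: eq_from_tnth => i; rewrite -!coef_mpoly c12.
Qed.

Lemma mpoly_cons m x (c : m.-tuple R) :
  mpoly [tuple of x :: c] = mpoly c * 'X + x%:P.
Proof.
rewrite /mpoly big_ord_recl tnth0 expr0 alg_polyC mulrDl -exprSr -addrA.
congr (_ + _); rewrite addrC; congr (_ + _); rewrite mulr_suml.
by apply: eq_bigr => i _; rewrite tnthS -scalerAl -exprSr.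
Qed.

Definition rootp m (l : m.-tuple R) : {poly R} :=
  \prod_(i < m) ('X - (tnth l i)%:P).

Lemma monic_rootp m (l : m.-tuple R) : rootp l \is monic.
Proof. exact: monic_prod_XsubC. Qed.

Lemma size_rootp m (l : m.-tuple R) : size (rootp l) = m.+1.
Proof. by rewrite size_prod_XsubC; congr _.+1; rewrite -[RHS]size_enum_ord enumT. Qed.

Definition coefs m (l : m.-tuple R) : m.-tuple R := [tuple (rootp l)`_i | i < m].

Lemma mpoly_coefs m (l : m.-tuple R) : mpoly (coefs l) = rootp l.
Proof. by apply: mpolyP; [exact: monic_rootp|exact: size_rootp]. Qed.

Lemma rootp_cons m x (l : m.-tuple R) :
  rootp [tuple of x :: l] = ('X - x%:P) * rootp l.
Proof.
rewrite /rootp big_ord_recl tnth0; congr (_ * _).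
by apply: eq_bigr => i _; rewrite tnthS.
Qed.

Lemma horner_rootp m (l : m.-tuple R) x :
  (rootp l).[x] = \prod_(i < m) (x - tnth l i).
Proof. by rewrite horner_prod; apply: eq_bigr => i _; rewrite hornerXsubC. Qed.

Definition below m (l : m.-tuple R) t : bool := [forall j, tnth l j < t].

(** Positivity persists to the right of [t], which excludes a root there. Conversely the factors are
    added one at a time; the derivative of top order is treated apart and read off the leading
    coefficient. *)
Lemma dpos_rootp m (l : m.-tuple R) t : dpos m.+1 (rootp l) t = below l t.
Proof.
apply/idP/forallP => [h j|h].
  rewrite ltNge; apply/negP => tl.
  have := dposP _ _ _ (dpos_le _ tl h) 0%N (ltn0Sn _).
  rewrite size_rootp => /(_ (leqnn _)); rewrite derivn0 horner_rootp (bigD1 j)//=.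
  by rewrite subrr mul0r ltxx.
elim: m l h => [|m IH] l h.
  apply/dposP => -[|//] _; rewrite derivn0 horner_rootp big_ord0//.
have [x [l' lE]] : exists x, exists l' : m.-tuple R, l = [tuple of x :: l'].
  by case/tupleP: l {h} => x l'; exists x, l'.
rewrite lE rootp_cons; apply/dposP => k.
rewrite ltnS leq_eqVlt => /predU1P[->|km]; last first.
  apply: (dposP m.+1) => //; apply: dpos_XsubCM.
    by have := h ord0; rewrite lE tnth0.
  by apply: IH => j; have := h (lift ord0 j); rewrite lE tnthS.
rewrite -rootp_cons nderivn_def hornerMn pmulrn_lgt0 ?fact_gt0//.
set p := rootp _; have ps : size p = m.+2 by exact: size_rootp.
rewrite (_ : p^`N(m.+1) = 1) ?hornerC//.
have := monic_rootp [tuple of x :: l']; rewrite -/p monicE lead_coefE ps => /eqP pm.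
apply/polyP => i; rewrite coef_nderivn coef1 addSn.
case: i => [|i]; first by rewrite addn0 pm binn.
by rewrite nth_default ?mul0rn// ps addnS !ltnS leq_addr.
Qed.

(** Boolean, so that it can serve as a numerical indicator in densities. *)
Definition sdec m (l : m.-tuple R) : bool :=
  [forall i : 'I_m, forall j : 'I_m, (i < j)%N ==> (tnth l j < tnth l i)].

Lemma sdecP m (l : m.-tuple R) :
  reflect (forall i j : 'I_m, (i < j)%N -> tnth l j < tnth l i) (sdec l).
Proof.
apply: (iffP forallP) => [h i j ij|h i].
  by have /forallP/(_ j)/implyP := h i; apply.
by apply/forallP => j; apply/implyP; exact: h.
Qed.

Lemma sdec_cons m x (l : m.-tuple R) :
  sdec [tuple of x :: l] = below l x && sdec l.
Proof.
apply/sdecP/andP => [h|[/forallP xl /sdecP lp] i j].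
  split; first by apply/forallP => j; have := h ord0 (lift ord0 j); rewrite tnth0 tnthS; exact.
  by apply/sdecP => i j ij; have := h (lift ord0 i) (lift ord0 j); rewrite !tnthS; exact.
case: (unliftP ord0 j) => [j' ->|->]; last by rewrite ltn0.
rewrite tnthS; case: (unliftP ord0 i) => [i' ->|->]; last by rewrite tnth0.
by rewrite tnthS; exact: lp.
Qed.

Definition vand m (l : m.-tuple R) : R :=
  \prod_(i < m) \prod_(j < m | (i < j)%N) (tnth l i - tnth l j).

Lemma vand_cons m x (l : m.-tuple R) :
  vand [tuple of x :: l] = (rootp l).[x] * vand l.
Proof.
rewrite /vand big_ord_recl horner_rootp; congr (_ * _).
  rewrite big_mkcond big_ord_recl/= mul1r; apply: eq_bigr => j _.
  by rewrite tnth0 tnthS.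
apply: eq_bigr => i _; rewrite big_mkcond big_ord_recl/= mul1r [RHS]big_mkcond.
by apply: eq_bigr => j _; rewrite !tnthS.
Qed.

Lemma vand_gt0 m (l : m.-tuple R) : sdec l -> 0 < vand l.
Proof.
move=> /sdecP lp; apply: prodr_gt0 => i _; apply: prodr_gt0 => j ij.
by rewrite subr_gt0 lp.
Qed.

End RealRootedPolynomials.

(** * Measurability of functions of tuples and polynomials *)

Section MeasurabilityTools.
Context (R : realType) d (T : measurableType d).

Lemma measurable_forall (I : finType) (b : I -> T -> bool) :
  (forall i, measurable_fun setT (b i)) ->
  measurable_fun setT (fun x => [forall i, b i x]).
Proof.
move=> mb; apply: (measurable_fun_bool true).
rewrite setTI (_ : _ @^-1` _ = \bigcap_(i in [set: I]) (b i @^-1` [set true])).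
  apply: fin_bigcap_measurable => // i _.
  by rewrite -[X in measurable X]setTI; exact: mb.
apply/seteqP; split => x /=.
  by move=> /forallP h i _; exact: h.
by move=> h; apply/forallP => i; exact: h.
Qed.

Lemma measurable_natr_bool (b : T -> bool) : measurable_fun setT b ->
  measurable_fun setT (fun x => (b x)%:R : R).
Proof.
move=> mb; rewrite (_ : (fun _ => _) = (fun x => if b x then 1 else 0)).
  exact: measurable_fun_ifT.
by apply/funext => x; case: (b x).
Qed.

Lemma measurable_tnth_comp dS (S : measurableType dS) n (f : T -> n.-tuple S) i :
  measurable_fun setT f -> measurable_fun setT (fun x => tnth (f x) i).
Proof. by move=> mf; exact: (measurableT_comp (measurable_tnth i) mf). Qed.

Lemma measurable_mktuple dS (S : measurableType dS) n (f : 'I_n -> T -> S) :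
  (forall i, measurable_fun setT (f i)) ->
  measurable_fun setT (fun x => [tuple f i x | i < n]).
Proof.
move=> mf; apply/measurable_fun_tnthP => i.
by rewrite (_ : _ \o _ = f i)//; apply/funext => x /=; rewrite tnth_mktuple.
Qed.

Lemma measurable_coef_mulXsubC (a : T -> R) (p : T -> {poly R}) :
  measurable_fun setT a -> (forall k, measurable_fun setT (fun x => (p x)`_k)) ->
  forall k, measurable_fun setT (fun x => (('X - (a x)%:P) * p x)`_k).
Proof.
move=> ma mp k; under eq_fun do rewrite mulrBl coefB coefXM coefCM.
by apply: measurable_funB; [case: k|exact: measurable_funM].
Qed.

Lemma measurable_coef_prod_XsubC n (f : 'I_n -> T -> R) :
  (forall i, measurable_fun setT (f i)) ->
  forall k, measurable_fun setT (fun x => (\prod_(i < n) ('X - (f i x)%:P))`_k).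
Proof.
elim: n f => [|n IH] f mf k; first by under eq_fun do rewrite big_ord0; exact: measurable_cst.
under eq_fun do rewrite big_ord_recl.
by apply: (measurable_coef_mulXsubC (mf ord0)); exact: IH.
Qed.

Lemma measurable_coefs n (f : T -> n.-tuple R) :
  measurable_fun setT f -> measurable_fun setT (fun x => coefs (f x)).
Proof.
move=> mf; apply: measurable_mktuple => i; apply: measurable_coef_prod_XsubC => j.
exact: measurable_tnth_comp.
Qed.

Lemma measurable_horner_mpoly n (c : T -> n.-tuple R) (a : T -> R) k :
  measurable_fun setT c -> measurable_fun setT a ->
  measurable_fun setT (fun x => ((mpoly (c x))^`(k)).[a x]).
Proof.
move=> mc ma.
have mX i : measurable_fun setT (fun x => (('X^i : {poly R})^`(k)).[a x]).
  by apply: (measurableT_comp _ ma); exact: measurable_poly.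
rewrite (_ : (fun _ => _) = fun x => ('X^n^`(k)).[a x] +
    \sum_(i < n) tnth (c x) i * ('X^i^`(k)).[a x]).
  apply: measurable_funD => //; apply: measurable_sum => i.
  by apply: measurable_funM => //; exact: measurable_tnth_comp.
apply/funext => x; rewrite /mpoly linearD hornerD linear_sum horner_sum.
by congr (_ + _); apply: eq_bigr => i _; rewrite linearZ hornerZ.
Qed.

Lemma measurable_sdec n (f : T -> n.-tuple R) :
  measurable_fun setT f -> measurable_fun setT (fun x => sdec (f x)).
Proof.
move=> mf; apply: measurable_forall => i; apply: measurable_forall => j.
have [ij|] := boolP (i < j)%N; last by [].
by apply: measurable_fun_ltr; exact: measurable_tnth_comp.
Qed.

Lemma measurable_vand n (f : T -> n.-tuple R) :
  measurable_fun setT f -> measurable_fun setT (fun x => vand (f x)).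
Proof.
move=> mf; apply: measurable_prod => i _.
rewrite (_ : (fun _ => _) = fun x => \prod_(j < n)
    (if (i < j)%N then tnth (f x) i - tnth (f x) j else 1)); last first.
  by apply/funext => x; rewrite big_mkcond.
apply: measurable_prod => j _; case: (i < j)%N; last exact: measurable_cst.
by apply: measurable_funB; exact: measurable_tnth_comp.
Qed.

End MeasurabilityTools.

(** * The Jacobian of the map from roots to coefficients *)

Section RootsCoefficients.
Context (R : realType).

Lemma derivn_XsubCM_horner (q : {poly R}) x k :
  ((('X - x%:P) * q)^`(k.+1)).[x] = (q^`(k)).[x] *+ k.+1.
Proof.
rewrite mulrBl mulrC mul_polyC derivnB derivnZ.
have := derivnMXaddC k q 0; rewrite polyC0 addr0 => ->.
by rewrite !(hornerD, hornerN, hornerZ, hornerM, hornerX, hornerMn); ring.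
Qed.

(** The coefficients of order 1 to [n] of [(X - x) g], with [g] monic of degree [n]; the constant
    coefficient is left out because it is the one traded for the root [x]. *)
Definition shear n (x : R) (g : n.-tuple R) : n.-tuple R :=
  [tuple tnth g i - x * (mpoly g)`_i.+1 | i < n].

Lemma mpoly_shear n x (g : n.-tuple R) :
  ('X - x%:P) * mpoly g = mpoly (shear x g) * 'X + (- (x * (mpoly g).[0]))%:P.
Proof.
apply/polyP => -[|k].
  by rewrite mulrBl coefB coefD coefXM coefMX coefCM coefC/= horner_coef0 !add0r.
rewrite mulrBl coefB coefD coefXM coefMX coefCM coefC/= addr0.
have [kn|nk] := ltnP k n.
  rewrite (coef_mpoly _ (Ordinal kn)) -[in RHS]/(nat_of_ord (Ordinal kn)).
  by rewrite coef_mpoly tnth_mktuple.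
rewrite [X in _ - _ * X]nth_default ?size_mpoly// mulr0 subr0.
rewrite !coefD !coefXn; congr (_ + _).
by rewrite !coef_sum_scaleX !nth_default ?size_tuple.
Qed.

Let shear_mx n (x : R) : 'M[R]_n :=
  \matrix_(i, j) ((i == j)%:R - x * (j == i.+1 :> nat)%:R).

(** The matrix is upper triangular with unit diagonal, so the shear preserves Lebesgue measure. The
    translation comes from the leading coefficient 1 of [mpoly g], which only the last entry
    sees. *)
Let shear_affact n x (g : n.-tuple R) :
  shear x g = affact (shear_mx n x) (fun i => - (x * (i.+1 == n)%:R)) g.
Proof.
apply: eq_from_tnth => i; rewrite !tnth_mktuple.
under eq_bigr do rewrite mxE mulrBl.
rewrite sumrB (bigD1 i)//= eqxx mul1r big1 ?addr0; last first.
  by move=> j ji; rewrite eq_sym (negbTE ji) mul0r.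
rewrite -addrA -opprD; congr (_ - _).
under eq_bigr do rewrite -mulrA; rewrite -mulr_sumr -mulrDr; congr (_ * _).
rewrite coefD coefXn addrC coef_sum_scaleX; congr (_ + _).
have [iN|Ni] := ltnP i.+1 n; last first.
  rewrite nth_default ?size_tuple// big1// => j _.
  by rewrite ltn_eqF ?mul0r// (leq_trans _ Ni).
rewrite (bigD1 (Ordinal iN))//= eqxx mul1r big1 ?addr0 ?(tnth_nth 0)// => j.
by rewrite -val_eqE/= => /negbTE ->; rewrite mul0r.
Qed.

Let integral_shear n x (f : n.-tuple R -> \bar R) :
  measurable_fun setT f -> (forall t, 0 <= f t)%E ->
  (\int[lebesgue_tuple R n]_g f (shear x g) = \int[lebesgue_tuple R n]_g f g)%E.
Proof.
move=> mf f0; under eq_integral do rewrite shear_affact.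
have diag1 i : shear_mx n x i i = 1.
  by rewrite mxE eqxx ltn_eqF ?mulr0 ?subr0.
rewrite -[RHS](@ge0_integral_upper _ _ (shear_mx n x)
  (fun i => - (x * (i.+1 == n)%:R)))//.
- by rewrite (eq_bigr (fun=> 1)) ?big1_eq ?normr1 ?mul1e// => i _; rewrite diag1.
- move=> i j ji; by rewrite mxE -val_eqE/= gtn_eqF// ltn_eqF ?mulr0 ?subr0// ltnW.
- by move=> i; rewrite diag1 oner_eq0.
Qed.

(** The integrand once the constant coefficient is traded for a root [x], the higher coefficients
    [z.2] being fixed. [P] is the polynomial without constant term, [-P(x)] the constant term that
    makes [x] a root, [P'(x)] the Jacobian; the condition on derivatives singles out the largest
    root of a real-rooted polynomial. *)
Let H n (h : n.+1.-tuple R -> \bar R) (z : R * n.-tuple R) : \bar R :=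
  let P := mpoly z.2 * 'X in
  (((dpos n.+1 P^`() z.1)%:R * (P^`()).[z.1])%:E * h (tcons ((- P.[z.1])%R, z.2)))%E.

Let H_ge0 n h z : (forall t, 0 <= h t)%E -> (0 <= H (n := n) h z)%E.
Proof.
move=> h0; rewrite mule_ge0// lee_fin.
case: (boolP (dpos n.+1 _ z.1)) => /=; last by rewrite mul0r.
by rewrite mul1r => /dposP/(_ 0%N (ltn0Sn _))/ltW.
Qed.

Let measurable_H n h : measurable_fun setT h -> measurable_fun setT (H (n := n) h).
Proof.
move=> mh.
have m2 : measurable_fun setT (fun z : R * n.-tuple R => tcons (0 : R, z.2)).
  by apply: measurableT_comp (@measurable_tcons R n) _; exact: measurable_fun_pair.
have XE (z : R * n.-tuple R) : mpoly z.2 * 'X = mpoly (tcons (0, z.2)).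
  by rewrite mpoly_cons addr0.
have mD k : measurable_fun setT
    (fun z : R * n.-tuple R => ((mpoly z.2 * 'X)^`(k)).[z.1]).
  by under eq_fun do rewrite XE; exact: measurable_horner_mpoly.
apply: emeasurable_funM.
  apply/measurable_EFinP; apply: measurable_funM; last first.
    by under eq_fun do rewrite -derivn1; exact: mD.
  apply: measurable_natr_bool; apply: measurable_forall => k.
  by apply: measurable_fun_ltr => //; under eq_fun do rewrite -derivSn; exact: mD.
apply: measurableT_comp mh _; apply: measurableT_comp (@measurable_tcons R n) _.
apply: measurable_fun_pair => //; apply: measurableT_comp => //.
by have := mD 0%N; under eq_fun do rewrite derivn0.
Qed.

(** At [x] the derivative of order [k + 1] of [(X - x) g] is [(k + 1) g^(k)(x)], so both the
    positivity condition and the Jacobian pass from [P'] to [g]. *)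
Let H_shear n h x (g : n.-tuple R) (c : n.+1.-tuple R) :
  mpoly c = ('X - x%:P) * mpoly g ->
  (H h (x, shear x g) =
   ((dpos n.+1 (mpoly g) x)%:R * (mpoly g).[x])%:E * h c)%E.
Proof.
move=> cE; rewrite /H /=.
have PE : mpoly (shear x g) * 'X = ('X - x%:P) * mpoly g + (x * (mpoly g).[0])%:P.
  by rewrite mpoly_shear -addrA -polyCD addNr addr0.
have dE k : (((mpoly (shear x g) * 'X)^`())^`(k)).[x] = ((mpoly g)^`(k)).[x] *+ k.+1.
  by rewrite -derivSn PE derivnD hornerD derivnC/= horner0 addr0
    derivn_XsubCM_horner.
have -> : dpos n.+1 (mpoly (shear x g) * 'X)^`() x = dpos n.+1 (mpoly g) x.
  by apply: eq_forallb => k; rewrite dE pmulrn_lgt0.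
have := dE 0%N; rewrite !derivn0 mulr1n => ->; congr (_ * h _)%E.
apply: mpoly_inj; rewrite mpoly_cons cE mpoly_shear; congr (_ + _%:P).
by rewrite PE hornerD hornerM hornerXsubC subrr mul0r add0r hornerC.
Qed.

Let integral_H n h (f' : n.-tuple R) : measurable_fun setT h ->
  (forall t, 0 <= h t)%E ->
  (forall c, h c != 0%E -> exists2 l : n.+1.-tuple R, sdec l & mpoly c = rootp l) ->
  (\int[lebesgue_measure]_x H h (x, f') =
   \int[lebesgue_measure]_x h [tuple of x :: f'])%E.
Proof.
move=> mh h0 hr; pose P := mpoly f' * 'X.
(* The constant coefficient is minus the value of [P], hence the reflection. *)
pose f x := h [tuple of (- x) :: f'].
have mf : measurable_fun setT f.
  by apply: measurableT_comp mh _; apply: measurable_cons => //; exact: measurable_funN.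
have sP' : (size P^`() <= n.+1)%N.
  rewrite -ltnS (leq_trans (lt_size_deriv _))//.
    by rewrite -size_poly_eq0 size_mulX ?size_mpoly// -size_poly_eq0 size_mpoly.
  by rewrite size_mulX ?size_mpoly// -size_poly_eq0 size_mpoly.
pose I := [set s | dpos n.+1 P^`() s].
have mI : measurable I.
  rewrite (_ : I = (dpos n.+1 P^`()) @^-1` [set true])//.
  rewrite -[X in measurable X]setTI.
  have : measurable_fun setT (dpos n.+1 P^`()).
    by apply: measurable_forall => k; apply: measurable_fun_ltr => //; exact: measurable_poly.
  by apply.
have := @ge0_integral_horner R P I _ _ _ _ f mI mf.
rewrite -[in X in _ -> X](@ge0_integral_affine R (-1) 0 (fun x => h [tuple of x :: f'])); last 3 first.
- by rewrite oppr_eq0 oner_eq0.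
- by apply: measurableT_comp mh _; exact: measurable_tuple_cons1.
- by [].
rewrite normrN1 mul1e => E; transitivity (\int[lebesgue_measure]_x f x)%E.
  rewrite -E//.
  + apply: eq_integral => x _; rewrite indicE mem_setE /H /=.
    by rewrite -/P.
  + move=> s t Is st; exact: (dpos_le sP' st Is).
  + by move=> s /dpos_open.
  + by move=> s /dposP/(_ 0%N (ltn0Sn _)).
  + by move=> s c Is; exact: (dpos_grow _ sP' _ Is).
  + by move=> x; exact: h0.
  (* The head [y] of the decreasing list is the largest root, and it is the point of [I] where [P]
     takes the value [c]. *)
  + move=> c /hr[l]; case/tupleP: l => y l; rewrite sdec_cons => /andP[yl _].
    rewrite mpoly_cons rootp_cons => E2.
    have PE : P = ('X - y%:P) * rootp l + c%:P.
      by rewrite -E2 -addrA -polyCD addNr addr0.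
    exists y; last by rewrite PE hornerD hornerM hornerXsubC subrr mul0r add0r hornerC.
    apply/dposP => k kn; rewrite -derivSn PE derivnD hornerD derivn_XsubCM_horner.
    rewrite derivnC/= horner0 addr0 pmulrn_lgt0//.
    by apply: (dposP n.+1) => //; rewrite dpos_rootp.
by apply: eq_integral => x _; rewrite /f mulN1r addr0.
Qed.

(** Induction on the number of roots. For fixed higher coefficients the constant one is traded for
    the largest root [x]; a shear then replaces the higher coefficients by those of the quotient
    [g], to which the induction hypothesis applies. The factor [g(x)] collected is the part of the
    Vandermonde product that involves [x]. *)
Lemma roots_to_coefs n (h : n.-tuple R -> \bar R) :
  measurable_fun setT h -> (forall t, 0 <= h t)%E ->
  (forall c, h c != 0%E -> exists2 l : n.-tuple R, sdec l & mpoly c = rootp l) ->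
  (\int[lebesgue_tuple R n]_c h c =
   \int[lebesgue_tuple R n]_l (((sdec l)%:R * vand l)%:E * h (coefs l)))%E.
Proof.
have mW k : measurable_fun setT (fun l : k.-tuple R => (sdec l)%:R * vand l : R).
  apply: measurable_funM; last exact: measurable_vand.
  by apply: measurable_natr_bool; exact: measurable_sdec.
have W0 k (l : k.-tuple R) : 0 <= (sdec l)%:R * vand l.
  by case: (boolP (sdec l)) => [/vand_gt0/ltW|]; rewrite (mul1r, mul0r).
have mWh k (h' : k.-tuple R -> \bar R) : measurable_fun setT h' ->
    measurable_fun setT (fun l => ((sdec l)%:R * vand l)%:E * h' (coefs l))%E.
  move=> mh; apply: emeasurable_funM; first by apply/measurable_EFinP; exact: mW.
  by apply: measurableT_comp mh _; exact: measurable_coefs.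
elim: n h => [|n IH] h mh h0 hr.
  rewrite !integral_lebesgue_tuple0//; last exact: mWh.
  rewrite (_ : sdec _); last by apply/sdecP => -[].
  by rewrite /vand big_ord0 mulr1 mul1e; rewrite (tuple0 (coefs _)).
rewrite [RHS]integral_lebesgue_tupleS//; first last.
- by move=> l; rewrite mule_ge0// lee_fin.
- exact: mWh.
have mHx x : measurable_fun setT (fun f' => H h (x, f')).
  exact: measurableT_comp (measurable_H mh) (measurable_pair1 x).
transitivity (\int[lebesgue_measure]_x \int[lebesgue_tuple R n]_f' H h (x, f'))%E.
  rewrite integral_lebesgue_tupleS2//.
  under eq_integral do rewrite -integral_H//.
  rewrite (@fubini_tonelli _ _ (measurableTypeR R) _ _ lebesgue_measure
    (lebesgue_tuple R n) (H h))//.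
    exact: measurable_H.
  by move=> z; exact: H_ge0.
apply: eq_integral => x _.
rewrite -(integral_shear x (mHx x)); last by move=> t; exact: H_ge0.
have cE (g : n.-tuple R) : exists c : n.+1.-tuple R, mpoly c = ('X - x%:P) * mpoly g.
  exists (tcons (- (x * (mpoly g).[0]), shear x g)).
  by rewrite mpoly_cons mpoly_shear.
rewrite IH; first last.
(* If [x] were a root smaller than [y], then [g], whose derivatives are positive at [x], would be
   positive at [y], although [(X - x) g] vanishes there. So [x] is the largest root and its factor
   cancels. *)
- move=> g; have [c cgE] := cE g; rewrite (H_shear h cgE).
  rewrite !mule_eq0 !negb_or eqe mulf_eq0 negb_or pnatr_eq0 eqb0 negbK.
  move=> /andP[/andP[gx _] /hr[l]]; case/tupleP: l => y l.
  rewrite sdec_cons rootp_cons cgE => /andP[/forallP yl lp] E.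
  suff xy : x = y.
    exists l => //; move: E; rewrite xy => /mulfI; apply.
    by rewrite polyXsubC_eq0.
  have /eqP := congr1 (horner^~ x) E.
  rewrite !hornerM !hornerXsubC subrr mul0r eq_sym mulf_eq0 subr_eq0.
  move=> /orP[/eqP//|]; rewrite horner_rootp prodf_seq_eq0 => /hasP[j _ /=].
  rewrite subr_eq0 => /eqP xl; have xy : x < y by rewrite xl yl.
  have := dposP _ _ _ (dpos_le _ (ltW xy) gx) 0%N (ltn0Sn _).
  rewrite size_mpoly => /(_ (leqnn _)); rewrite derivn0 => gy.
  have /eqP := congr1 (horner^~ y) E.
  rewrite !hornerM !hornerXsubC subrr mul0r mulf_eq0 subr_eq0 gt_eqF//=.
  by rewrite gt_eqF.
- by move=> g; exact: H_ge0.
- apply: measurableT_comp (mHx x) _.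
  have -> : shear x = affact (shear_mx n x) (fun i => - (x * (i.+1 == n)%:R)).
    by apply/funext => g; exact: shear_affact.
  exact: measurable_affact.
apply: eq_integral => l _.
rewrite (@H_shear _ _ _ _ (coefs [tuple of x :: l])); last first.
  by rewrite !mpoly_coefs rootp_cons.
rewrite mpoly_coefs dpos_rootp sdec_cons vand_cons muleA -EFinM; congr (_%:E * _)%E.
case: (below l x) => /=; last by rewrite !mul0r mulr0.
by rewrite !mul1r; ring.
Qed.

End RootsCoefficients.

(** * Measurability of ordered roots *)

Section OrderedRoots.
Context (R : realType) d (T : measurableType d).

Definition nonincr n (x : n.-tuple R) :=
  forall i j : 'I_n, (i <= j)%N -> tnth x j <= tnth x i.

Lemma below_head n (x : n.+1.-tuple R) t : nonincr x ->
  below x t = (tnth x ord0 < t).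
Proof.
move=> ox; apply/forallP/idP => [|xt j]; first exact.
by apply: le_lt_trans xt; exact: ox.
Qed.

(** Division by [X - a] from the top: [q_k = p_(k+1) + a q_(k+1)], by downward induction from the
    degree bound. *)
Lemma measurable_quotient_XsubC n (p q : T -> {poly R}) (a : T -> R) :
  (forall k, measurable_fun setT (fun w => (p w)`_k)) -> measurable_fun setT a ->
  (forall w, (size (q w) <= n)%N) -> (forall w, p w = ('X - (a w)%:P) * q w) ->
  forall k, measurable_fun setT (fun w => (q w)`_k).
Proof.
move=> mp ma qn pq k.
have [j] : exists j, (n <= k + j)%N by exists n; rewrite leq_addl.
elim: j k => [|j IH] k.
  rewrite addn0 => nk; rewrite (_ : (fun _ => _) = cst 0)//.
  by apply/funext => w /=; rewrite nth_default// (leq_trans (qn w)).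
move=> nk; have mqk : measurable_fun setT (fun w => (q w)`_k.+1).
  by apply: IH; rewrite addSnnS.
rewrite (_ : (fun _ => _) = fun w => (p w)`_k.+1 + a w * (q w)`_k.+1).
  by apply: measurable_funD => //; exact: measurable_funM.
by apply/funext => w; rewrite pq mulrBl coefB coefXM coefCM/= subrK.
Qed.

Lemma measurable_derivn_horner n (p : T -> {poly R}) k (t : R) :
  (forall k, measurable_fun setT (fun w => (p w)`_k)) ->
  (forall w, (size (p w) <= n)%N) ->
  measurable_fun setT (fun w => ((p w)^`(k)).[t]).
Proof.
move=> mp pn.
rewrite (_ : (fun _ => _) =
    fun w => \sum_(i < n) (p w)`_(k + i) *+ (k + i) ^_ k * t ^+ i).
  apply: measurable_sum => i; apply: measurable_funM => //.
  under eq_fun do rewrite -mulr_natr.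
  exact: measurable_funM.
apply/funext => w; rewrite (@horner_coef_wide _ n).
  by apply: eq_bigr => i _; rewrite coef_derivn.
apply/leq_sizeP => j nj; rewrite coef_derivn nth_default ?mul0rn//.
by rewrite (leq_trans (pn w))// (leq_trans nj)// leq_addl.
Qed.

(** The largest root lies below [t] exactly when all derivatives are positive at [t], a measurable
    condition on the coefficients. Dividing by its factor leaves a polynomial with one root less. *)
Lemma measurable_ordered_roots n (p : T -> {poly R}) (x : T -> n.-tuple R) :
  (forall k, measurable_fun setT (fun w => (p w)`_k)) ->
  (forall w, p w = rootp (x w)) -> (forall w, nonincr (x w)) ->
  measurable_fun setT x.
Proof.
elim: n p x => [|n IH] p x mp px ox; first by apply/measurable_fun_tnthP => -[].
have mx0 : measurable_fun setT (fun w => tnth (x w) ord0).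
  apply: (measurability _ (RGenInftyO.measurableE R)) => //.
  move=> _ [_ [t ->] <-]; rewrite setTI.
  rewrite (_ : _ @^-1` _ = (fun w => dpos n.+2 (p w) t) @^-1` [set true]).
    rewrite -[X in measurable X]setTI.
    have : measurable_fun setT (fun w => dpos n.+2 (p w) t).
      apply: measurable_forall => k; apply: measurable_fun_ltr => //.
      apply: (measurable_derivn_horner (n := n.+2)) => // w.
      by rewrite px size_rootp.
    by apply.
  apply/seteqP; split => w /=; rewrite in_itv/= px dpos_rootp below_head//.
pose x' w := [tuple of behead (x w)].
have xE w : x w = [tuple of tnth (x w) ord0 :: x' w].
  by rewrite [LHS]tuple_eta; congr [tuple of _ :: _].
have mx' : measurable_fun setT x'.
  apply: (IH (fun w => rootp (x' w))) => //.
    apply: (@measurable_quotient_XsubC n.+1 p _ (fun w => tnth (x w) ord0)) => //.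
      by move=> w; rewrite size_rootp.
    by move=> w; rewrite px {1}xE rootp_cons.
  move=> w i j ij; have := ox w (lift ord0 i) (lift ord0 j) ij.
  by rewrite xE !tnthS.
rewrite (_ : x = fun w => [tuple of tnth (x w) ord0 :: x' w]); last exact/funext.
exact: measurable_cons.
Qed.

End OrderedRoots.

(** * Rank one perturbations of Hermitian matrices *)

Section Schur.
Local Open Scope ring_scope.

(** The column [b] is eliminated with [\adj A] in place of an inverse; this multiplies the
    determinant by [\det A], which is then cancelled. *)
Let schur_regular (F : idomainType) n (A : 'M[F]_n) (b : 'cV[F]_n) (c : 'rV[F]_n) d :
  \det A != 0 ->
  \det (block_mx (d%:M : 'M[F]_1) c b A) = d * \det A - (c *m \adj A *m b) 0 0.
Proof.
move=> dA.
have E : block_mx (d%:M : 'M[F]_1) c b A *m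
    block_mx ((\det A)%:M : 'M[F]_1) 0 (- (\adj A *m b)) 1%:M =
    block_mx ((d * \det A - (c *m \adj A *m b) 0 0)%:M : 'M[F]_1) c 0 A.
  rewrite mulmx_block !mulmx0 !mulmx1 !add0r; congr block_mx.
    apply/matrixP => i j; rewrite !ord1 mulmxN mulmxA.
    by rewrite -scalar_mxM !mxE eqxx !mulr1n.
  by rewrite mulmxN mulmxA mul_mx_adj mul_mx_scalar mul_scalar_mx subrr.
have := congr1 determinant E.
rewrite det_mulmx det_ublock (@det_lblock _ 1 n) det1 mulr1 !det_scalar1.
by move/mulIf; apply.
Qed.

Lemma det_schur (F : idomainType) n (A : 'M[F]_n) (b : 'cV[F]_n) (c : 'rV[F]_n) d :
  \det (block_mx (d%:M : 'M[F]_1) c b A) = d * \det A - (c *m \adj A *m b) 0 0.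
Proof.
(* The characteristic matrix of [-A] is [X + A]: its determinant is monic, hence nonzero, and
   evaluation at 0 gives back [A]. *)
pose A' := char_poly_mx (- A).
have dA' : \det A' != 0 by apply: monic_neq0; exact: char_poly_monic.
have := schur_regular (map_mx polyC b) (map_mx polyC c) d%:P dA'.
pose ev : {rmorphism {poly F} -> F} := horner_eval 0.
move=> /(congr1 ev).
have evC (p q : nat) (M : 'M[F]_(p, q)) : map_mx ev (map_mx polyC M) = M.
  by apply/matrixP => i j; rewrite !mxE /ev /= /horner_eval hornerC.
have evA : map_mx ev A' = A.
  apply/matrixP => i j; rewrite !mxE /ev /= /horner_eval.
  by rewrite hornerD hornerMn hornerX mul0rn add0r hornerN hornerC opprK.
rewrite rmorphB rmorphM -!det_map_mx map_block_mx !evC evA.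
have -> : map_mx ev (d%:P%:M : 'M[{poly F}]_1) = d%:M.
  by apply/matrixP => i j; rewrite !mxE /ev /= /horner_eval hornerMn hornerC.
move=> ->; congr (_ * _ - _); first by rewrite /ev /= /horner_eval hornerC.
have -> : ev ((map_mx polyC c *m \adj A' *m map_mx polyC b) 0 0) =
    (map_mx ev (map_mx polyC c *m \adj A' *m map_mx polyC b)) 0 0 by rewrite [RHS]mxE.
by rewrite !map_mxM map_mx_adj !evC evA.
Qed.

(** Both sides are the determinant of the block matrix with rows [(1, c)] and [(b, A)]: clearing [c]
    with the first column leaves [A - b c]. *)
Lemma det_sub_rank1 (F : idomainType) n (A : 'M[F]_n) (b : 'cV[F]_n) (c : 'rV[F]_n) :
  \det (A - b *m c) = \det A - (c *m \adj A *m b) 0 0.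
Proof.
rewrite -[X in _ = X - _]mul1r -det_schur.
have := congr1 determinant (mulmx_block (1%:M : 'M[F]_1) c b A 1%:M (- c) 0 1%:M).
rewrite !mulmx1 !mulmx0 !addr0 mul1mx addNr det_mulmx det_ublock !det1 !mulr1.
by rewrite (@det_lblock _ 1 n) det1 mul1r mulmxN addrC => ->.
Qed.

Lemma adj_diag_mx (F : idomainType) n (d : 'rV[F]_n) : (forall i, d 0 i != 0) ->
  forall i j, \adj (diag_mx d) i j = (i == j)%:R * \prod_(k < n | k != i) d 0 k.
Proof.
move=> d0 i j; have := mul_mx_adj (diag_mx d) => /matrixP/(_ i j).
rewrite mul_diag_mx !mxE det_diag (bigD1 i)//= => E.
by apply: (mulfI (d0 i)); rewrite E; case: eqP => _; rewrite ?mulr1n ?mulr0n; ring.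
Qed.

(** The rank one formula over polynomials; the adjugate of the diagonal matrix of the [X - d_i] is
    diagonal, its entries being the products that omit one factor. *)
Lemma char_poly_diag_rank1 (F : fieldType) n (d : 'rV[F]_n) (b : 'cV[F]_n)
    (c : 'rV[F]_n) :
  char_poly (diag_mx d + b *m c) = \prod_(i < n) ('X - (d 0 i)%:P) -
    \sum_(i < n) (c 0 i * b i 0) *: \prod_(j < n | j != i) ('X - (d 0 j)%:P).
Proof.
pose D : 'rV[{poly F}]_n := \row_i ('X - (d 0 i)%:P).
have -> : char_poly (diag_mx d + b *m c) =
    \det (diag_mx D - map_mx polyC b *m map_mx polyC c).
  rewrite /char_poly /char_poly_mx -map_mxM; congr determinant.
  apply/matrixP => i j; rewrite !mxE polyCD opprD addrA; congr (_ - _).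
  by case: eqP => [->|]; rewrite ?mulr1n// !mulr0n polyC0 subr0.
have D0 i : D 0 i != 0 by rewrite mxE polyXsubC_eq0.
rewrite det_sub_rank1 det_diag; congr (_ - _).
  by apply: eq_bigr => i _; rewrite mxE.
rewrite mxE; apply: eq_bigr => i _; rewrite !mxE.
rewrite (bigD1 i)//= big1 ?addr0; last first.
  by move=> k ki; rewrite adj_diag_mx// (negbTE ki) mul0r mulr0.
rewrite adj_diag_mx// eqxx mul1r mxE -mul_polyC polyCM.
rewrite (eq_bigr (fun j => 'X - (d 0 j)%:P)); last by move=> k _; rewrite mxE.
by ring.
Qed.

End Schur.

(** * Uniqueness of the ordered list of roots *)

Section OrderedRootsUnique.
Context (R : realType).

(** The polynomial determines which [t] exceed the largest root, hence that root; its factor is then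
    cancelled. *)
Lemma rootp_inj n (x y : n.-tuple R) : nonincr x -> nonincr y ->
  rootp x = rootp y -> x = y.
Proof.
elim: n x y => [|n IH] x y ox oy xy; first by rewrite (tuple0 x) (tuple0 y).
have h t : (tnth x ord0 < t) = (tnth y ord0 < t).
  by rewrite -!below_head// -!dpos_rootp xy.
have x0y0 : tnth x ord0 = tnth y ord0.
  apply/eqP; rewrite eq_le -!(rwP andP) leNgt -h ltxx /=.
  by split=> //; rewrite leNgt h ltxx.
case/tupleP: x => a x in ox xy h x0y0 *; case/tupleP: y => b y in oy xy h x0y0 *.
rewrite !tnth0 in x0y0; rewrite -x0y0 in oy xy *.
congr [tuple of _ :: _]; apply: IH.
- by move=> i j ij; have := ox (lift ord0 i) (lift ord0 j) ij; rewrite !tnthS.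
- by move=> i j ij; have := oy (lift ord0 i) (lift ord0 j) ij; rewrite !tnthS.
- by move: xy; rewrite !rootp_cons => /mulfI; apply; rewrite polyXsubC_eq0.
Qed.

Lemma exists_nonincr_perm n (x : n.-tuple R) :
  exists s : {perm 'I_n}, nonincr (tperm_tuple s x).
Proof.
have /tuple_permP[s sE] : perm_eq (sort_tuple (fun u v => v <= u) x) x.
  by rewrite perm_sort.
exists s => i j ij; rewrite -/(tperm_tuple s x).
have <- : sort_tuple (fun u v => v <= u) x = tperm_tuple s x by exact: val_inj.
rewrite !(tnth_nth 0); apply: (sorted_leq_nth (leT := fun u v : R => v <= u)) => //.
- by move=> a b c ba cb; exact: le_trans cb ba.
- by apply: sort_sorted => u v; exact: le_total.
- by rewrite inE size_tuple.
- by rewrite inE size_tuple.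
Qed.

End OrderedRootsUnique.

(** * Spectral theory of Gram matrices *)

Section Spectral.
Local Open Scope sesquilinear_scope.
Context (R : realType).
Local Notation C := R[i].
Local Notation rc := (real_complex R).

Definition sqn (z : C) : R := complex.Re z ^+ 2 + complex.Im z ^+ 2.

Lemma sqnE (z : C) : z^* * z = rc (sqn z).
Proof.
case: z => a b; rewrite /sqn; apply/eqP; rewrite eq_complex /=.
by apply/andP; split; apply/eqP; ring.
Qed.

Lemma map_rootp n (x : n.-tuple R) :
  map_poly rc (rootp x) = \prod_(i < n) ('X - (rc (tnth x i))%:P).
Proof. by rewrite rmorph_prod; apply: eq_bigr => i _; rewrite /= map_polyXsubC. Qed.

Lemma ordered_eigenvaluesP n (A : 'M[C]_n) x : ordered_eigenvalues A x <->
  nonincr x /\ char_poly A = map_poly rc (rootp x).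
Proof. by rewrite map_rootp. Qed.

Definition realdiag n (a : n.-tuple R) : 'M[C]_n := diag_mx (\row_i rc (tnth a i)).

Lemma gram_hermitian m n (A : 'M[C]_(m, n)) : A *m A^t* \is hermsymmx.
Proof.
by apply/is_hermitianmxP; rewrite expr0 scale1r trmx_mul map_mxM trmxCK.
Qed.

(** The spectral theorem gives a unitary diagonalization; Hermitian symmetry makes the diagonal
    real, and a permutation matrix absorbed into [U] sorts it. *)
Lemma hermitian_spectral n (M : 'M[C]_n) : M \is hermsymmx ->
  exists (U : 'M[C]_n) (a : n.-tuple R),
  [/\ U \is unitarymx, nonincr a & M = U^t* *m realdiag a *m U].
Proof.
move=> Mh; have Mn := hermitian_normalmx Mh.
have ME := orthomx_spectralP Mn.
have Ur := spectral_unitarymx M; rewrite invmx_unitary// in ME.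
have dr := hermitian_spectral_diag_real Mh.
pose b := [tuple complex.Re (spectral_diag M 0 i) | i < n].
have bE : spectral_diag M = \row_i rc (tnth b i).
  apply/rowP => i; rewrite mxE tnth_mktuple.
  have /CrealP : spectral_diag M 0 i \is Num.real by exact: (mxOverP dr).
  case: (spectral_diag M 0 i) => u v /= [vE]; congr Complex.
  by lra.
have [s sb] := exists_nonincr_perm b.
exists (perm_mx s *m spectralmx M), (tperm_tuple s b).
have Us : (perm_mx s : 'M[C]_n) \is unitarymx.
  apply/unitarymxP; rewrite tr_perm_mx map_perm_mx -perm_mxM mulgV.
  by rewrite perm_mx1.
split; [exact: mul_unitarymx|exact: sb|].
rewrite [LHS]ME trmx_mul map_mxM -!mulmxA; congr (_ *m _).
rewrite !mulmxA; congr (_ *m _); rewrite tr_perm_mx map_perm_mx bE.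
apply/matrixP => i j.
rewrite -mulmxA -row_permE !mxE.
under eq_bigr do rewrite !mxE.
rewrite (bigD1 ((s^-1)%g i))//= eqxx mulr1n permKV big1 ?addr0; last first.
  by move=> k ki; rewrite eq_sym (negbTE ki) mulr0n mul0r.
have -> : tnth (tperm_tuple s b) ((s^-1)%g i) = tnth b i.
  by rewrite [LHS]tnth_mktuple permKV.
by rewrite mulr_natr.
Qed.

Lemma char_poly_unitary n (U M : 'M[C]_n) : U \is unitarymx ->
  char_poly (U^t* *m M *m U) = char_poly M.
Proof.
move=> Uu; have UU : U^t* *m U = 1%:M.
  by apply: mulmx1C; exact/unitarymxP.
pose p k l (N : 'M[C]_(k, l)) : 'M[{poly C}]_(k, l) := map_mx polyC N.
have : char_poly_mx (U^t* *m M *m U) = p _ _ (U^t*) *m char_poly_mx M *m p _ _ U.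
  rewrite /char_poly_mx mulmxBr mulmxBl !map_mxM; congr (_ - _).
  by rewrite scalar_mxC -mulmxA -map_mxM UU map_mx1 mulmx1.
rewrite /char_poly => ->; rewrite !det_mulmx mulrAC -det_mulmx -map_mxM UU.
by rewrite map_mx1 det1 mul1r.
Qed.

(* The characteristic polynomial of [diag(d) + u u^*], where [q_i = |u_i|^2]. *)
Definition secp n (d q : n.-tuple R) : {poly R} :=
  rootp d - \sum_(i < n) tnth q i *: \prod_(j < n | j != i) ('X - (tnth d j)%:P).

Lemma char_poly_secp n (d : n.-tuple R) (w : 'cV[C]_n) :
  char_poly (realdiag d + w *m w^t*) =
  map_poly rc (secp d [tuple sqn (w i 0) | i < n]).
Proof.
rewrite char_poly_diag_rank1 /secp rmorphB /= map_rootp; congr (_ - _).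
  by apply: eq_bigr => i _; rewrite mxE.
rewrite rmorph_sum; apply: eq_bigr => i _; rewrite /= map_polyZ/= rmorph_prod.
rewrite !mxE tnth_mktuple -sqnE; congr (_ *: _).
by apply: eq_bigr => j _; rewrite mxE /= map_polyXsubC.
Qed.

Lemma char_poly_hermitian n (M : 'M[C]_n) : M \is hermsymmx ->
  exists2 x : n.-tuple R, nonincr x & char_poly M = map_poly rc (rootp x).
Proof.
move=> /hermitian_spectral[U [a [Uu oa ->]]]; exists a => //.
rewrite char_poly_unitary// map_rootp char_poly_trig ?diag_mx_is_trig//.
by apply: eq_bigr => i _; rewrite !mxE eqxx mulr1n.
Qed.

Lemma exists_ordered_eigenvalues n (A : 'M[C]_n) :
  exists x, ordered_eigenvalues (A *m A^t*) x.
Proof.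
have [x ox xE] := char_poly_hermitian (gram_hermitian A).
by exists x; apply/ordered_eigenvaluesP.
Qed.

Definition lower_block n (X : 'M[C]_n.+1) : 'M[C]_n :=
  \matrix_(i, j) X (lift ord0 i) (lift ord0 j).

Definition extend_unitary n (U : 'M[C]_n) : 'M[C]_n.+1 :=
  block_mx (1%:M : 'M[C]_1) 0 0 U : 'M[C]_(1 + n).

Lemma trmxC_block m1 m2 n1 n2 (A : 'M[C]_(m1, n1)) (B : 'M[C]_(m1, n2))
    (D : 'M[C]_(m2, n1)) (E : 'M[C]_(m2, n2)) :
  (block_mx A B D E)^t* = block_mx (A^t*) (D^t*) (B^t*) (E^t*).
Proof. by rewrite tr_block_mx map_block_mx. Qed.

Lemma extend_unitary_unitary n (U : 'M[C]_n) : U \is unitarymx ->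
  extend_unitary U \is unitarymx.
Proof.
move=> /unitarymxP UU; apply/unitarymxP.
pose B : 'M[C]_(1 + n) := block_mx (1%:M : 'M[C]_1) 0 0 U.
suff : B *m B^t* = 1%:M by [].
rewrite /B trmxC_block mulmx_block !trmx0 !map_mx0 !mulmx0 !mul0mx !addr0 !add0r UU.
by rewrite trmx1 map_mx1 mulmx1 -scalar_mx_block.
Qed.

Lemma gram_peel n (X : 'M[C]_n.+1) (U : 'M[C]_n) (a : n.-tuple R) :
  is_trig_mx X -> U \is unitarymx ->
  lower_block X *m (lower_block X)^t* = U^t* *m realdiag a *m U ->
  char_poly (X *m X^t*) = map_poly rc (secp [tuple of 0 :: a]
    [tuple sqn ((extend_unitary U *m col ord0 X) i 0) | i < n.+1]).
Proof.
move=> /is_trig_mxP Xt Uu XE.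
pose X' : 'M[C]_(1 + n) := X.
have dr : drsubmx X' = lower_block X.
  by apply/matrixP => i j; rewrite !mxE; congr (X _ _); exact: val_inj.
(* Triangularity: the first row of [X] vanishes off the diagonal, so the first row of the Gram
   matrix comes from the first column alone. *)
have ur : ursubmx X' = 0.
  by apply/matrixP => i j; rewrite !mxE Xt//= !ord1.
have cE : col ord0 X = col_mx (ulsubmx X') (dlsubmx X').
  pose c : 'cV[C]_(1 + n) := col ord0 X.
  transitivity (col_mx (usubmx c) (dsubmx c)); first by rewrite vsubmxK.
  have -> : usubmx c = ulsubmx X'.
    apply/matrixP => i j; rewrite !mxE.
    by congr (X _ _); apply: val_inj; rewrite /= !ord1.
  have -> : dsubmx c = dlsubmx X'.
    apply/matrixP => i j; rewrite !mxE.
    by congr (X _ _); apply: val_inj; rewrite /= !ord1.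
  by [].
set W := extend_unitary U; set u := col ord0 X.
have Wu : W \is unitarymx by exact: extend_unitary_unitary.
have WW : W^t* *m W = 1%:M by apply: mulmx1C; exact/unitarymxP.
have dE : realdiag [tuple of 0 :: a] =
    block_mx (0 : 'M[C]_1) 0 0 (realdiag a) :> 'M[C]_(1 + n).
  transitivity (diag_mx (row_mx (0 : 'rV[C]_1) (\row_i rc (tnth a i)))); last first.
    by rewrite diag_mx_row linear0.
  rewrite /realdiag; congr diag_mx; apply/rowP => i.
  rewrite mxE; case: (unliftP ord0 i) => [j ->|->].
    rewrite tnthS (_ : lift ord0 j = rshift 1 j) ?row_mxEr ?mxE//.
    exact: val_inj.
  rewrite tnth0 (_ : ord0 = lshift n (0 : 'I_1)) ?row_mxEl ?mxE ?rmorph0//.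
  exact: val_inj.
have -> : X *m X^t* = W^t* *m (realdiag [tuple of 0 :: a] +
    (W *m u) *m (W *m u)^t*) *m W.
  rewrite trmx_mul map_mxM mulmxDr mulmxDl !mulmxA WW mul1mx.
  rewrite -[X in _ + X]mulmxA WW mulmx1.
  have -> : W^t* *m realdiag [tuple of 0 :: a] *m W =
      block_mx (0 : 'M[C]_1) 0 0 (U^t* *m realdiag a *m U) :> 'M[C]_(1 + n).
    pose B : 'M[C]_(1 + n) := block_mx (1%:M : 'M[C]_1) 0 0 U.
    pose D : 'M[C]_(1 + n) := block_mx (0 : 'M[C]_1) 0 0 (realdiag a).
    transitivity (B^t* *m D *m B); first by rewrite dE.
    rewrite /B trmxC_block !mulmx_block !trmx0 !map_mx0.
    by rewrite !(mulmx0, mul0mx, addr0, add0r).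
  rewrite -XE -dr /u cE.
  transitivity (X' *m X'^t*); first by [].
  transitivity (block_mx (0 : 'M[C]_1) 0 0 (drsubmx X' *m (drsubmx X')^t*) +
    col_mx (ulsubmx X') (dlsubmx X') *m (col_mx (ulsubmx X') (dlsubmx X'))^t*); last by [].
  rewrite tr_col_mx map_row_mx mul_col_row.
  rewrite -[in LHS](submxK X') ur trmxC_block mulmx_block add_block_mx.
  by rewrite !trmx0 !map_mx0 !(mulmx0, mul0mx, addr0, add0r) addrC.
by rewrite char_poly_unitary// char_poly_secp.
Qed.

(** [secp d q] is the characteristic polynomial of a Hermitian matrix, the rank one perturbation of
    [realdiag d] by the vector of square roots of the [q_i]. *)
Lemma exists_roots_secp n (d q : n.-tuple R) : (forall i, 0 <= tnth q i) ->
  exists2 x : n.-tuple R, nonincr x & secp d q = rootp x.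
Proof.
move=> q0; pose w : 'cV[C]_n := \col_i rc (Num.sqrt (tnth q i)).
have h : realdiag d + w *m w^t* \is hermsymmx.
  apply/is_hermitianmxP; rewrite expr0 scale1r linearD/= map_mxD trmx_mul map_mxM.
  rewrite trmxCK; congr (_ + _); rewrite /realdiag tr_diag_mx map_diag_mx.
  by congr diag_mx; apply/rowP => i; rewrite !mxE; exact/esym/conjc_real.
have [x ox] := char_poly_hermitian h; rewrite char_poly_secp.
move=> /(map_poly_inj rc) E; exists x => //; rewrite -E; congr secp.
apply: eq_from_tnth => i; rewrite tnth_mktuple mxE /sqn /= expr0n addr0.
by rewrite sqr_sqrtr.
Qed.

End Spectral.

(** * Complex Gaussian vectors *)

Section Polar.
Context (R : realType).

Lemma ge0_eq_integral_off0 (f g : R -> \bar R) :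
  measurable_fun setT f -> measurable_fun setT g ->
  (forall x, 0 <= f x)%E -> (forall x, 0 <= g x)%E ->
  (forall x, x != 0 -> f x = g x) ->
  (\int[lebesgue_measure]_x f x = \int[lebesgue_measure]_x g x)%E.
Proof.
move=> mf mg f0 g0 fg; apply: ge0_ae_eq_integral => //.
exists [set (0 : R)]; split.
- exact: measurable_set1.
- exact: lebesgue_measure_set1.
- by move=> x /= h; apply: contrapT => /eqP x0; apply: h => _; exact: fg.
Qed.

Definition posi (x : R) : R := if 0 < x then 1 else 0.

Lemma posi_ge0 x : 0 <= posi x.
Proof. by rewrite /posi; case: ifP. Qed.

Lemma measurable_posi : measurable_fun setT posi.
Proof. by apply: measurable_fun_ifT => //; exact: measurable_fun_ltr. Qed.

Lemma integral_posi_exp :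
  (\int[lebesgue_measure]_x (posi x * expR (- x))%:E = 1)%E.
Proof.
rewrite -(@integral_exponential_pdf R 1)//; apply: ge0_eq_integral_off0.
- apply/measurable_EFinP; apply: measurable_funM; first exact: measurable_posi.
  exact: measurableT_comp.
- by apply/measurable_EFinP; exact: measurable_exponential_pdf.
- by move=> x; rewrite lee_fin mulr_ge0 ?posi_ge0 ?expR_ge0.
- by move=> x; rewrite lee_fin exponential_pdf_ge0.
- move=> x x0; congr EFin; rewrite /posi /exponential_pdf /patch mem_setE in_itv/=.
  by rewrite andbT le_eqVlt eq_sym (negbTE x0)/= mulN1r; case: ifP => _; rewrite ?mul1r ?mul0r.
Qed.

(* [x = 0] is excluded from the ray so that [X^2] is strictly increasing on it. *)
Lemma ge0_integral_posi_sqr (f : R -> \bar R) :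
  measurable_fun setT f -> (forall x, 0 <= f x)%E ->
  (\int[lebesgue_measure]_x ((posi x * (x *+ 2))%:E * f (x ^+ 2)%R) =
   \int[lebesgue_measure]_x ((posi x)%:E * f x))%E.
Proof.
move=> mf f0.
have := @ge0_integral_horner R 'X^2 [set x | 0 < x] _ _ _ _
  (fun x => (posi x)%:E * f x)%E.
move=> <-.
- apply: eq_integral => x _.
  rewrite hornerXn derivXn hornerMn hornerX muleA -EFinM.
  congr (_%:E * _)%E; rewrite /posi indicE.
  have -> : (x \in [set x : R | 0 < x]) = (0 < x) by apply/idP/idP; rewrite inE.
  case: ifPn => x0; last by rewrite !mul0r.
  by rewrite exprn_gt0// mulr1 mul1r.
- by move=> s t /= s0 st; exact: lt_le_trans st.
- by move=> s /= s0; exists (s / 2); rewrite /= ?divr_gt0// ltr_pdivrMr// ltr_pMr// ltr1n.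
- by move=> s /= s0; rewrite derivXn hornerMn hornerX mulr2n addr_gt0.
(* The point is at least 1, so its square is at least the point itself, which exceeds [c]. *)
- move=> s c /= s0; exists (s + `|c| + 1).
    by rewrite -addrA lerDl addr_ge0.
  rewrite hornerXn (le_trans (ler_norm c))// expr2 (@le_trans _ _ (s + `|c| + 1))//.
    by rewrite -addrA addrCA lerDl addr_ge0// ltW.
  by rewrite ler_peMr// ?lerDr addr_ge0// ?addr_ge0// ltW.
- rewrite (_ : [set _ | _] = `]0, +oo[%classic) //.
  by apply/seteqP; split => x /=; rewrite in_itv/= andbT.
- by apply: emeasurable_funM => //; apply/measurable_EFinP; exact: measurable_posi.
- by move=> x; rewrite mule_ge0 ?lee_fin ?posi_ge0.
- move=> c c0; have cp : 0 < c.
    by move: c0; rewrite /posi; case: ifPn => // _; rewrite mul0e eqxx.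
  by exists (Num.sqrt c); rewrite /= ?sqrtr_gt0// hornerXn sqr_sqrtr// ltW.
Qed.

(** The two half-lines contribute equally by reflection; together they give the weight [2x] on the
    positive one. *)
Let ge0_integral_sqr (f : R -> \bar R) :
  measurable_fun setT f -> (forall x, 0 <= f x)%E ->
  (\int[lebesgue_measure]_x (`|x|%:E * f (x ^+ 2)%R) =
   \int[lebesgue_measure]_x ((posi x)%:E * f x))%E.
Proof.
move=> mf f0.
have mposi := measurable_posi.
have mf2 : measurable_fun setT (fun x : R => f (x ^+ 2)).
  by apply: measurableT_comp mf _; exact: measurable_funX.
have mh a : measurable_fun setT (fun x : R => ((posi (a * x) * (a * x))%:E * f (x ^+ 2)%R)%E).
  apply: emeasurable_funM => //; apply/measurable_EFinP.
  have ma : measurable_fun setT (fun x : R => a * x) by exact: measurable_funM.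
  by apply: measurable_funM => //; exact: measurableT_comp mposi ma.
have ph x : 0 <= posi x * x :> R.
  by rewrite /posi; case: ifPn => [/ltW|_]; rewrite ?mul1r ?mul0r.
transitivity (\int[lebesgue_measure]_x
  ((posi (1 * x) * (1 * x))%:E * f (x ^+ 2)%R +
   (posi (-1 * x) * (-1 * x))%:E * f (x ^+ 2)%R))%E.
  apply: eq_integral => x _; rewrite -ge0_muleDl ?lee_fin// -EFinD !mul1r mulN1r.
  congr (_%:E * _)%E; rewrite /posi oppr_gt0.
  by case: ltgtP => [x0|x0|<-]; rewrite ?mul1r ?mul0r ?add0r ?addr0 ?normr0
    ?(gtr0_norm x0) ?(ltr0_norm x0).
have pf0 a x : [set: R] x -> (0 <= (posi (a * x) * (a * x))%:E * f (x ^+ 2)%R)%E.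
  by move=> _; rewrite mule_ge0 ?lee_fin.
rewrite ge0_integralD//; try exact: mh; try exact: pf0.
have := @ge0_integral_affine R (-1) 0 (fun x => (posi (1 * x) * (1 * x))%:E * f (x ^+ 2)%R)%E.
rewrite oppr_eq0 oner_eq0 normrN1 mul1e => /(_ isT (mh 1)) E.
have -> : (\int[lebesgue_measure]_x ((posi (-1 * x) * (-1 * x))%:E * f (x ^+ 2)%R) =
  \int[lebesgue_measure]_x ((posi (1 * x) * (1 * x))%:E * f (x ^+ 2)%R))%E.
  rewrite -E; last by move=> x; rewrite mule_ge0 ?lee_fin.
  by apply: eq_integral => x _; rewrite addr0 !mul1r !mulN1r sqrrN.
rewrite -ge0_integralD//; try exact: mh; try exact: pf0.
apply: (etrans _ (ge0_integral_posi_sqr mf f0)).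
by apply: eq_integral => x _; rewrite -ge0_muleDl ?lee_fin// -EFinD !mul1r -mulrDr mulr2n.
Qed.

(** This is [pi], but it enters the polar formula as an unknown constant, determined afterwards from
    the Gaussian integral. *)
Let D : \bar R := (\int[lebesgue_measure]_s ((1 + s ^+ 2)^-1 : R)%:E)%E.

(** For fixed nonzero [x] put [y = x s], so that [x^2 + y^2 = x^2 (1 + s^2)]; exchange the integrals
    and, for fixed [s], substitute [q = x^2] and then [r = q (1 + s^2)]. *)
Let polar_D (H : R -> \bar R) :
  measurable_fun setT H -> (forall r, 0 <= H r)%E ->
  (\int[lebesgue_measure]_x \int[lebesgue_measure]_y H (x ^+ 2 + y ^+ 2)%R =
   D * \int[lebesgue_measure]_r ((posi r)%:E * H r))%E.
Proof.
move=> mH H0.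
have mXY : measurable_fun setT (fun z : R * R => H (z.1 ^+ 2 + z.2 ^+ 2)).
  by apply: measurableT_comp mH _; apply: measurable_funD; exact: measurable_funX.
have mXS : measurable_fun setT
    (fun z : R * R => `|z.1|%:E * H (z.1 ^+ 2 * (1 + z.2 ^+ 2))%R)%E.
  apply: emeasurable_funM.
    by apply/measurable_EFinP; exact: measurableT_comp.
  apply: measurableT_comp mH _; apply: measurable_funM; first exact: measurable_funX.
  by apply: measurable_funD => //; exact: measurable_funX.
have XS0 z : (0 <= `|z.1|%:E * H (z.1 ^+ 2 * (1 + z.2 ^+ 2))%R)%E.
  by rewrite mule_ge0 ?lee_fin.
transitivity (\int[lebesgue_measure]_x \int[lebesgue_measure]_s
    (`|x|%:E * H (x ^+ 2 * (1 + s ^+ 2))%R))%E.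
  apply: ge0_eq_integral_off0.
  - exact: (@measurable_fun_fubini_tonelli_F _ _ _ (measurableTypeR R) _
      lebesgue_measure (fun z : R * R => H (z.1 ^+ 2 + z.2 ^+ 2))).
  - exact: (@measurable_fun_fubini_tonelli_F _ _ _ (measurableTypeR R) _
      lebesgue_measure _ mXS XS0).
  - by move=> x; exact: integral_ge0.
  - by move=> x; apply: integral_ge0 => s _; exact: (XS0 (x, s)).
  - move=> x x0; have mx : measurable_fun setT (fun y : R => H (x ^+ 2 + y ^+ 2)).
      by apply: measurableT_comp mH _; apply: measurable_funD => //; exact: measurable_funX.
    rewrite -(ge0_integral_affine 0 x0 mx)//.
    under eq_integral do rewrite addr0 exprMn -[X in X + _]mulr1 -mulrDr.
    rewrite ge0_integralZl ?lee_fin//.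
    apply: measurableT_comp mH _; apply: measurable_funM => //.
    by apply: measurable_funD => //; exact: measurable_funX.
rewrite (@fubini_tonelli _ _ (measurableTypeR R) (measurableTypeR R) _
  lebesgue_measure lebesgue_measure _ mXS XS0).
have mp : measurable_fun setT (fun r : R => (posi r)%:E * H r)%E.
  by apply: emeasurable_funM => //; apply/measurable_EFinP; exact: measurable_posi.
have p0 r : (0 <= (posi r)%:E * H r)%E by rewrite mule_ge0 ?lee_fin ?posi_ge0.
rewrite -ge0_integralZr//; first last.
- exact: integral_ge0.
- by move=> s _; rewrite lee_fin invr_ge0 addr_ge0// sqr_ge0.
- apply/measurable_EFinP; apply: measurable_funTS; apply: continuous_measurable_fun.
  move=> s; apply: cvgV; first by rewrite gt_eqF// ltr_pwDl// sqr_ge0.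
  by apply: cvgD; [exact: cvg_cst|exact: exprn_continuous].
apply: eq_integral => s _.
have k0 : 0 < 1 + s ^+ 2 by rewrite ltr_pwDl// sqr_ge0.
rewrite (ge0_integral_sqr (f := fun q => H (q * (1 + s ^+ 2))%R))//; last first.
  by apply: measurableT_comp mH _; exact: measurable_funM.
rewrite -(ge0_integral_affine 0 (lt0r_neq0 k0) mp p0) muleA -EFinM gtr0_norm//.
rewrite mulVf ?gt_eqF// mul1e; apply: eq_integral => q _.
by rewrite addr0 (mulrC q) /posi pmulr_rgt0.
Qed.

(** The choice [H r = exp(-r)] identifies the constant [D]: the double integral is then the square
    of the Gaussian integral, namely [pi]. *)
Lemma ge0_integral_polar (H : R -> \bar R) :
  measurable_fun setT H -> (forall r, 0 <= H r)%E ->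
  (\int[lebesgue_measure]_x \int[lebesgue_measure]_y H (x ^+ 2 + y ^+ 2)%R =
   pi%:E * \int[lebesgue_measure]_r ((posi r)%:E * H r))%E.
Proof.
move=> mH H0; rewrite polar_D//; congr (_ * _)%E.
have me : measurable_fun setT (fun r : R => (expR (- r))%:E).
  by apply/measurable_EFinP; exact: measurableT_comp.
have := polar_D me (fun r => expR_ge0 _).
under [X in _ = (_ * X)%E]eq_integral do rewrite -EFinM.
rewrite integral_posi_exp mule1 => <-.
have gE x : (\int[lebesgue_measure]_y (expR (- (x ^+ 2 + y ^+ 2)))%:E =
    (expR (- x ^+ 2))%:E * (Num.sqrt pi)%:E)%E.
  under eq_integral do rewrite opprD expRD EFinM.
  rewrite ge0_integralZl//; first by rewrite integralT_gauss.
  by apply/measurable_EFinP; exact: measurable_gauss_fun.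
under eq_integral do rewrite gE.
rewrite ge0_integralZr//; last first.
  by apply/measurable_EFinP; exact: measurable_gauss_fun.
by rewrite integralT_gauss -EFinM -expr2 sqr_sqrtr// pi_ge0.
Qed.

End Polar.

(** * Squared moduli of a complex Gaussian vector *)

Section GaussianVector.
Context (R : realType).
Implicit Types m : nat.

Definition posb m (q : m.-tuple R) : bool := [forall i, 0 < tnth q i].

(** The joint density of [m] independent exponential variables of mean 1. *)
Definition expd m (q : m.-tuple R) : R :=
  (posb q)%:R * expR (- \sum_(i < m) tnth q i).

Lemma expd_ge0 m (q : m.-tuple R) : 0 <= expd q.
Proof. by rewrite mulr_ge0 ?expR_ge0. Qed.

Lemma expd_cons m r (q : m.-tuple R) :
  expd [tuple of r :: q] = posi r * expR (- r) * expd q.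
Proof.
rewrite /expd big_ord_recl opprD expRD tnth0.
under eq_bigr do rewrite tnthS.
have -> : posb [tuple of r :: q] = (0 < r) && posb q.
  apply/forallP/andP => [h|[r0 /forallP h] i].
    split; first by have := h ord0; rewrite tnth0.
    by apply/forallP => i; have := h (lift ord0 i); rewrite tnthS.
  by case: (unliftP ord0 i) => [j ->|->]; rewrite ?tnthS ?tnth0.
rewrite /posi; case: (0 < r) => /=; last by rewrite !mul0r.
by ring.
Qed.

Lemma measurable_posb d (T : measurableType d) m (f : T -> m.-tuple R) :
  measurable_fun setT f -> measurable_fun setT (fun x => posb (f x)).
Proof.
move=> mf; apply: measurable_forall => i; apply: measurable_fun_ltr => //.
exact: measurable_tnth_comp.
Qed.

Lemma measurable_expd d (T : measurableType d) m (f : T -> m.-tuple R) :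
  measurable_fun setT f -> measurable_fun setT (fun x => expd (f x)).
Proof.
move=> mf; apply: measurable_funM.
  by apply: measurable_natr_bool; exact: measurable_posb.
apply: measurableT_comp => //; apply: measurableT_comp => //.
by apply: measurable_sum => i; exact: measurable_tnth_comp.
Qed.

(** The density of a complex Gaussian vector in real coordinates; the entries [2i] and [2i + 1] are
    the real and imaginary parts of coordinate [i]. *)
Definition gaussd m (t : m.*2.-tuple R) : R :=
  pi ^- m * expR (- \sum_(i < m.*2) tnth t i ^+ 2).

Lemma gaussd_ge0 m (t : m.*2.-tuple R) : 0 <= gaussd t.
Proof. by rewrite mulr_ge0 ?expR_ge0// invr_ge0 exprn_ge0// pi_ge0. Qed.

Lemma measurable_gaussd d (T : measurableType d) m (f : T -> m.*2.-tuple R) :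
  measurable_fun setT f -> measurable_fun setT (fun x => gaussd (f x)).
Proof.
move=> mf; apply: measurable_funM => //; apply: measurableT_comp => //.
apply: measurableT_comp => //; apply: measurable_sum => i.
by apply: measurable_funX; exact: measurable_tnth_comp.
Qed.

Definition sqs m (t : m.*2.-tuple R) : m.-tuple R :=
  [tuple nth 0 t i.*2 ^+ 2 + nth 0 t i.*2.+1 ^+ 2 | i < m].

Lemma measurable_nth d (T : measurableType d) n (f : T -> n.-tuple R) k :
  measurable_fun setT f -> measurable_fun setT (fun x => nth 0 (f x) k).
Proof.
move=> mf; have [kn|nk] := ltnP k n; last first.
  rewrite (_ : (fun _ => _) = cst 0)//; apply/funext => x.
  by rewrite nth_default// size_tuple.
rewrite (_ : (fun _ => _) = fun x => tnth (f x) (Ordinal kn)).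
  exact: measurable_tnth_comp.
by apply/funext => x; rewrite (tnth_nth 0).
Qed.

Lemma measurable_sqs d (T : measurableType d) m (f : T -> m.*2.-tuple R) :
  measurable_fun setT f -> measurable_fun setT (fun x => sqs (f x)).
Proof.
move=> mf; apply: measurable_mktuple => i.
by apply: measurable_funD; apply: measurable_funX; exact: measurable_nth.
Qed.

Definition cons2 m (x y : R) (t : m.*2.-tuple R) : m.+1.*2.-tuple R :=
  [tuple of x :: [tuple of y :: t]].

Lemma gaussd_cons m x y (t : m.*2.-tuple R) : gaussd (cons2 x y t) =
  pi^-1 * expR (- (x ^+ 2 + y ^+ 2)) * gaussd t.
Proof.
rewrite /gaussd /cons2 2!big_ord_recl tnth0 tnthS tnth0.
under eq_bigr do rewrite 2!tnthS.
by rewrite exprS invfM addrA opprD expRD; ring.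
Qed.

Let sqs_cons m x y (t : m.*2.-tuple R) :
  sqs (cons2 x y t) = [tuple of (x ^+ 2 + y ^+ 2) :: sqs t].
Proof.
apply: eq_from_tnth => i; case: (unliftP ord0 i) => [j ->|->].
  by rewrite tnthS !tnth_mktuple.
by rewrite tnth0 tnth_mktuple.
Qed.

(** Polar coordinates in each pair of entries; the factor [pi] from the angle cancels the [1/pi] of
    the density. *)
Lemma gaussian_sqs m (f : m.-tuple R -> \bar R) :
  measurable_fun setT f -> (forall q, 0 <= f q)%E ->
  (\int[lebesgue_tuple R m.*2]_t ((gaussd t)%:E * f (sqs t)) =
   \int[lebesgue_tuple R m]_q ((expd q)%:E * f q))%E.
Proof.
elim: m f => [|m IH] f mf f0.
  have m0 (g : 0.-tuple R -> \bar R) : measurable_fun setT g.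
    have -> : g = cst (g [tuple]) by apply/funext => t; rewrite (tuple0 t).
    exact: measurable_cst.
  rewrite !integral_lebesgue_tuple0//.
  rewrite (tuple0 (sqs _)) /gaussd /expd !big_ord0 expr0 invr1 mul1r oppr0.
  by rewrite (_ : posb _) ?mul1r//; apply/forallP => -[].
have mLHS : measurable_fun setT (fun t : m.+1.*2.-tuple R => (gaussd t)%:E * f (sqs t))%E.
  apply: emeasurable_funM; first by apply/measurable_EFinP; exact: measurable_gaussd.
  by apply: measurableT_comp mf _; exact: measurable_sqs.
have L0 (t : m.+1.*2.-tuple R) : (0 <= (gaussd t)%:E * f (sqs t))%E.
  by rewrite mule_ge0 ?lee_fin ?gaussd_ge0.
have mRHS : measurable_fun setT (fun q : m.+1.-tuple R => (expd q)%:E * f q)%E.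
  apply: emeasurable_funM => //; apply/measurable_EFinP.
  exact: (@measurable_expd _ _ _ id).
have R0 (q : m.+1.-tuple R) : (0 <= (expd q)%:E * f q)%E.
  by rewrite mule_ge0 ?lee_fin ?expd_ge0.
rewrite [RHS]integral_lebesgue_tupleS//.
transitivity (\int[lebesgue_measure]_x \int[lebesgue_measure]_y
  \int[lebesgue_tuple R m.*2]_t ((gaussd (cons2 x y t))%:E * f (sqs (cons2 x y t))))%E.
  rewrite (@integral_lebesgue_tupleS R m.*2.+1)//.
  apply: eq_integral => x _; rewrite (@integral_lebesgue_tupleS R m.*2)//.
  exact: measurableT_comp mLHS (measurable_tuple_cons x).
pose K r : \bar R := (\int[lebesgue_tuple R m]_q ((expd q)%:E * f [tuple of r :: q]))%E.
have mfc r : measurable_fun setT (fun q : m.-tuple R => f [tuple of r :: q]).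
  exact: measurableT_comp mf (measurable_tuple_cons r).
have mK : measurable_fun setT K.
  apply: (@measurable_integral_tuple R m
    (fun z : R * m.-tuple R => (expd z.2)%:E * f (tcons z))%E).
    apply: emeasurable_funM; first by apply/measurable_EFinP; exact: measurable_expd.
    exact: measurableT_comp mf (@measurable_tcons R m).
  by move=> z; rewrite mule_ge0 ?lee_fin ?expd_ge0.
have K0 r : (0 <= K r)%E.
  by apply: integral_ge0 => q _; rewrite mule_ge0 ?lee_fin ?expd_ge0.
pose H r : \bar R := ((pi^-1 * expR (- r))%:E * K r)%E.
have pe0 r : 0 <= pi^-1 * expR (- r) :> R.
  by rewrite mulr_ge0 ?expR_ge0// invr_ge0 pi_ge0.
transitivity (\int[lebesgue_measure]_x \int[lebesgue_measure]_y H (x ^+ 2 + y ^+ 2)%R)%E.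
  apply: eq_integral => x _; apply: eq_integral => y _.
  under eq_integral do rewrite gaussd_cons sqs_cons EFinM -muleA.
  rewrite ge0_integralZl ?lee_fin//; last 2 first.
  - apply: emeasurable_funM.
      by apply/measurable_EFinP; exact: (@measurable_gaussd _ _ _ id).
    by apply: measurableT_comp (mfc _) _; exact: (@measurable_sqs _ _ _ id).
  - by move=> t _; rewrite mule_ge0 ?lee_fin ?gaussd_ge0.
  by rewrite (IH (fun q => f [tuple of (x ^+ 2 + y ^+ 2) :: q])).
rewrite ge0_integral_polar//; last 2 first.
- apply: emeasurable_funM => //; apply/measurable_EFinP; apply: measurable_funM => //.
  exact: measurableT_comp.
- by move=> r; rewrite mule_ge0 ?lee_fin.
rewrite -ge0_integralZl//; last 3 first.
- apply: emeasurable_funM; first by apply/measurable_EFinP; exact: measurable_posi.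
  apply: emeasurable_funM => //; apply/measurable_EFinP; apply: measurable_funM => //.
  exact: measurableT_comp.
- by move=> r _; rewrite mule_ge0 ?lee_fin ?posi_ge0// mule_ge0 ?lee_fin.
- by rewrite lee_fin pi_ge0.
apply: eq_integral => r _; under [RHS]eq_integral do rewrite expd_cons EFinM -muleA.
rewrite ge0_integralZl//; last 3 first.
- apply: emeasurable_funM => //.
  by apply/measurable_EFinP; exact: (@measurable_expd _ _ _ id).
- by move=> q _; rewrite mule_ge0 ?lee_fin ?expd_ge0.
- by rewrite lee_fin mulr_ge0 ?posi_ge0 ?expR_ge0.
rewrite -/(K r) /H !muleA -!EFinM; congr (_%:E * _)%E.
have pi0 : pi != 0 :> R by rewrite gt_eqF// pi_gt0.
by rewrite mulrACA mulfV// mul1r.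
Qed.

End GaussianVector.

(** * Unitary invariance of the Gaussian law *)

Section UnitaryInvariance.
Local Open Scope sesquilinear_scope.
Context (R : realType).
Local Notation C := R[i].
Implicit Types m : nat.

Let half_ord m (i : 'I_m.*2) : 'I_m :=
  Ordinal (etrans (ltn_half_double i m) (ltn_ord i)).

Let lt_dbl m (l : 'I_m) : (l.*2 < m.*2)%N.
Proof. by rewrite ltn_double. Qed.

Let lt_dblS m (l : 'I_m) : (l.*2.+1 < m.*2)%N.
Proof. by rewrite ltn_Sdouble. Qed.

Let even_ord m (l : 'I_m) : 'I_m.*2 := Ordinal (lt_dbl l).
Let odd_ord m (l : 'I_m) : 'I_m.*2 := Ordinal (lt_dblS l).

Let half_even m (l : 'I_m) : half_ord (even_ord l) = l.
Proof. by apply: val_inj; rewrite /= doubleK. Qed.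

Let half_odd m (l : 'I_m) : half_ord (odd_ord l) = l.
Proof. by apply: val_inj; rewrite /= uphalf_double. Qed.

Let ord_double m (i : 'I_m.*2) :
  i = if odd i then odd_ord (half_ord i) else even_ord (half_ord i).
Proof.
by case: ifPn => oi; apply: val_inj;
  rewrite /= -[LHS]odd_double_half ?oi ?(negbTE oi).
Qed.

Let sum_double m (G : 'I_m.*2 -> R) :
  \sum_j G j = \sum_(l < m) (G (even_ord l) + G (odd_ord l)).
Proof.
rewrite (partition_big (@half_ord m) xpredT)//=; apply: eq_bigr => l _.
rewrite (bigD1 (even_ord l)) ?half_even//=; congr (_ + _).
rewrite (bigD1 (odd_ord l)) ?half_odd ?eqxx//= ?big1 ?addr0//.
  move=> j /andP[/andP[/eqP jl je] jo]; move: je jo.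
  by rewrite (ord_double j) jl; case: ifP; rewrite eqxx.
by rewrite -val_eqE/= gtn_eqF.
Qed.

Definition cvec m (t : m.*2.-tuple R) : 'cV[C]_m :=
  \col_l (tnth t (even_ord l) +i* tnth t (odd_ord l))%C.

(** The real matrix of multiplication by [W]: an entry [a + ib] becomes the 2 by 2 block with rows
    [(a, -b)] and [(b, a)]. *)
Definition realmx_of m (W : 'M[C]_m) : 'M[R]_(m.*2) :=
  \matrix_(i, j) let z := W (half_ord i) (half_ord j) in
    if odd i then if odd j then complex.Re z else complex.Im z
    else if odd j then - complex.Im z else complex.Re z.

Lemma sqs_cvec m (t : m.*2.-tuple R) : sqs t = [tuple sqn (cvec t i 0) | i < m].
Proof.
apply: eq_from_tnth => i; rewrite !tnth_mktuple mxE /sqn /=.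
by rewrite !(tnth_nth 0).
Qed.

Lemma cvec_inj m : injective (@cvec m).
Proof.
move=> t1 t2 /colP E; apply: eq_from_tnth => i.
have := E (half_ord i); rewrite !mxE => -[E1 E2].
by rewrite (ord_double i); case: ifP.
Qed.

Let Re_sum m (F : 'I_m -> C) :
  complex.Re (\sum_i F i) = \sum_i complex.Re (F i).
Proof. by apply: (big_morph (@complex.Re R)) => // -[? ?] [? ?]. Qed.

Let Im_sum m (F : 'I_m -> C) :
  complex.Im (\sum_i F i) = \sum_i complex.Im (F i).
Proof. by apply: (big_morph (@complex.Im R)) => // -[? ?] [? ?]. Qed.

Lemma cvec_affact m (W : 'M[C]_m) (t : m.*2.-tuple R) :
  cvec (affact (realmx_of W) (fun=> 0) t) = W *m cvec t.
Proof.
apply/colP => k; rewrite !mxE !tnth_mktuple !addr0 !sum_double.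
apply/eqP; rewrite eq_complex /= Re_sum Im_sum; apply/andP; split; apply/eqP;
  apply: eq_bigr => l _; rewrite !mxE !half_even !half_odd /= ?odd_double /=;
  by case: (W k l) => a b /=; ring.
Qed.

Lemma sum_sqn m (t : m.*2.-tuple R) :
  \sum_(i < m.*2) tnth t i ^+ 2 = \sum_(l < m) sqn (cvec t l 0).
Proof. by rewrite sum_double; apply: eq_bigr => l _; rewrite mxE. Qed.

Let affact_cancel n (A B : 'M[R]_n) :
  (forall t, affact B (fun=> 0) (affact A (fun=> 0) t) = t) -> B *m A = 1%:M.
Proof.
move=> h; apply/matrixP => i k; rewrite !mxE.
pose e := [tuple (j == k)%:R : R | j < n].
have := congr1 (fun t => tnth t i) (h e); rewrite !tnth_mktuple addr0.
move=> <-; apply: eq_bigr => j _; rewrite tnth_mktuple addr0; congr (_ * _).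
rewrite (bigD1 k)//= tnth_mktuple eqxx mulr1 big1 ?addr0// => l lk.
by rewrite tnth_mktuple (negbTE lk) mulr0.
Qed.

Lemma sum_sqn_unitary m (W : 'M[C]_m) (z : 'cV[C]_m) : W \is unitarymx ->
  \sum_(l < m) sqn ((W *m z) l 0) = \sum_(l < m) sqn (z l 0).
Proof.
move=> /unitarymxP/mulmx1C WW.
have E (v : 'cV[C]_m) : (v^t* *m v) 0 0 = (\sum_(l < m) sqn (v l 0))%:C%C.
  rewrite mxE rmorph_sum; apply: eq_bigr => l _.
  by rewrite !mxE sqnE.
apply: (@complexI R); rewrite -!E trmx_mul map_mxM -mulmxA.
by rewrite (mulmxA _ W) WW mul1mx.
Qed.

Definition sqs_mul m (W : 'M[C]_m) (t : m.*2.-tuple R) : m.-tuple R :=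
  [tuple sqn ((W *m cvec t) i 0) | i < m].

Lemma gaussian_unitary m (W : 'M[C]_m) (f : m.-tuple R -> \bar R) :
  W \is unitarymx -> measurable_fun setT f -> (forall q, 0 <= f q)%E ->
  (\int[lebesgue_tuple R m.*2]_t
     ((gaussd t)%:E * f (sqs_mul W t)) =
   \int[lebesgue_tuple R m]_q ((expd q)%:E * f q))%E.
Proof.
move=> Wu mf f0; pose B := realmx_of W.
have Bu : B \in unitmx.
  have : realmx_of (W^t*) *m B = 1%:M.
    apply: affact_cancel => t; apply: cvec_inj; rewrite !cvec_affact mulmxA.
    by rewrite (mulmx1C (unitarymxP Wu)) mul1mx.
  by move=> /mulmx1_unit[].
have gB t : gaussd (affact B (fun=> 0) t) = gaussd t.
  by rewrite /gaussd !sum_sqn cvec_affact sum_sqn_unitary.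
have key (g : m.-tuple R -> \bar R) : measurable_fun setT g -> (forall q, 0 <= g q)%E ->
    (`|\det B|%:E * \int[lebesgue_tuple R m.*2]_t
      ((gaussd t)%:E * g (sqs_mul W t)) =
    \int[lebesgue_tuple R m]_q ((expd q)%:E * g q))%E.
  move=> mg g0; rewrite -gaussian_sqs//.
  have mG : measurable_fun setT (fun t : m.*2.-tuple R => (gaussd t)%:E * g (sqs t))%E.
    apply: emeasurable_funM.
      by apply/measurable_EFinP; exact: (@measurable_gaussd _ _ _ _ id).
    by apply: measurableT_comp mg _; exact: (@measurable_sqs _ _ _ _ id).
  have G0 (t : m.*2.-tuple R) : (0 <= (gaussd t)%:E * g (sqs t))%E.
    by rewrite mule_ge0 ?lee_fin ?gaussd_ge0.
  rewrite -(ge0_integral_linear (fun=> 0) Bu mG G0).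
  by under [in RHS]eq_integral do rewrite gB sqs_cvec cvec_affact.
(* Tested on the constant 1, both integrals equal 1, which forces the determinant of [B] to have
   absolute value 1. *)
have := key (fun=> 1%E) (measurable_cst _) (fun=> lee01).
have -> : (\int[lebesgue_tuple R m.*2]_t ((gaussd t)%:E * 1) =
  \int[lebesgue_tuple R m]_q ((expd q)%:E * 1))%E.
  by rewrite -(@gaussian_sqs _ _ (fun=> 1%E)).
have -> : (\int[lebesgue_tuple R m]_q ((expd q)%:E * 1) = 1)%E.
  under eq_integral do rewrite mule1.
  elim: m {W f Wu mf f0 B Bu gB key} => [|m IH].
    rewrite integral_lebesgue_tuple0; last first.
      by apply/measurable_EFinP; exact: (@measurable_expd _ _ _ _ id).
    rewrite /expd big_ord0 oppr0 expR0 mulr1 (_ : posb _)//.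
    by apply/forallP => -[].
  rewrite integral_lebesgue_tupleS; last 2 first.
  - by apply/measurable_EFinP; exact: (@measurable_expd _ _ _ _ id).
  - by move=> q; rewrite lee_fin expd_ge0.
  rewrite -[RHS](@integral_posi_exp R); apply: eq_integral => r _.
  under eq_integral do rewrite expd_cons EFinM.
  rewrite ge0_integralZl ?IH ?mule1//.
  - by apply/measurable_EFinP; exact: (@measurable_expd _ _ _ _ id).
  - by move=> q _; rewrite lee_fin expd_ge0.
  - by rewrite lee_fin mulr_ge0 ?posi_ge0 ?expR_ge0.
rewrite mule1 => -[detB]; rewrite -key// detB mul1e.
by [].
Qed.

End UnitaryInvariance.

(** * The law of the roots of the secular equation *)

Section SecularEquation.
Context (R : realType).
Implicit Types m n : nat.

Definition others m (d : m.-tuple R) (i : 'I_m) : {poly R} :=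
  \prod_(j < m | j != i) ('X - (tnth d j)%:P).

Lemma size_others m (d : m.-tuple R) i : size (others d i) = m.
Proof.
rewrite /others -big_filter size_prod_XsubC size_filter.
by rewrite -sum1_count sum1_card (cardC1 i) card_ord prednK// (leq_ltn_trans _ (ltn_ord i)).
Qed.

Lemma monic_others m (d : m.-tuple R) i : others d i \is monic.
Proof. by apply: monic_prod => j _; exact: monicXsubC. Qed.

Lemma horner_others m (d : m.-tuple R) i :
  (others d i).[tnth d i] = \prod_(j < m | j != i) (tnth d i - tnth d j).
Proof. by rewrite horner_prod; apply: eq_bigr => j _; rewrite hornerXsubC. Qed.

Lemma horner_others0 m (d : m.-tuple R) i k : k != i -> (others d i).[tnth d k] = 0.
Proof.
by move=> ki; rewrite horner_prod (bigD1 k)//= hornerXsubC subrr mul0r.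
Qed.

Lemma secpE m (d q : m.-tuple R) :
  secp d q = rootp d - \sum_(i < m) tnth q i *: others d i.
Proof. by []. Qed.

Let size_sum_others m (d q : m.-tuple R) :
  (size (\sum_(i < m) tnth q i *: others d i)%R <= m)%N.
Proof.
apply: (leq_trans (size_sum _ _ _)); apply/bigmax_leqP => i _.
by rewrite (leq_trans (size_scale_leq _ _))// size_others.
Qed.

Lemma size_secp m (d q : m.-tuple R) : size (secp d q) = m.+1.
Proof. by rewrite secpE size_addl size_rootp// size_polyN ltnS. Qed.

Lemma monic_secp m (d q : m.-tuple R) : secp d q \is monic.
Proof.
rewrite monicE lead_coefE size_secp/= secpE coefB [X in _ - X]nth_default// subr0.
by have := monic_rootp d; rewrite monicE lead_coefE size_rootp.
Qed.

Definition scoef m (d q : m.-tuple R) : m.-tuple R :=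
  [tuple (secp d q)`_i | i < m].

Lemma mpoly_scoef m (d q : m.-tuple R) : mpoly (scoef d q) = secp d q.
Proof. by apply: mpolyP; [exact: monic_secp|exact: size_secp]. Qed.

Lemma horner_rootp_self m (d : m.-tuple R) i : (rootp d).[tnth d i] = 0.
Proof. by rewrite horner_rootp (bigD1 i)//= subrr mul0r. Qed.

Lemma horner_secp m (d q : m.-tuple R) i :
  (secp d q).[tnth d i] = - (tnth q i * (others d i).[tnth d i]).
Proof.
rewrite secpE hornerD hornerN horner_rootp_self sub0r horner_sum (bigD1 i)//=.
rewrite big1 ?addr0 ?hornerZ// => j ji.
by rewrite hornerZ horner_others0 ?mulr0// eq_sym.
Qed.

(* Partial fractions: [q_i] is minus the residue of [secp d q / rootp d] at [d_i]. *)
Definition qof m (d c : m.-tuple R) : m.-tuple R :=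
  [tuple - (mpoly c).[tnth d i] / (others d i).[tnth d i] | i < m].

Lemma measurable_qof m (d : m.-tuple R) : measurable_fun setT (qof d).
Proof.
apply: measurable_mktuple => i; apply: measurable_funM => //.
apply: measurableT_comp => //.
by have := @measurable_horner_mpoly R _ _ m id (cst (tnth d i)) 0%N; apply.
Qed.

Section Distinct.
Variables (m : nat) (d : m.-tuple R).
Hypothesis dinj : injective (tnth d).

Lemma others_neq0 i : (others d i).[tnth d i] != 0.
Proof.
rewrite horner_others; apply/prodf_neq0 => j ji; rewrite subr_eq0.
by apply: contra ji => /eqP/dinj ->.
Qed.

Lemma qof_scoef q : qof d (scoef d q) = q.
Proof.
apply: eq_from_tnth => i; rewrite tnth_mktuple mpoly_scoef horner_secp opprK.
by rewrite mulfK// others_neq0.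
Qed.

(** Two monic polynomials of degree [m] that agree at the [m] distinct points [d_i] coincide. *)
Lemma secp_qof c : secp d (qof d c) = mpoly c.
Proof.
apply/eqP; rewrite -subr_eq0; set p := _ - _.
have ps : (size p <= m)%N.
  apply/leq_sizeP => j; rewrite leq_eqVlt => /predU1P[<-|mj].
    have /eqP := monic_secp d (qof d c); have /eqP := monic_mpoly c.
    rewrite !lead_coefE size_secp size_mpoly/= => c1 s1.
    by rewrite coefB c1 s1 subrr.
  by rewrite nth_default// (leq_trans _ mj)// (leq_trans (size_polyD _ _))//
    size_polyN size_secp size_mpoly maxnn.
apply/eqP; apply: (@roots_geq_poly_eq0 _ p [seq tnth d i | i <- enum 'I_m]).
- apply/allP => _ /mapP[i _ ->]; rewrite rootE hornerD hornerN horner_secp.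
  by rewrite tnth_mktuple divfK ?others_neq0// opprK subrr.
- by rewrite map_inj_uniq ?enum_uniq.
- by rewrite size_map size_enum_ord.
Qed.

(** The linear part of [scoef d]. Multiplied by the Vandermonde matrix [V], that is, evaluated at
    the [d_i], it becomes diagonal, which gives its determinant. *)
Let Cm : 'M[R]_m := \matrix_(k, i) - (others d i)`_k.

Let scoef_affact q : scoef d q = affact Cm (tnth (coefs d)) q.
Proof.
apply: eq_from_tnth => k; rewrite !tnth_mktuple secpE coefB addrC; congr (_ + _).
rewrite coef_sum -sumrN; apply: eq_bigr => i _.
by rewrite !mxE coefZ mulNr mulrC.
Qed.

Let V : 'M[R]_m := \matrix_(i, k) (tnth d i) ^+ k.

Let VCm : V *m Cm = diag_mx (\row_i - (others d i).[tnth d i]).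
Proof.
apply/matrixP => i l; rewrite !mxE.
transitivity (- (others d l).[tnth d i]).
  rewrite (@horner_coef_wide _ m) ?size_others// -sumrN.
  by apply: eq_bigr => k _; rewrite !mxE mulrN mulrC.
have [->|il] := eqVneq i l; first by rewrite mulr1n.
by rewrite horner_others0// oppr0 mulr0n.
Qed.

Let detV : `|\det V| = `|vand d|.
Proof.
have -> : V = (Vandermonde m (\row_i tnth d i))^T.
  by apply/matrixP => i j; rewrite !mxE.
rewrite det_tr det_Vandermonde /vand !normr_prod; apply: eq_bigr => i _.
by rewrite !normr_prod; apply: eq_bigr => j _; rewrite !mxE distrC.
Qed.

(** Each pair of indices occurs twice, once in each order. *)
Let prod_others : `|\prod_i (others d i).[tnth d i]| = `|vand d| ^+ 2.
Proof.
have -> : \prod_i (others d i).[tnth d i] =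
    (\prod_(i < m) \prod_(j < m | (i < j)%N) (tnth d i - tnth d j)) *
    \prod_(i < m) \prod_(j < m | (j < i)%N) (tnth d i - tnth d j).
  rewrite -big_split; apply: eq_bigr => i _ /=; rewrite horner_others.
  rewrite (bigID (fun j : 'I_m => (i < j)%N))/=; congr (_ * _); apply: eq_bigl => j.
    by rewrite -val_eqE/=; case: ltngtP.
  by rewrite -val_eqE/=; case: ltngtP.
rewrite normrM expr2; congr (_ * _).
rewrite (exchange_big_dep xpredT)//= /vand !normr_prod; apply: eq_bigr => i _.
by rewrite !normr_prod; apply: eq_bigr => j _; rewrite distrC.
Qed.

Lemma vand_neq0 : vand d != 0.
Proof.
apply/prodf_neq0 => i _; apply/prodf_neq0 => j ij; rewrite subr_eq0.
by apply/eqP => /dinj E; rewrite E ltnn in ij.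
Qed.

Let detC : `|\det Cm| = `|vand d|.
Proof.
have v0 : `|vand d| != 0 by rewrite normr_eq0 vand_neq0.
apply: (mulfI v0); rewrite -detV -normrM -det_mulmx VCm det_diag detV -expr2.
rewrite -prod_others !normr_prod; apply: eq_bigr => i _.
by rewrite mxE normrN.
Qed.

(** Two substitutions: from [q] to the coefficients of the secular polynomial, affine with the
    absolute value of [vand d] as Jacobian, and from coefficients to roots, with Jacobian
    [vand l]. *)
Lemma ge0_integral_roots_secp (x : m.-tuple R -> m.-tuple R) (f : m.-tuple R -> \bar R) :
  measurable_fun setT x ->
  (forall q, posb q -> secp d q = rootp (x q) /\ sdec (x q)) ->
  measurable_fun setT f -> (forall q, 0 <= f q)%E ->
  (`|vand d|%:E * \int[lebesgue_tuple R m]_q ((expd q)%:E * f (x q)) =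
   \int[lebesgue_tuple R m]_l (((sdec l)%:R * vand l)%:E *
     ((expd (qof d (coefs l)))%:E * f l)))%E.
Proof.
move=> mx xP mf f0.
pose h c : \bar R := ((expd (qof d c))%:E * f (x (qof d c)))%E.
have mqof := @measurable_qof _ d.
have mh : measurable_fun setT h.
  apply: emeasurable_funM; first by apply/measurable_EFinP; exact: measurable_expd.
  by apply: measurableT_comp mf _; exact: measurableT_comp mx mqof.
have h0 c : (0 <= h c)%E by rewrite mule_ge0 ?lee_fin ?expd_ge0.
have Cu : Cm \in unitmx.
  by rewrite unitmxE unitfE -normr_eq0 detC normr_eq0 vand_neq0.
transitivity (\int[lebesgue_tuple R m]_c h c)%E.
  rewrite -(ge0_integral_linear (tnth (coefs d)) Cu mh h0) detC.
  by under [in RHS]eq_integral do rewrite -scoef_affact /h qof_scoef.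
have posq c : h c != 0%E -> posb (qof d c).
  by apply: contraNT => /negbTE np; rewrite /h /expd np mul0r mul0e.
have hr c : h c != 0%E -> exists2 l : m.-tuple R, sdec l & mpoly c = rootp l.
  move=> /posq/xP[E lx]; exists (x (qof d c)) => //.
  by rewrite -E secp_qof.
rewrite (roots_to_coefs mh h0 hr).
apply: eq_integral => l _; have [sl|] := boolP (sdec l); last by rewrite !mul0r !mul0e.
congr (_ * _)%E; rewrite /h.
have [pq|/negbTE np] := boolP (posb (qof d (coefs l))); last first.
  by rewrite /expd np mul0r !mul0e.
have [E lx] := xP _ pq; congr (_ * f _)%E.
have nin (y : m.-tuple R) : sdec y -> nonincr y.
  move=> /sdecP yd i j; rewrite leq_eqVlt => /predU1P[ij|/yd/ltW//].
  by rewrite (val_inj ij).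
by apply: rootp_inj; [exact: nin|exact: nin|rewrite -E secp_qof mpoly_coefs].
Qed.

End Distinct.

(** Comparison of subleading coefficients, that is, of traces. It turns the exponential weight in
    [q] into a function of the roots. *)
Lemma sum_qof n (d c : n.+1.-tuple R) (l : n.+1.-tuple R) : injective (tnth d) ->
  mpoly c = rootp l ->
  \sum_(i < n.+1) tnth (qof d c) i = \sum_(i < n.+1) tnth l i - \sum_(i < n.+1) tnth d i.
Proof.
move=> dinj cl.
have coefn (y : n.+1.-tuple R) : (rootp y)`_n = - \sum_(i < n.+1) tnth y i.
  have := @coefPn_prod_XsubC R (val y); rewrite size_tuple => /(_ isT).
  by rewrite /rootp !big_tuple.
have := congr1 (fun p : {poly R} => p`_n) (secp_qof dinj c).
rewrite cl /= secpE coefB !coefn coef_sum => E.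
have : \sum_i tnth (qof d c) i = \sum_(i < n.+1) (tnth (qof d c) i *: others d i)`_n.
  apply: eq_bigr => i _; rewrite coefZ.
  have /eqP := monic_others d i; rewrite lead_coefE size_others/= => ->.
  by rewrite mulr1.
by move=> ->; move: E; lra.
Qed.

End SecularEquation.

(** * Positive residues and interlacing *)

Section Interlacing.
Context (R : realType).
Implicit Types n : nat.

Lemma prod_sign n (F : 'I_n -> R) k : (k <= n)%N ->
  (forall j : 'I_n, (j < k)%N -> F j <= 0) ->
  (forall j : 'I_n, (k <= j)%N -> 0 <= F j) ->
  \prod_j F j = (-1) ^+ k * \prod_j `|F j|.
Proof.
move=> kn Fneg Fpos.
transitivity (\prod_(j < n) ((if (j < k)%N then -1 else 1) * `|F j|)).
  apply: eq_bigr => j _; case: ltnP => jk.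
    by rewrite ler0_norm ?Fneg// mulN1r opprK.
  by rewrite ger0_norm ?Fpos// mul1r.
rewrite big_split/=; congr (_ * _); rewrite -big_mkcond/=.
by rewrite -(big_ord_widen n (fun=> -1) kn) prodr_const card_ord.
Qed.

Definition inter n (a : n.-tuple R) (l : n.+1.-tuple R) : bool :=
  [forall i : 'I_n, (tnth l (lift ord0 i) < tnth a i) &&
     (tnth a i < tnth l (widen_ord (leqnSn n) i))] && (0 < tnth l ord_max).

(** Since [nth 0 a n] is the default 0, the condition on [tnth l ord_max] becomes the case [i = n]
    of the second family. *)
Lemma interP n (a : n.-tuple R) (l : n.+1.-tuple R) :
  reflect ((forall i, (i < n)%N -> nth 0 l i.+1 < nth 0 a i) /\
           (forall i, (i <= n)%N -> nth 0 a i < nth 0 l i)) (inter a l).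
Proof.
apply: (iffP andP) => [[/forallP h l0]|[h1 h2]].
  split=> i.
    by move=> lin; have /andP[+ _] := h (Ordinal lin); rewrite !(tnth_nth 0).
  rewrite leq_eqVlt => /predU1P[->|lin].
    by rewrite [X in X < _]nth_default ?size_tuple//; move: l0; rewrite (tnth_nth 0).
  by have /andP[_] := h (Ordinal lin); rewrite !(tnth_nth 0).
split.
  by apply/forallP => i; rewrite !(tnth_nth 0) /= h1//= h2// ltnW.
have := h2 n (leqnn _); rewrite [X in X < _]nth_default ?size_tuple//.
by rewrite (tnth_nth 0).
Qed.

Section Fixed.
Variables (n : nat) (a : n.-tuple R).
Hypotheses (sa : sdec a) (pa : posb a).

(** The sequence [a] followed by 0: the default value stands for the additional entry 0, here in its
    place in decreasing order, whereas [d] has it at the head. *)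
Let b i : R := nth 0 a i.

Let b_tnth (i : 'I_n) : b i = tnth a i. Proof. by rewrite (tnth_nth 0). Qed.

Let b_lt i j : (i < j <= n)%N -> b j < b i.
Proof.
move=> /andP[ij jn]; have lin : (i < n)%N by exact: leq_trans jn.
move: jn; rewrite leq_eqVlt => /predU1P[->|jn].
  by rewrite {1}/b nth_default ?size_tuple// (b_tnth (Ordinal lin)) (forallP pa).
by rewrite (b_tnth (Ordinal lin)) (b_tnth (Ordinal jn)) (sdecP _ sa).
Qed.

Definition altsign (l : n.+1.-tuple R) :=
  forall i, (i <= n)%N -> 0 < (-1) ^+ i.+1 * (rootp l).[b i].

Let nth_nonincr (l : n.+1.-tuple R) i j : nonincr l -> (i <= j <= n)%N ->
  nth 0 l j <= nth 0 l i.
Proof.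
move=> nl /andP[ij jn]; have lin : (i < n.+1)%N by rewrite ltnS (leq_trans ij).
by have := nl (Ordinal lin) (Ordinal (jn : (j < n.+1)%N)) ij; rewrite !(tnth_nth 0).
Qed.

(** The sign at [b i] is the parity of the number of roots above it. Going down from the top this
    forces [b i] below the root of index [i]; then, going up from the bottom, above the root of
    index [i + 1]. *)
Lemma altsign_inter (l : n.+1.-tuple R) : nonincr l -> altsign l -> inter a l.
Proof.
move=> nl S; apply/interP.
(* If the first [k] roots are at or above [b i], the others at or below, and [k] has the parity of
   [i], then the sign at [b i] is wrong. *)
have contra_sign i k : (i <= n)%N -> (k <= n.+1)%N -> odd (i + k) = false ->
    (forall j : 'I_n.+1, (j < k)%N -> b i - tnth l j <= 0) ->
    (forall j : 'I_n.+1, (k <= j)%N -> 0 <= b i - tnth l j) -> False.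
  move=> lin kn ik h1 h2; have := S _ lin.
  rewrite horner_rootp (prod_sign kn h1 h2) mulrA -exprD -signr_odd.
  rewrite addSn /= ik /= expr1 mulN1r oppr_gt0 ltNge => /negP; apply.
  exact: prodr_ge0.
(* Otherwise the roots above [b i] are the first [i] ones, by the bounds already obtained at the
   larger points. *)
have above i : (i <= n)%N -> b i < nth 0 l i.
  elim/ltn_ind: i => i IH lin; rewrite ltNge; apply/negP => li.
  apply: (contra_sign i i) => //; first by rewrite ltnW.
  - by rewrite addnn odd_double.
  - move=> j ji; rewrite subr_le0 (tnth_nth 0) ltW// (lt_trans _ (IH _ ji _))//.
      by rewrite b_lt// ji.
    by rewrite (leq_trans (ltnW ji)).
  - move=> j ij; rewrite subr_ge0 (tnth_nth 0) (le_trans _ li)//.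
    by rewrite nth_nonincr// ij leq_ord.
split => //; suff below k i : (i + k.+1 = n)%N -> nth 0 l i.+1 < b i.
  by move=> i lin; apply: (below (n - i.+1)%N); rewrite -subSn// subnKC// ltnW.
(* Otherwise the first [i + 2] roots are at least [b i], while the induction hypothesis puts the
   remaining ones below it. *)
elim/ltn_ind: k i => k IH i ikn; rewrite ltNge; apply/negP => li.
have lin : (i < n)%N by rewrite -ikn addnS ltnS leq_addr.
apply: (contra_sign i i.+2) => //; first exact: ltnW.
- by rewrite !addnS /= addnn odd_double.
- move=> j; rewrite ltnS => ji; rewrite subr_le0 (tnth_nth 0) (le_trans li)//.
  by rewrite nth_nonincr// ji.
- case=> -[//|j] jn' /= ij'; have ij : (i < j)%N by [].
  have jn : (j < n)%N by [].
  rewrite subr_ge0 (tnth_nth 0)/= ltW//.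
  have jk : (n - j.+1 < k)%N.
    by rewrite -ikn -(ltn_add2l j.+1) subnKC ?addSnnS ?ltn_add2r// ikn.
  have jE : (j + (n - j.+1).+1 = n)%N by rewrite -subSn// subSS subnKC// ltnW.
  by rewrite (lt_trans (IH _ jk j jE))// b_lt// ij ltnW.
Qed.

Lemma inter_sdec (l : n.+1.-tuple R) : inter a l -> nonincr l -> sdec l.
Proof.
move=> /interP[h1 h2] nl; apply/sdecP => i j ij; rewrite !(tnth_nth 0).
have lin : (i < n)%N by rewrite (leq_trans ij)// -ltnS.
rewrite (le_lt_trans _ (lt_trans (h1 i lin) (h2 i (ltnW lin))))//.
by rewrite nth_nonincr// ij leq_ord.
Qed.

Lemma inter_altsign (l : n.+1.-tuple R) : nonincr l -> inter a l -> altsign l.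
Proof.
move=> nl /interP[h1 h2] i lin.
have neg (j : 'I_n.+1) : (j < i.+1)%N -> b i - tnth l j < 0.
  rewrite ltnS => ji; rewrite subr_lt0 (tnth_nth 0) (lt_le_trans (h2 _ lin))//.
  by rewrite nth_nonincr// ji.
have pos (j : 'I_n.+1) : (i.+1 <= j)%N -> 0 < b i - tnth l j.
  move=> ij; have lin' : (i < n)%N by rewrite (leq_trans ij)// -ltnS.
  rewrite subr_gt0 (tnth_nth 0) (le_lt_trans _ (h1 _ lin'))//.
  by rewrite nth_nonincr// ij leq_ord.
rewrite horner_rootp (@prod_sign _ _ i.+1)//; last 2 first.
- by move=> j /neg/ltW.
- by move=> j /pos/ltW.
rewrite mulrA -exprD -signr_odd addnn odd_double expr0 mul1r.
apply: prodr_gt0 => j _; rewrite normr_gt0.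
by have [/neg/lt_eqF ->|/pos/gt_eqF ->] := ltnP j i.+1.
Qed.

Let d : n.+1.-tuple R := [tuple of 0 :: a].

Lemma cons0_inj : injective (tnth d).
Proof.
have lt0 i : tnth a i == 0 = false by rewrite gt_eqF//; exact: (forallP pa).
move=> i j; case: (unliftP ord0 i) => [i' ->|->]; case: (unliftP ord0 j) => [j' ->|->] //.
- rewrite !tnthS => E; congr lift; apply: val_inj.
  by case: (ltngtP i' j') => [/(sdecP _ sa)|/(sdecP _ sa)|//]; rewrite E ltxx.
- by rewrite tnthS tnth0 => /eqP; rewrite lt0.
- by rewrite tnthS tnth0 => /esym/eqP; rewrite lt0.
Qed.

Lemma vand_cons0 : `|vand d| = (\prod_(i < n) tnth a i) * vand a.
Proof.
rewrite vand_cons normrM horner_rootp normr_prod (gtr0_norm (vand_gt0 sa)).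
congr (_ * _); apply: eq_bigr => i _.
by rewrite sub0r normrN gtr0_norm//; exact: (forallP pa).
Qed.

(** Signs of the denominators in [qof], here and in [denS]: the entry 0 is below all [n] others,
    whence [(-1)^n]; [a_i] is below exactly [i] entries, whence [(-1)^i]. *)
Let den0 : 0 < (-1) ^+ n * (others d ord0).[tnth d ord0].
Proof.
rewrite horner_others big_mkcond big_ord_recl/= mul1r.
rewrite (eq_bigr (fun j => - tnth a j)); last first.
  by move=> j _; rewrite tnthS tnth0 sub0r.
rewrite (@prod_sign _ _ n)//; last 2 first.
- by move=> j _; rewrite oppr_le0 ltW//; exact: (forallP pa).
- by move=> j; rewrite leqNgt ltn_ord.
rewrite mulrA -exprD -signr_odd addnn odd_double mul1r.
by apply: prodr_gt0 => j _; rewrite normrN normr_gt0 gt_eqF//; exact: (forallP pa).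
Qed.

Let denS (i : 'I_n) : 0 < (-1) ^+ i * (others d (lift ord0 i)).[tnth d (lift ord0 i)].
Proof.
rewrite horner_others big_mkcond big_ord_recl/= tnth0 !tnthS subr0 mulrCA.
rewrite mulr_gt0//; first exact: (forallP pa).
rewrite (eq_bigr (fun j => if j == i then 1 else tnth a i - tnth a j)); last first.
  move=> j _; rewrite tnthS (inj_eq lift_inj).
  by case: (j == i).
have lt (j k : 'I_n) : (j < k)%N -> tnth a k < tnth a j by exact: (sdecP _ sa).
rewrite (@prod_sign _ _ i) ?(ltnW (ltn_ord i))//; last 2 first.
- by move=> j ji; rewrite -val_eqE/= ltn_eqF// subr_le0 ltW// lt.
- move=> j; rewrite leq_eqVlt => /predU1P[/val_inj ->|ij]; first by rewrite eqxx.
  by rewrite -val_eqE/= gtn_eqF// subr_ge0 ltW// lt.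
rewrite mulrA -exprD -signr_odd addnn odd_double mul1r.
apply: prodr_gt0 => j _; have [_|ji] := boolP (j == i).
  by rewrite normr_gt0 oner_neq0.
rewrite normr_gt0 subr_eq0; case: (ltngtP j i) => [/lt/lt_eqF ->//|/lt/gt_eqF ->//|/val_inj E].
by rewrite E eqxx in ji.
Qed.

Let sign_div (k : nat) (r D : R) : 0 < (-1) ^+ k * D ->
  (0 < - r / D) = (0 < (-1) ^+ k.+1 * r).
Proof.
move=> kD; have D0 : D != 0 by apply: contraTneq kD => ->; rewrite mulr0 ltxx.
have -> : - r / D = (-1) ^+ k.+1 * r / ((-1) ^+ k * D).
  have s0 : (-1) ^+ k != 0 :> R by rewrite signr_eq0.
  by rewrite exprS; field; rewrite D0 s0.
by rewrite pmulr_lgt0// invr_gt0.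
Qed.

(** The residue at [a_i] matches the sign condition of index [i], and the residue at the head 0 of
    [d] that of index [n]. *)
Lemma posb_qofP (l : n.+1.-tuple R) :
  reflect (altsign l) (posb (qof d (coefs l))).
Proof.
apply: (iffP forallP) => [h i|S i].
  rewrite leq_eqVlt => /predU1P[->|lin].
    rewrite /b nth_default ?size_tuple//.
    have := h ord0; rewrite tnth_mktuple mpoly_coefs (sign_div _ den0) tnth0; exact.
  have := h (lift ord0 (Ordinal lin)).
  by rewrite tnth_mktuple mpoly_coefs (sign_div _ (denS _)) tnthS (tnth_nth 0).
rewrite tnth_mktuple mpoly_coefs; case: (unliftP ord0 i) => [j ->|->].
  rewrite (sign_div _ (denS _)) tnthS (tnth_nth 0); apply: S; exact: ltnW.
rewrite (sign_div _ den0) tnth0.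
by have := S n (leqnn _); rewrite /b nth_default ?size_tuple.
Qed.

Lemma posb_qof_inter (l : n.+1.-tuple R) : nonincr l ->
  posb (qof d (coefs l)) = inter a l.
Proof.
move=> nl; apply/posb_qofP/idP; first exact: altsign_inter.
exact: inter_altsign.
Qed.

End Fixed.
End Interlacing.

(** * Law of the roots of the secular polynomial for fixed [a] *)

Section StepLaw.
Context {R : realType} (n : nat).
Implicit Types (a : n.-tuple R) (q l : n.+1.-tuple R).

(** Real-rootedness is available for nonnegative weights; absolute values turn the roots into a
    total function of [q] and change nothing on the support of [expd]. *)
Let absq q : n.+1.-tuple R := [tuple `|tnth q i| | i < n.+1].

Let exists_ev a q : exists x : n.+1.-tuple R, nonincr x /\ secp [tuple of 0 :: a] (absq q) = rootp x.
Proof.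
have [|x nx xE] := @exists_roots_secp R _ [tuple of 0 :: a] (absq q).
  by move=> i; rewrite tnth_mktuple.
by exists x.
Qed.

Definition secular_roots a q := sval (cid (exists_ev a q)).

Lemma nonincr_secular_roots a q : nonincr (secular_roots a q).
Proof. by rewrite /secular_roots; case: cid => x []. Qed.

Let secular_rootsE a q : secp [tuple of 0 :: a] (absq q) = rootp (secular_roots a q).
Proof. by rewrite /secular_roots; case: cid => x []. Qed.

Lemma rootp_secular_roots a q : (forall i, 0 <= tnth q i) ->
  rootp (secular_roots a q) = secp [tuple of 0 :: a] q.
Proof.
move=> q0; rewrite -secular_rootsE; congr secp.
by apply: eq_from_tnth => i; rewrite tnth_mktuple ger0_norm.
Qed.

Lemma measurable_secular_roots a : measurable_fun setT (secular_roots a).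
Proof.
apply: (@measurable_ordered_roots _ _ _ _ (fun q => secp [tuple of 0 :: a] (absq q))).
- move=> k; rewrite (_ : (fun _ => _) = (fun q => (rootp [tuple of 0 :: a])`_k -
     \sum_(i < n.+1) `|tnth q i| * (others [tuple of 0 :: a] i)`_k)).
    apply: measurable_funB; first exact: measurable_cst.
    apply: measurable_sum => i; apply: measurable_funM; last exact: measurable_cst.
    by apply: measurableT_comp; [exact: normr_measurable|exact: measurable_tnth].
  apply/funext => q; rewrite secpE coefB coef_sum; congr (_ - _).
  by apply: eq_bigr => i _; rewrite coefZ tnth_mktuple.
- by move=> q; rewrite secular_rootsE.
- exact: nonincr_secular_roots.
Qed.

(** For positive decreasing [a] the denominator is the absolute Vandermonde product of [0 :: a]
    ([vand_cons0]), the Jacobian of the passage from [q] to the coefficients. *)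
Definition interlacing_kernel a l : R :=
  (inter a l)%:R * ((sdec l)%:R * vand l *
    expR (\sum_(i < n) tnth a i - \sum_(i < n.+1) tnth l i)) /
  ((\prod_(i < n) tnth a i) * vand a).

Lemma secular_roots_law a (f : n.+1.-tuple R -> \bar R) : sdec a -> posb a ->
  measurable_fun setT f -> (forall l, 0 <= f l)%E ->
  (\int[lebesgue_tuple R n.+1]_q ((expd q)%:E * f (secular_roots a q)) =
   \int[lebesgue_tuple R n.+1]_l ((interlacing_kernel a l)%:E * f l))%E.
Proof.
move=> sa pa mf f0.
set d := [tuple of 0 :: a].
have dinj : injective (tnth d) by exact: cons0_inj.
set D : R := `|vand d|.
have D0 : 0 < D by rewrite normr_gt0 vand_neq0.
have xP q : posb q -> secp d q = rootp (secular_roots a q) /\ sdec (secular_roots a q).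
  move=> /forallP pq; have q0 i : 0 <= tnth q i by exact/ltW/pq.
  have xE := rootp_secular_roots a q0; split; first by rewrite xE.
  (* Positive weights are recovered as the residues of their own secular polynomial, so its roots
     interlace [a], which makes them simple. *)
  apply: (@inter_sdec _ _ a); last exact: nonincr_secular_roots.
  rewrite -(posb_qof_inter sa pa); last exact: nonincr_secular_roots.
  suff -> : qof d (coefs (secular_roots a q)) = q by exact/forallP.
  rewrite -[RHS](qof_scoef dinj); congr qof; apply: mpoly_inj.
  by rewrite mpoly_coefs mpoly_scoef xE.
have := ge0_integral_roots_secp dinj (measurable_secular_roots a) xP mf f0.
move=> /(congr1 (fun z => (D^-1)%:E * z)%E).
rewrite muleA -EFinM mulVf ?gt_eqF// mul1e => ->.
rewrite -ge0_integralZl//; last 3 first.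
- apply: emeasurable_funM.
    apply/measurable_EFinP; apply: measurable_funM; last exact: (@measurable_vand _ _ _ _ id).
    by apply: measurable_natr_bool; exact: (@measurable_sdec _ _ _ _ id).
  apply: emeasurable_funM mf; apply/measurable_EFinP.
  by apply: measurable_expd; apply: measurableT_comp (@measurable_qof _ _ d) _; exact: (@measurable_coefs _ _ _ _ id).
- move=> l _; rewrite mule_ge0// ?mule_ge0 ?lee_fin ?expd_ge0//.
  have [sl|] := boolP (sdec l); last by rewrite mul0r.
  by rewrite mul1r ltW// vand_gt0.
- by rewrite lee_fin invr_ge0 ltW.
apply: eq_integral => l _; rewrite !muleA -!EFinM; congr (_%:E * _)%E.
rewrite /interlacing_kernel -vand_cons0// -/d -/D.
have [sl|] := boolP (sdec l); last by rewrite !(mul0r, mulr0).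
rewrite /expd posb_qof_inter//; last first.
  by move=> i j; rewrite leq_eqVlt => /predU1P[/val_inj ->//|/(sdecP _ sl)/ltW].
rewrite (@sum_qof _ _ _ _ l dinj) ?mpoly_coefs//.
rewrite [\sum_(i < n.+1) tnth d i]big_ord_recl tnth0 add0r opprB.
rewrite (eq_bigr (tnth a)); last by move=> i _; rewrite tnthS.
by rewrite !mul1r [RHS]mulrC; ring.
Qed.

End StepLaw.

(** * Integration over interlacing tuples *)

Section ProductIntegral.
Local Open Scope ereal_scope.
Context {R : realType}.

Section Pair.
Context d1 d2 (T1 : measurableType d1) (T2 : measurableType d2).
Variables (m1 : {sigma_finite_measure set T1 -> \bar R}).
Variables (m2 : {sigma_finite_measure set T2 -> \bar R}).
Variables (f : T1 -> R) (g : T2 -> R).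
Hypotheses (intf : m1.-integrable setT (EFin \o f)).
Hypotheses (intg : m2.-integrable setT (EFin \o g)).

Lemma integrable_prod_pair :
  (m1 \x m2).-integrable setT (fun p : T1 * T2 => (f p.1 * g p.2)%R%:E).
Proof.
have mf := measurable_int _ intf; have mg := measurable_int _ intg.
have mF : measurable_fun setT (fun p : T1 * T2 => (f p.1 * g p.2)%R%:E).
  apply/measurable_EFinP; apply: measurable_funM.
    by apply: measurableT_comp => //; exact/measurable_EFinP.
  by apply: measurableT_comp => //; exact/measurable_EFinP.
apply/(@integrable12ltyP _ _ _ _ _ m1 m2 _ mF).
under eq_integral => x _ do under eq_integral => y _ do
  rewrite /= normrM EFinM.
rewrite (eq_integral (fun x => `|(f x)%:E| * \int[m2]_y `|(g y)%:E|)).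
  move/integrableP : intf => [_ /= Lf]; move/integrableP : intg => [_ /= Lg].
  rewrite ge0_integralZr//; last 2 first.
  - by apply/measurable_EFinP; apply: measurableT_comp => //; exact/measurable_EFinP.
  - exact: integral_ge0.
  by rewrite lte_mul_pinfty// ?integral_ge0// ge0_fin_numE// integral_ge0.
move=> x _; rewrite ge0_integralZl//.
by apply/measurable_EFinP; apply: measurableT_comp => //; exact/measurable_EFinP.
Qed.

Lemma integral_prod_pair :
  \int[m1 \x m2]_p (f p.1 * g p.2)%R%:E =
  (\int[m1]_x (f x)%:E) * (\int[m2]_y (g y)%:E).
Proof.
rewrite -(integral12_prod_meas1 integrable_prod_pair) /fubini_F/=.
under eq_integral => x _.
  under eq_integral => y _ do rewrite EFinM.
  rewrite (integralZl measurableT intg).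
  over.
have := integral_fune_fin_num measurableT intg.
set c := (\int[m2]_y _); move=> cfin.
have -> : c = (fine c)%:E by rewrite fineK.
by rewrite (integralZr measurableT intf).
Qed.

End Pair.

(** The integrands are signed, so integrability is carried along in the induction for the sake of
    Fubini. *)
Lemma integrable_prod_tuple m (g : 'I_m -> R -> R) :
  (forall j, (@lebesgue_measure R).-integrable setT (EFin \o g j)) ->
  (lebesgue_tuple R m).-integrable setT (fun t => (\prod_(j < m) g j (tnth t j))%R%:E) /\
  \int[lebesgue_tuple R m]_t (\prod_(j < m) g j (tnth t j))%R%:E =
  (\prod_(j < m) fine (\int[@lebesgue_measure R]_x (g j x)%:E))%R%:E.
Proof.
elim: m g => [|m IH] g ig.
  split.
    apply/integrableP; split.
      by apply/measurable_EFinP; under eq_fun do rewrite big_ord0; exact: measurable_cst.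
    under eq_integral do rewrite big_ord0.
    by rewrite integral_lebesgue_tuple0 ?abse1 ?ltry.
  under eq_integral do rewrite big_ord0.
  by rewrite integral_lebesgue_tuple0 ?big_ord0.
have [iG EG] := IH (fun j => g (lift ord0 j)) (fun j => ig (lift ord0 j)).
set G := (fun t : m.-tuple R => \prod_(j < m) g (lift ord0 j) (tnth t j))%R in iG EG.
have FE : (fun t : m.+1.-tuple R => (\prod_(j < m.+1) g j (tnth t j))%R%:E) \o @tcons R m
    = (fun p => (g ord0 p.1 * G p.2)%R%:E).
  apply/funext => -[x t] /=; rewrite big_ord_recl; congr (_ * _)%R%:E.
  by apply: eq_bigr => j _; rewrite tnthS.
have mF : measurable_fun setT (fun t : m.+1.-tuple R => (\prod_(j < m.+1) g j (tnth t j))%R%:E).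
  apply/measurable_EFinP; apply: measurable_prod => j _.
  apply: measurableT_comp; last exact: measurable_tnth.
  by have /measurable_EFinP := measurable_int _ (ig j).
have iF := integrable_prod_pair (ig ord0) iG.
split.
  apply/integrableP; split => //.
  have Fa : (fun t : m.+1.-tuple R => `|(\prod_(j < m.+1) g j (tnth t j))%R%:E|) \o @tcons R m
      = (fun p => `|(g ord0 p.1 * G p.2)%R%:E|).
    by apply/funext => p; rewrite -(congr1 (fun h => h p) FE).
  rewrite [ltLHS]ge0_integral_tcons//; last exact: measurableT_comp.
  by under eq_integral => p _ do rewrite -[`|_|]/(((fun t => `|(\prod_(j < m.+1) g j (tnth t j))%R%:E|) \o @tcons R m) p) Fa; move/integrableP : iF => [].
pose mu : {measure set (measurableTypeR R * m.-tuple R) -> \bar R} :=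
  (@lebesgue_measure R \x lebesgue_tuple R m).
have mt : measurable_fun [set: measurableTypeR R * m.-tuple R] (@tcons R m).
  exact: measurable_tcons.
have := @integral_pushforward _ _ _ _ _ _ mt mu setT _ mF.
rewrite preimage_setT FE => /(_ iF measurableT) => ->.
rewrite (integral_prod_pair (ig ord0) iG) EG.
rewrite big_ord_recl EFinM fineK//.
exact: (integral_fune_fin_num measurableT (ig ord0)).
Qed.

End ProductIntegral.

(** * Integrals of powers of the logarithm *)

Section LogIntegral.
Context {R : realType}.
Notation mu := (@lebesgue_measure R).

(** Up to a constant factor, the derivative of [(- ln x)^(k+1)]; the base is [- ln x] because [vand]
    is a Vandermonde determinant in the opposites of its entries ([vand_det]). *)
Let logpow (k : nat) (x : R) : R := (- ln x) ^+ k / x.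

Let is_derive_logpow k (x : R) : 0 < x ->
  is_derive x 1 (fun y => - ((- ln y) ^+ k.+1 / k.+1%:R) : R) (logpow k x).
Proof.
move=> x0; have dl := is_derive1_ln x0.
have k0 : k.+1%:R != 0 :> R by rewrite pnatr_eq0.
have -> : (fun y => - ((- ln y) ^+ k.+1 / k.+1%:R) : R) =
    - (k.+1%:R^-1 *: ((- (@ln R)) ^+ k.+1)).
  apply/funext => y /=.
  by rewrite [in RHS]/GRing.opp/= [in RHS]/GRing.scale/= fctE mulrC.
apply: is_derive_eq.
rewrite /logpow -mulr_natl /GRing.scale/= fctE.
by move: (k.+1%:R) k0 => K k0; field; rewrite k0 gt_eqF.
Qed.

Let continuous_logpow k (x : R) : 0 < x -> {for x, continuous (logpow k)}.
Proof.
move=> x0; apply: cvgM.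
  apply: (@cvg_comp _ _ _ (fun y => - ln y) (fun z => z ^+ k) _ (nbhs (- ln x))).
    by apply: cvgN; exact: continuous_ln.
  exact: exprn_continuous.
by apply: cvgV; [rewrite gt_eqF|exact: cvg_id].
Qed.

Let within_logpow k (u v : R) : 0 < u -> {within `[u, v], continuous (logpow k)}.
Proof.
move=> u0; apply: continuous_in_subspaceT => x; rewrite inE/= in_itv/= => /andP[ux _].
by apply: continuous_logpow; exact: lt_le_trans ux.
Qed.

Let integrable_logpow_oo k (u v : R) : 0 < u ->
  mu.-integrable `]u, v[ (EFin \o logpow k).
Proof.
move=> u0.
apply: (@integrableS _ _ _ mu `[u, v]) => //; first exact: subset_itv_oo_cc.
by apply: continuous_compact_integrable; [exact: segment_compact|exact: within_logpow].
Qed.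

Lemma integrable_logpow k (u v : R) : 0 < u ->
  mu.-integrable setT (EFin \o (fun x : R => (- ln x) ^+ k / x * (u < x < v)%R%:R)).
Proof.
move=> u0.
have logpowE : EFin \o (fun x : R => (- ln x) ^+ k / x * (u < x < v)%R%:R) =
    (EFin \o logpow k) \_ `]u, v[.
  apply/funext => x; rewrite patchE mem_setE in_itv/= /logpow.
  by case: ifP => _; rewrite ?mulr1 ?mulr0.
rewrite logpowE; apply: (iffLR (integrable_mkcond (mu := mu) (EFin \o logpow k) (measurable_itv `]u, v[))).
exact: integrable_logpow_oo.
Qed.

Lemma integral_logpow k (u v : R) : 0 < u -> u < v ->
  fine (\int[mu]_x ((- ln x) ^+ k / x * (u < x < v)%R%:R)%:E) =
  ((- ln u) ^+ k.+1 - (- ln v) ^+ k.+1) / k.+1%:R.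
Proof.
move=> u0 uv.
pose F (y : R) := - ((- ln y) ^+ k.+1 / k.+1%:R) : R.
transitivity (fine (\int[mu]_(x in `[u, v]) (logpow k x)%:E)).
  rewrite integral_itv_bndoo; last first.
    exact: measurable_int (integrable_logpow_oo _ _ u0).
  rewrite [in RHS]integral_mkcond; congr fine; apply: eq_integral => x _.
  rewrite patchE mem_setE in_itv/= /logpow.
  by case: ifP => _; rewrite ?mulr1 ?mulr0.
rewrite (@continuous_FTC2 _ (logpow k) F)//.
- by rewrite /F/= opprK mulrBl addrC.
- exact: within_logpow.
- split.
  + move=> x; rewrite in_itv/= => /andP[ux _].
    by have [] := is_derive_logpow k (lt_trans u0 ux).
  + apply: cvg_at_right_filter.
    have [+ _] := is_derive_logpow k u0.
    by move=> /derivable1_diffP/differentiable_continuous.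
  + apply: cvg_at_left_filter.
    have [+ _] := is_derive_logpow k (lt_trans u0 uv).
    by move=> /derivable1_diffP/differentiable_continuous.
- move=> x; rewrite in_itv/= => /andP[ux _].
  have [_ <-] := is_derive_logpow k (lt_trans u0 ux).
  by rewrite derive1E.
Qed.

End LogIntegral.

Section DetIntegral.
Context {R : realType}.
Notation mu := (@lebesgue_measure R).
Local Open Scope ereal_scope.

(** Row [j] depends on the variable of index [j] only, so each term of the Leibniz expansion is a
    product of functions of separate variables. *)
Lemma integral_det m (g : 'I_m -> 'I_m -> R -> R) :
  (forall j k, mu.-integrable setT (EFin \o g j k)) ->
  (lebesgue_tuple R m).-integrable setT
    (fun t => (\det (\matrix_(j, k) g j k (tnth t j)))%:E) /\
  \int[lebesgue_tuple R m]_t (\det (\matrix_(j, k) g j k (tnth t j)))%:E =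
  (\det (\matrix_(j, k) fine (\int[mu]_x (g j k x)%:E)))%:E.
Proof.
move=> ig.
pose h (s : 'S_m) (t : m.-tuple R) :=
  ((-1) ^+ s * \prod_(j < m) g j (s j) (tnth t j))%R%:E.
have hE t : (\det (\matrix_(j, k) g j k (tnth t j)))%:E = \sum_(s : 'S_m) h s t.
  rewrite /h sumEFin; congr EFin; apply: eq_bigr => s _; congr (_ * _)%R.
  by apply: eq_bigr => j _; rewrite mxE.
have ip (s : 'S_m) := integrable_prod_tuple (fun j => ig j (s j)).
have ih s : (lebesgue_tuple R m).-integrable setT (h s).
  exact: (integrableZl measurableT ((-1) ^+ s) (ip s).1).
split.
  rewrite (_ : (fun _ => _) = (fun t => \sum_(s : 'S_m) h s t)); last exact/funext.
  by apply: integrable_sum.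
under eq_integral do rewrite hE.
rewrite integral_sum// -sumEFin; apply: eq_bigr => s _.
rewrite /h; under eq_integral do rewrite EFinM.
rewrite integralZl//; last exact: (ip s).1.
rewrite (ip s).2 -EFinM; congr (_ * _)%R%:E.
by apply: eq_bigr => j _; rewrite mxE.
Qed.

End DetIntegral.

(** * Logarithmic Vandermonde products over interlacing points *)

Section LogVandermonde.
Context {R : realType}.
Notation mu := (@lebesgue_measure R).

(** [vand] subtracts the entry of larger index, the Vandermonde formula the entry of smaller index;
    negating the entries reconciles the two without a sign. *)
Lemma vand_det m (z : m.-tuple R) :
  vand z = \det (\matrix_(j < m, i < m) (- tnth z j) ^+ i).
Proof.
rewrite -det_tr (_ : _^T = Vandermonde m (\row_j - tnth z j)); last first.
  by apply/matrixP => i j; rewrite !mxE.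
rewrite det_Vandermonde; apply: eq_bigr => i _; apply: eq_bigr => j _.
by rewrite !mxE opprK addrC.
Qed.

(** Subtracting from each row of the Vandermonde matrix the row above it keeps the determinant and
    reduces the first column to its top entry 1; then expand along that column. *)
Lemma det_power_differences n (z : 'I_n.+1 -> R) :
  \det (\matrix_(j < n, i < n)
    (z (lift ord0 j) ^+ i.+1 - z (widen_ord (leqnSn n) j) ^+ i.+1)) =
  \det (\matrix_(j < n.+1, i < n.+1) z j ^+ i).
Proof.
set V := (X in _ = \det X).
pose D : 'M[R]_n.+1 := \matrix_(i, j) ((i == j)%:R - (i == j.+1 :> nat)%:R).
have detD : \det D = 1.
  rewrite det_trig; last first.
    apply/is_trig_mxP => i j ij; rewrite !mxE -val_eqE/= !ltn_eqF ?subrr//.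
    exact: ltnW.
  by rewrite big1// => i _; rewrite !mxE eqxx ltn_eqF ?subr0.
rewrite -[RHS]mul1r -detD -det_mulmx (expand_det_col _ ord0) (bigD1 ord0)//=.
have DV (i k : 'I_n.+1) : (D *m V) i k = z i ^+ k -
    (if unlift ord0 i is Some j then z (widen_ord (leqnSn n) j) ^+ k else 0).
  rewrite !mxE; under eq_bigr do rewrite !mxE mulrBl.
  rewrite sumrB; congr (_ - _).
    rewrite (bigD1 i)//= eqxx mul1r big1 ?addr0// => j ji.
    by rewrite eq_sym (negbTE ji) mul0r.
  case: unliftP => [j ->|->]; last first.
    by rewrite big1// => j _; rewrite mul0r.
  rewrite (bigD1 (widen_ord (leqnSn n) j))//= eqxx mul1r big1 ?addr0// => j' jj.
  rewrite /bump leq0n add1n eqSS eq_sym (_ : _ == _ = false) ?mul0r//.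
  by apply: contraNF jj => /eqP jE; apply/eqP/val_inj.
have DV0 (k : 'I_n.+1) : (D *m V) ord0 k = z ord0 ^+ k by rewrite DV unlift_none subr0.
have DVS j (k : 'I_n.+1) : (D *m V) (lift ord0 j) k =
    z (lift ord0 j) ^+ k - z (widen_ord (leqnSn n) j) ^+ k by rewrite DV liftK.
rewrite DV0 expr0 mul1r big1 ?addr0; last first.
  by move=> i; case: (unliftP ord0 i) => [j ->|->//] _; rewrite DVS !expr0 subrr mul0r.
rewrite /cofactor expr0 mul1r; congr (\det _); apply/matrixP => j k.
transitivity ((D *m V) (lift ord0 j) (lift ord0 k)); first by rewrite DVS mxE.
by rewrite [RHS]mxE [RHS]mxE.
Qed.

Lemma det_scale_rows m (c : 'I_m -> R) (A : 'M[R]_m) :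
  \det (\matrix_(j, k) (c j * A j k)) = (\prod_(j < m) c j) * \det A.
Proof.
rewrite (_ : \matrix_(j, k) _ = diag_mx (\row_j c j) *m A).
  by rewrite det_mulmx det_diag; congr (_ * _); apply: eq_bigr => j _; rewrite mxE.
by apply/matrixP => j k; rewrite mul_diag_mx !mxE.
Qed.

Definition ln_tuple m (l : m.-tuple R) : m.-tuple R := [tuple ln (tnth l i) | i < m].

(** For fixed [l] the interlacing region is a product of intervals, so the determinant is integrated
    entry by entry. The rows become differences of powers of consecutive [- ln l_j], and the factors
    [1/(k+1)] of the primitives multiply to [1/n!]. *)
Lemma integral_inter_vand_ln n (l : n.+1.-tuple R) : sdec l -> posb l ->
  (\int[lebesgue_tuple R n]_a
     ((inter a l)%:R * vand (ln_tuple a) / \prod_(i < n) tnth a i)%:E =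
   (vand (ln_tuple l) / n`!%:R)%:E)%E.
Proof.
move=> sl pl.
pose lo (j : 'I_n) := tnth l (lift ord0 j).
pose up (j : 'I_n) := tnth l (widen_ord (leqnSn n) j).
have lo0 j : 0 < lo j by exact: (forallP pl).
have lou j : lo j < up j by exact: (sdecP _ sl).
pose g (j k : 'I_n) (x : R) : R := (- ln x) ^+ k / x * (lo j < x < up j)%R%:R.
have [_ Eg] := @integral_det R n g (fun j k => integrable_logpow k (up j) (lo0 j)).
transitivity (\int[lebesgue_tuple R n]_t (\det (\matrix_(j, k) g j k (tnth t j)))%:E)%E.
  apply: eq_integral => a _; congr (_%:E).
  rewrite (_ : \matrix_(j, k) _ = \matrix_(j, k) (((lo j < tnth a j < up j)%R%:R / tnth a j) *
    (\matrix_(j < n, i < n) (- tnth (ln_tuple a) j) ^+ i) j k)); last first.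
    apply/matrixP => j k; rewrite !mxE tnth_mktuple /g.
    by rewrite -mulrA mulrC; congr (_ * _); rewrite mulrC.
  rewrite det_scale_rows -vand_det big_split/= -prodfV mulrAC; congr (_ * _ * _).
  rewrite /inter (forallP pl) andbT.
  case: (boolP [forall i, _]) => [/forallP h|/forallPn[i /negbTE h]].
    by rewrite big1// => i _; rewrite [X in (nat_of_bool X)%:R]h.
  by rewrite (bigD1 i)//= [X in (nat_of_bool X)%:R]h mul0r.
rewrite Eg; congr (_%:E).
rewrite -det_tr (_ : _^T = \matrix_(k, j) ((k.+1%:R)^-1 * (\matrix_(j < n, i < n)
    ((- tnth (ln_tuple l) (lift ord0 j)) ^+ i.+1 -
     (- tnth (ln_tuple l) (widen_ord (leqnSn n) j)) ^+ i.+1))^T k j)); last first.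
  by apply/matrixP => k j; rewrite !mxE integral_logpow// !tnth_mktuple mulrC.
rewrite det_scale_rows det_tr (det_power_differences (fun j => - tnth (ln_tuple l) j)).
rewrite -vand_det mulrC; congr (_ * _).
by rewrite prodfV fact_prod big_add1/= big_mkord natr_prod.
Qed.

End LogVandermonde.

(** * The recursion on the densities *)

Section DensityStep.
Context {R : realType}.

Definition vconst n : R := (\prod_(1 <= j < n) (j`!)%:R)^-1.

Lemma vconst_gt0 n : 0 < vconst n.
Proof. by rewrite invr_gt0 prodr_gt0// => j _; rewrite ltr0n fact_gt0. Qed.

Lemma vconstS n : vconst n.+1 = vconst n / n`!%:R.
Proof.
rewrite /vconst; case: n => [|n]; first by rewrite !big_geq// fact0 invr1 mulr1.
by rewrite big_nat_recr//= invfM mulrC.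
Qed.

Lemma eigenvalue_densityE n (x : n.-tuple R) : eigenvalue_density x =
  (sdec x && posb x)%:R * (vconst n * expR (- \sum_(j < n) tnth x j) *
    (vand x * vand (ln_tuple x))).
Proof.
rewrite /eigenvalue_density mulrC; congr (_ * (_ * _)).
  rewrite indicE; congr (nat_of_bool _)%:R; apply/idP/idP.
    by rewrite inE => -[/= h1 h2]; apply/andP; split; [exact/sdecP|exact/forallP].
  by move=> /andP[/sdecP h1 /forallP h2]; rewrite inE.
rewrite /vand -big_split; apply: eq_bigr => i _ /=.
by rewrite -big_split; apply: eq_bigr => j _ /=; rewrite !tnth_mktuple.
Qed.

Lemma sdec_ln_tuple n (x : n.-tuple R) : sdec x -> posb x -> sdec (ln_tuple x).
Proof.
move=> /sdecP sx /forallP px; apply/sdecP => i j ij; rewrite !tnth_mktuple.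
by rewrite ltr_ln ?posrE// sx.
Qed.

Lemma eigenvalue_density_ge0 n (x : n.-tuple R) : 0 <= eigenvalue_density x.
Proof.
rewrite eigenvalue_densityE.
have [/andP[sx px]|] := boolP (_ && _); last by rewrite mul0r.
rewrite mul1r mulr_ge0// ?mulr_ge0 ?expR_ge0 ?(ltW (vconst_gt0 _))//.
  exact/ltW/vand_gt0.
exact/ltW/vand_gt0/sdec_ln_tuple.
Qed.

Lemma inter_sdec_left n (a : n.-tuple R) (l : n.+1.-tuple R) :
  inter a l -> sdec l -> sdec a /\ posb a.
Proof.
move=> /interP[h1 h2] /sdecP sl.
have nonincr_l i j : (i <= j <= n)%N -> nth 0 l j <= nth 0 l i.
  move=> /andP[ij jn]; have jn' : (j < n.+1)%N by [].
  have in' : (i < n.+1)%N by exact: leq_ltn_trans jn'.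
  move: ij; rewrite leq_eqVlt => /predU1P[->//|ij].
  have := sl (Ordinal in') (Ordinal jn') ij.
  by rewrite !(tnth_nth 0) => /ltW.
split.
  apply/sdecP => i j ij; rewrite !(tnth_nth 0).
  rewrite (lt_trans (h2 j _))// 1?ltnW// (le_lt_trans (nonincr_l i.+1 j _))//.
    by rewrite ij ltnW.
  exact: h1.
apply/forallP => i; rewrite (tnth_nth 0).
have := h2 n (leqnn n); rewrite [X in X < _]nth_default ?size_tuple// => l0.
apply: lt_trans (h1 i (ltn_ord i)); apply: lt_le_trans l0 _.
by apply: nonincr_l; rewrite ltn_ord leqnn.
Qed.

Lemma inter_posb n (a : n.-tuple R) (l : n.+1.-tuple R) :
  inter a l -> sdec l -> posb l.
Proof.
move=> /andP[_ l0] /sdecP sl; apply/forallP => i.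
have [-> //|im] := eqVneq i ord_max.
apply: lt_trans l0 _; apply: sl; rewrite ltn_neqAle -ltnS ltn_ord andbT.
exact: im.
Qed.

(** [powR] is measurable on the whole line, and the chosen expression agrees with the inverse at 0
    too, where both are 0. *)
Lemma measurable_invr : measurable_fun setT (fun x : R => x^-1).
Proof.
rewrite (_ : (fun _ => _) = (fun x : R => x * (x ^+ 2) `^ (-1))).
  apply: measurable_funM => //; apply: (measurableT_comp (@measurable_powR R (-1))).
  exact: (@measurable_funX _ _ _ _ id).
apply/funext => x; rewrite powR_inv1 ?sqr_ge0//.
by have [->|x0] := eqVneq x 0; [rewrite invr0 mul0r|field].
Qed.

Section Meas.
Context d (T : measurableType d).

Lemma measurable_ln_tuple n (f : T -> n.-tuple R) :
  measurable_fun setT f -> measurable_fun setT (fun x => ln_tuple (f x)).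
Proof.
move=> mf; apply: measurable_mktuple => i.
by apply: measurableT_comp (@measurable_ln R) _; exact: measurable_tnth_comp.
Qed.

Lemma measurable_inter n (f : T -> n.-tuple R) (g : T -> n.+1.-tuple R) :
  measurable_fun setT f -> measurable_fun setT g ->
  measurable_fun setT (fun x => inter (f x) (g x)).
Proof.
move=> mf mg; apply: measurable_and; last first.
  by apply: measurable_fun_ltr => //; exact: measurable_tnth_comp.
apply: measurable_forall => i; apply: measurable_and;
  by apply: measurable_fun_ltr; exact: measurable_tnth_comp.
Qed.

Lemma measurable_sum_tuple n (f : T -> n.-tuple R) :
  measurable_fun setT f -> measurable_fun setT (fun x => \sum_(i < n) tnth (f x) i).
Proof. by move=> mf; apply: measurable_sum => i; exact: measurable_tnth_comp. Qed.

Lemma measurable_prod_tuple n (f : T -> n.-tuple R) :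
  measurable_fun setT f -> measurable_fun setT (fun x => \prod_(i < n) tnth (f x) i).
Proof. by move=> mf; apply: measurable_prod => i _; exact: measurable_tnth_comp. Qed.

Lemma measurable_eigenvalue_density n (f : T -> n.-tuple R) :
  measurable_fun setT f -> measurable_fun setT (fun x => eigenvalue_density (f x)).
Proof.
move=> mf; under eq_fun do rewrite eigenvalue_densityE.
apply: measurable_funM.
  apply: measurable_natr_bool; apply: measurable_and.
    exact: measurable_sdec.
  exact: measurable_posb.
apply: measurable_funM; last first.
  by apply: measurable_funM; apply: measurable_vand => //; exact: measurable_ln_tuple.
apply: measurable_funM => //; apply: measurableT_comp => //.
by apply: measurableT_comp => //; exact: measurable_sum_tuple.
Qed.

Lemma measurable_interlacing_kernel n (f : T -> n.-tuple R) (g : T -> n.+1.-tuple R) :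
  measurable_fun setT f -> measurable_fun setT g ->
  measurable_fun setT (fun x => interlacing_kernel (f x) (g x)).
Proof.
move=> mf mg; apply: measurable_funM.
  apply: measurable_funM.
    by apply: measurable_natr_bool; exact: measurable_inter.
  apply: measurable_funM.
    apply: measurable_funM; last exact: measurable_vand.
    by apply: measurable_natr_bool; exact: measurable_sdec.
  apply: measurableT_comp => //.
  by apply: measurable_funB; exact: measurable_sum_tuple.
apply: (measurableT_comp measurable_invr).
by apply: measurable_funM; [exact: measurable_prod_tuple|exact: measurable_vand].
Qed.

End Meas.

Lemma interlacing_kernel_ge0 n (a : n.-tuple R) (l : n.+1.-tuple R) :
  sdec a -> posb a -> 0 <= interlacing_kernel a l.
Proof.
move=> sa pa; rewrite /interlacing_kernel.
have [sl|] := boolP (sdec l); last by rewrite !mul0r mulr0 mul0r.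
rewrite mulr_ge0//; last first.
  rewrite invr_ge0 mulr_ge0 ?(ltW (vand_gt0 _))// prodr_ge0// => i _.
  exact/ltW/(forallP pa).
by rewrite mulr_ge0// mulr_ge0 ?expR_ge0// mul1r ltW// vand_gt0.
Qed.

Lemma density_kernel_ge0 n (a : n.-tuple R) (l : n.+1.-tuple R) :
  0 <= eigenvalue_density a * interlacing_kernel a l.
Proof.
have [/andP[sa pa]|h] := boolP (sdec a && posb a).
  by rewrite mulr_ge0 ?eigenvalue_density_ge0 ?interlacing_kernel_ge0.
by rewrite eigenvalue_densityE (negbTE h) !mul0r.
Qed.

(** The exponential and [vand a] cancel between density and kernel, so that only [vand (ln_tuple a)]
    over the product of the [a_i] is left to integrate. A tuple [l] that is not positive and
    decreasing gives 0 on both sides. *)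
Lemma integral_density_kernel n (l : n.+1.-tuple R) :
  (\int[lebesgue_tuple R n]_a
     (eigenvalue_density a * interlacing_kernel a l)%:E =
   (eigenvalue_density l)%:E)%E.
Proof.
have [/andP[sl pl]|h] := boolP (sdec l && posb l); last first.
  rewrite eigenvalue_densityE (negbTE h) mul0r.
  apply: integral0_eq => a _; rewrite /interlacing_kernel.
  have [sl|] := boolP (sdec l); last by rewrite !mul0r mulr0 mul0r mulr0.
  have [il|] := boolP (inter a l); last by rewrite !mul0r mulr0.
  by rewrite sl (inter_posb il sl) in h.
pose C := vconst n * vand l * expR (- \sum_(j < n.+1) tnth l j).
have C0 : 0 <= C.
  by rewrite mulr_ge0 ?expR_ge0// mulr_ge0 ?(ltW (vconst_gt0 _))// ltW// vand_gt0.
transitivity (\int[lebesgue_tuple R n]_a (C%:E * ((inter a l)%:R * vand (ln_tuple a) /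
    \prod_(i < n) tnth a i)%:E))%E.
  apply: eq_integral => a _; rewrite -EFinM; congr (_%:E).
  rewrite /interlacing_kernel eigenvalue_densityE sl.
  have [il|] := boolP (inter a l); last by rewrite !(mul0r, mulr0).
  have [sa pa] := inter_sdec_left il sl; rewrite sa pa !mul1r expRD /C.
  have v0 : vand a != 0 by rewrite gt_eqF// vand_gt0.
  have p0 : \prod_(i < n) tnth a i != 0.
    by apply/prodf_neq0 => i _; rewrite gt_eqF//; exact: (forallP pa).
  have e1 : expR (- \sum_(j < n) tnth a j) * expR (\sum_(j < n) tnth a j) = 1 :> R.
    by rewrite -expRD addNr expR0.
  by rewrite -[RHS]mulr1 -[X in _ = _ * X]e1; field; rewrite v0 p0.
rewrite ge0_integralZl//; last 2 first.
- apply/measurable_EFinP; apply: measurable_funM.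
    apply: measurable_funM.
      by apply: measurable_natr_bool; apply: measurable_inter => //; exact: measurable_cst.
    by apply: measurable_vand; exact: (@measurable_ln_tuple _ _ _ id).
  apply: (measurableT_comp measurable_invr).
  exact: (@measurable_prod_tuple _ _ _ id).
- move=> a _; rewrite lee_fin.
  have [il|] := boolP (inter a l); last by rewrite !mul0r.
  have [sa pa] := inter_sdec_left il sl.
  rewrite mul1r divr_ge0//; first exact/ltW/vand_gt0/sdec_ln_tuple.
  by rewrite prodr_ge0// => i _; exact/ltW/(forallP pa).
rewrite integral_inter_vand_ln// -EFinM; congr (_%:E).
by rewrite eigenvalue_densityE sl pl mul1r vconstS /C; move: (n`!%:R)^-1 => N; ring.
Qed.

End DensityStep.

(** * Triangular Gaussian matrices *)

Section ComplexMeasurability.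
Local Open Scope sesquilinear_scope.
Context {R : realType} d (T : measurableType d).
Local Notation C := R[i].
Implicit Types f g : T -> C.

Definition cmeasurable f := measurable_fun setT (fun w => complex.Re (f w)) /\
  measurable_fun setT (fun w => complex.Im (f w)).

Lemma cmeasurable_cst (z : C) : cmeasurable (fun=> z).
Proof. by split; exact: measurable_cst. Qed.

Lemma cmeasurableD f g : cmeasurable f -> cmeasurable g ->
  cmeasurable (fun w => f w + g w).
Proof.
move=> [f1 f2] [g1 g2]; split.
  by under eq_fun do rewrite raddfD; exact: measurable_funD.
by under eq_fun do rewrite raddfD; exact: measurable_funD.
Qed.

Lemma cmeasurableM f g : cmeasurable f -> cmeasurable g ->
  cmeasurable (fun w => f w * g w).
Proof.
move=> [f1 f2] [g1 g2]; split.
  rewrite (_ : (fun _ => _) = (fun w => complex.Re (f w) * complex.Re (g w) -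
      complex.Im (f w) * complex.Im (g w))).
    by apply: measurable_funB; exact: measurable_funM.
  by apply/funext => w; case: (f w) => ? ?; case: (g w).
rewrite (_ : (fun _ => _) = (fun w => complex.Re (f w) * complex.Im (g w) +
    complex.Im (f w) * complex.Re (g w))).
  by apply: measurable_funD; exact: measurable_funM.
by apply/funext => w; case: (f w) => ? ?; case: (g w).
Qed.

Lemma cmeasurable_conj f : cmeasurable f -> cmeasurable (fun w => (f w)^*).
Proof.
move=> [f1 f2]; split.
  rewrite (_ : (fun _ => _) = (fun w => complex.Re (f w)))//.
  by apply/funext => w; case: (f w).
rewrite (_ : (fun _ => _) = (fun w => - complex.Im (f w))).
  exact: measurableT_comp.
by apply/funext => w; case: (f w).
Qed.

Lemma cmeasurable_sum I (r : seq I) (P : pred I) (F : I -> T -> C) :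
  (forall i, P i -> cmeasurable (F i)) -> cmeasurable (fun w => \sum_(i <- r | P i) F i w).
Proof.
move=> mF; elim: r => [|i r IH].
  by under eq_fun do rewrite big_nil; exact: cmeasurable_cst.
have [Pi|/negbTE Pi] := boolP (P i); last by under eq_fun do rewrite big_cons Pi.
by under eq_fun do rewrite big_cons Pi; apply: cmeasurableD => //; exact: mF.
Qed.

Definition pmeasurable (p : T -> {poly C}) := forall k, cmeasurable (fun w => (p w)`_k).

Lemma pmeasurableM p q : pmeasurable p -> pmeasurable q ->
  pmeasurable (fun w => p w * q w).
Proof.
move=> mp mq k; under eq_fun do rewrite coefM.
by apply: cmeasurable_sum => i _; exact: cmeasurableM.
Qed.

Lemma pmeasurable_char_poly n (A : T -> 'M[C]_n) :
  (forall i j, cmeasurable (fun w => A w i j)) ->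
  pmeasurable (fun w => char_poly (A w)).
Proof.
move=> mA k; rewrite /char_poly /determinant.
under eq_fun do rewrite coef_sum.
apply: cmeasurable_sum => s _; move: k.
apply: (@pmeasurableM (fun=> (-1) ^+ s)) => [k|]; first exact: cmeasurable_cst.
elim: (index_enum _) => [|i r IH] k.
  by under eq_fun do rewrite big_nil; exact: cmeasurable_cst.
under eq_fun do rewrite big_cons.
apply: (pmeasurableM _ IH) => {}k.
under eq_fun do rewrite !mxE coefB coefMn coefC -mulN1r.
apply: cmeasurableD; first exact: cmeasurable_cst.
apply: cmeasurableM; first exact: cmeasurable_cst.
by case: (k == 0%N); [exact: mA|exact: cmeasurable_cst].
Qed.

Lemma cmeasurable_gram m n (A : T -> 'M[C]_(m, n)) :
  (forall i j, cmeasurable (fun w => A w i j)) ->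
  forall i j, cmeasurable (fun w => (A w *m (A w)^t*) i j).
Proof.
move=> mA i j; under eq_fun do rewrite mxE.
apply: cmeasurable_sum => k _; apply: cmeasurableM => //.
by under eq_fun do rewrite !mxE; exact: cmeasurable_conj.
Qed.

Lemma measurable_ordered_eigenvalues n (A : T -> 'M[C]_n) (x : T -> n.-tuple R) :
  (forall i j, cmeasurable (fun w => A w i j)) ->
  (forall w, ordered_eigenvalues (A w) (x w)) -> measurable_fun setT x.
Proof.
move=> mA xP; apply: (@measurable_ordered_roots _ _ _ _ (fun w => rootp (x w))) => //.
  move=> k; rewrite (_ : (fun _ => _) = (fun w => complex.Re (char_poly (A w))`_k)).
    by have [] := pmeasurable_char_poly mA k.
  apply/funext => w; have [_ ->] := (ordered_eigenvaluesP _ _).1 (xP w).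
  by rewrite coef_map.
by move=> w; have [] := (ordered_eigenvaluesP _ _).1 (xP w).
Qed.

Lemma ordered_eigenvalues_inj n (A : 'M[C]_n) (x y : n.-tuple R) :
  ordered_eigenvalues A x -> ordered_eigenvalues A y -> x = y.
Proof.
move=> /ordered_eigenvaluesP[nx xE] /ordered_eigenvaluesP[ny yE].
apply: rootp_inj => //; apply: (@map_inj_poly _ _ (real_complex R)).
- exact: complexI.
- by rewrite rmorph0.
- by rewrite -xE -yE.
Qed.

End ComplexMeasurability.

(** * Joint laws of independent variables *)

Section Independence.
Context {R : realType} d (T : measurableType d) (P : probability T R).
Context dE (E : measurableType dE) dS (S : measurableType dS).
Variables (Y : T -> E) (V : T -> S).
Hypotheses (mY : measurable_fun setT Y) (mV : measurable_fun setT V).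

Let Yf : {mfun T >-> E} := mfun_Sub (mem_set mY).
Let Vf : {mfun T >-> S} := mfun_Sub (mem_set mV).
Let YV w : E * S := (Y w, V w).
Let mYV : measurable_fun setT YV. Proof. exact: measurable_fun_pair. Qed.
Let YVf : {mfun T >-> (E * S)%type} := mfun_Sub (mem_set mYV).

(** Independence on rectangles identifies the joint law with the product of the marginals, after
    which Tonelli applies. Measurability of the inner integral is recorded for later
    almost-everywhere comparisons. *)
Lemma integral_independent (F : E * S -> \bar R) :
  (forall A B, measurable A -> measurable B ->
    P (Y @^-1` A `&` V @^-1` B) = (P (Y @^-1` A) * P (V @^-1` B))%E) ->
  measurable_fun setT F -> (forall p, 0 <= F p)%E ->
  (\int[P]_w F (Y w, V w) = \int[P]_w \int[P]_w' F (Y w, V w'))%E /\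
  measurable_fun setT (fun w => \int[P]_w' F (Y w, V w'))%E.
Proof.
move=> indep mF F0.
have prodE := @product_measure_unique _ _ _ _ R (distribution P Yf) (distribution P Vf)
  (distribution P YVf) indep.
have inner y : (\int[P]_w' F (y, V w') = \int[distribution P Vf]_s F (y, s))%E.
  rewrite ge0_integral_distribution//.
  exact: measurableT_comp mF (measurable_pair1 _).
have mF1 : measurable_fun setT (fun y => \int[distribution P Vf]_s F (y, s))%E.
  exact: (@measurable_fun_fubini_tonelli_F _ _ _ _ _ (distribution P Vf) F mF F0).
split; last first.
  under eq_fun do rewrite inner.
  exact: measurableT_comp mF1 mY.
transitivity (\int[distribution P YVf]_p F p)%E.
  by rewrite ge0_integral_distribution.
transitivity (\int[distribution P Yf \x distribution P Vf]_p F p)%E.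
  by apply: eq_measure_integral => A mA _; rewrite [RHS]prodE.
rewrite fubini_tonelli1// ge0_integral_distribution//; last first.
  by move=> y; exact: integral_ge0.
by apply: eq_integral => w _; rewrite inner.
Qed.

End Independence.

Section BoxLaw.
Context {R : realType}.

Lemma weighted_box_unique d1 d2 dS (X1 : measurableType d1) (X2 : measurableType d2)
    (S : measurableType dS) n
    (mu1 : {measure set X1 -> \bar R}) (mu2 : {measure set X2 -> \bar R})
    (phi1 : X1 -> n.-tuple S) (phi2 : X2 -> n.-tuple S) (w1 : X1 -> R) (w2 : X2 -> R) :
  measurable_fun setT phi1 -> measurable_fun setT phi2 ->
  measurable_fun setT w1 -> measurable_fun setT w2 ->
  (forall x, 0 <= w1 x) -> (forall x, 0 <= w2 x) ->
  (\int[mu1]_x (w1 x)%:E < +oo)%E ->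
  (forall A : 'I_n -> set S, (forall i, measurable (A i)) ->
    \int[mu1]_(x in phi1 @^-1` (box A)) (w1 x)%:E =
    \int[mu2]_(x in phi2 @^-1` (box A)) (w2 x)%:E)%E ->
  forall B, measurable B ->
    (\int[mu1]_(x in phi1 @^-1` B) (w1 x)%:E =
     \int[mu2]_(x in phi2 @^-1` B) (w2 x)%:E)%E.
Proof.
move=> mp1 mp2 mw1 mw2 w10 w20 fin boxE B mB.
apply: (@tuple_measure_unique _ S n R (wpush mu1 mp1 mw1 w10) (wpush mu2 mp2 mw2 w20)
  (fun=> setT)) => //.
- by apply/seteqP; split => // x _; exists 0%N.
- move=> _; suff H : (\int[mu1]_(x in phi1 @^-1` (box (fun=> setT))) (w1 x)%:E < +oo)%E by [].
  apply: le_lt_trans fin; apply: ge0_subset_integral => //.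
  + rewrite -[X in measurable X]setTI; apply: mp1 => //.
    exact: measurable_box.
  + exact/measurable_EFinP.
  + by move=> x _; rewrite lee_fin.
Qed.

Context d (T : measurableType d) (P : probability T R).

Let preim_meas d' (S : measurableType d') (f : T -> S) A :
  measurable_fun setT f -> measurable A -> measurable (f @^-1` A).
Proof. by move=> mf mA; rewrite -[X in measurable X]setTI; exact: mf. Qed.

(** For fixed [D] both sides are finite measures in [A], so boxes suffice. Applied to each of two
    vectors in turn, this extends independence from boxes to all measurable sets. *)
Let independent_half dS (S : measurableType dS) n (Y : T -> n.-tuple S) (D : set T) :
  measurable_fun setT Y -> measurable D ->
  (forall A : 'I_n -> set S, (forall i, measurable (A i)) ->
    P (Y @^-1` (box A) `&` D) = (P (Y @^-1` (box A)) * P D)%E) ->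
  forall A, measurable A -> P (Y @^-1` A `&` D) = (P (Y @^-1` A) * P D)%E.
Proof.
move=> mY mD boxE A mA.
pose c := fine (P D).
have cE : P D = c%:E by rewrite fineK// fin_num_measure.
have c0 : 0 <= c by rewrite fine_ge0.
have L B : measurable B -> (\int[P]_(x in Y @^-1` B) (\1_D x)%:E)%E = P (Y @^-1` B `&` D).
  by move=> mB; rewrite integral_indic//; [rewrite setIC|exact: preim_meas].
have Rr B : measurable B -> (\int[P]_(x in Y @^-1` B) (cst c x)%:E)%E = (P (Y @^-1` B) * P D)%E.
  by move=> mB; rewrite [LHS](@integral_cst _ _ _ P _ (preim_meas mY mB) c%:E) cE muleC.
rewrite -L// -Rr//.
apply: (@weighted_box_unique _ _ _ T T S n P P Y Y) => //.
- by rewrite integral_indic// setIT (le_lt_trans (probability_le1 _ _))// ltry.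
- by move=> B mB; have mb := measurable_box mB; rewrite L ?Rr ?boxE.
Qed.

Lemma independent_boxes d1 d2 (S1 : measurableType d1) (S2 : measurableType d2) m n
    (Y : T -> m.-tuple S1) (V : T -> n.-tuple S2) :
  measurable_fun setT Y -> measurable_fun setT V ->
  (forall A B, (forall i : 'I_m, measurable (A i)) -> (forall i : 'I_n, measurable (B i)) ->
    P (Y @^-1` (box A) `&` V @^-1` (box B)) =
    (P (Y @^-1` (box A)) * P (V @^-1` (box B)))%E) ->
  forall A B, measurable A -> measurable B ->
    P (Y @^-1` A `&` V @^-1` B) = (P (Y @^-1` A) * P (V @^-1` B))%E.
Proof.
move=> mY mV boxE A B mA mB.
rewrite setIC muleC; apply: (independent_half mV) => //; first exact: preim_meas.
move=> B' mB'; rewrite setIC muleC; apply: (independent_half mY) => //.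
  by apply: preim_meas => //; exact: measurable_box.
by move=> A' mA'; exact: boxE.
Qed.

Definition pairs m (t : m.*2.-tuple R) : m.-tuple (R * R) :=
  [tuple (nth 0 t i.*2, nth 0 t i.*2.+1) | i < m].

Lemma pairs_cons2 m x y (t : m.*2.-tuple R) :
  pairs (cons2 x y t) = [tuple of (x, y) :: pairs t] :> m.+1.-tuple (R * R).
Proof.
apply: eq_from_tnth => i; case: (unliftP ord0 i) => [j ->|->].
  by rewrite tnthS !tnth_mktuple.
by rewrite tnth0 tnth_mktuple.
Qed.

Lemma measurable_pairs m : measurable_fun setT (@pairs m).
Proof.
apply: measurable_mktuple => i.
by apply: measurable_fun_pair; exact: (@measurable_nth _ _ _ _ id).
Qed.

Definition gauss2 (p : R * R) : R :=
  pi^-1 * expR (- ComplexField.Normc.normc (p.1 +i* p.2)%C ^+ 2).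

Lemma gauss2E (p : R * R) : gauss2 p = pi^-1 * expR (- (p.1 ^+ 2 + p.2 ^+ 2)).
Proof.
by rewrite /gauss2 /ComplexField.Normc.normc sqr_sqrtr// addr_ge0// sqr_ge0.
Qed.

Lemma gauss2_ge0 p : 0 <= gauss2 p.
Proof. by rewrite mulr_ge0 ?expR_ge0// invr_ge0 pi_ge0. Qed.

Lemma measurable_gauss2 : measurable_fun setT gauss2.
Proof.
rewrite (_ : gauss2 = fun p => pi^-1 * expR (- (p.1 ^+ 2 + p.2 ^+ 2))); last first.
  by apply/funext => p; rewrite gauss2E.
apply: measurable_funM => //; apply: measurableT_comp => //; apply: measurableT_comp => //.
by apply: measurable_funD; exact: measurable_funX.
Qed.

Local Open Scope ereal_scope.

Lemma gaussd_box m (A : 'I_m -> set (R * R)) : (forall i, measurable (A i)) ->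
  \int[lebesgue_tuple R m.*2]_(t in @pairs m @^-1` (box A)) (gaussd t)%:E =
  \prod_(i < m) \int[@lebesgue_measure R \x @lebesgue_measure R]_(p in A i) (gauss2 p)%:E.
Proof.
move=> mA.
transitivity (\int[lebesgue_tuple R m.*2]_t ((gaussd t)%:E * (\1_(box A) (pairs t))%:E)).
  rewrite integral_mkcond; apply: eq_integral => t _.
  rewrite patchE indicE [t \in _](_ : _ = (pairs t \in box A)); last first.
    by apply/idP/idP; rewrite !inE.
  by case: ifP => _; rewrite ?mule1 ?mule0.
elim: m A mA => [|m IH] A mA.
  rewrite big_ord0 integral_lebesgue_tuple0; last first.
    have -> : (fun t : 0.-tuple R => (gaussd (t : 0.*2.-tuple R))%:E *
      (\1_(box A) (pairs (t : 0.*2.-tuple R)))%:E) = cst ((gaussd ([tuple] : 0.*2.-tuple R))%:E *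
      (\1_(box A) (pairs ([tuple] : 0.*2.-tuple R)))%:E).
      by apply/funext => t; rewrite (tuple0 t).
    exact: measurable_cst.
  rewrite /gaussd big_ord0 oppr0 expR0 expr0 invr1 mulr1 mul1e indicE mem_set//.
  by case.
have mg : measurable_fun setT (fun t : m.+1.*2.-tuple R =>
    (gaussd t)%:E * (\1_(box A) (pairs t))%:E).
  apply: emeasurable_funM; apply/measurable_EFinP; first exact: (@measurable_gaussd _ _ _ _ id).
  apply: (measurableT_comp _ (@measurable_pairs _)).
  by apply: measurable_indic; exact: measurable_box.
have g0 (t : m.+1.*2.-tuple R) : 0 <= (gaussd t)%:E * (\1_(box A) (pairs t))%:E.
  by rewrite mule_ge0 ?lee_fin ?gaussd_ge0.
pose A' i := A (lift ord0 i).
have indS x y t : \1_(box A) (pairs (cons2 x y t)) =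
    (\1_(A ord0) (x, y) * \1_(box A') (pairs t))%R :> R.
  rewrite pairs_cons2 !indicE -natrM mulnb; congr (nat_of_bool _)%:R.
  apply/idP/andP; rewrite !inE => h.
    by split; [have := h ord0; rewrite tnth0|move=> i; have := h (lift ord0 i); rewrite tnthS].
  move: h => [h1 h2] i; case: (unliftP ord0 i) => [j ->|->]; last by rewrite tnth0.
  by rewrite tnthS; exact: h2.
transitivity (\int[lebesgue_measure]_x \int[lebesgue_measure]_y \int[lebesgue_tuple R m.*2]_t
    ((gaussd (cons2 x y t))%:E * (\1_(box A) (pairs (cons2 x y t)))%:E)).
  rewrite (@integral_lebesgue_tupleS R m.*2.+1)//.
  apply: eq_integral => x _; rewrite (@integral_lebesgue_tupleS R m.*2)//.
  exact: measurableT_comp mg (measurable_tuple_cons x).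
rewrite big_ord_recl -(IH A'); last by move=> i; exact: mA.
set K := (X in _ = _ * X).
have K0 : 0 <= K by apply: integral_ge0 => t _; rewrite mule_ge0 ?lee_fin ?gaussd_ge0.
have m2 : measurable_fun setT (fun p : R * R => (gauss2 p * \1_(A ord0) p)%:E).
  apply/measurable_EFinP; apply: measurable_funM; first exact: measurable_gauss2.
  exact: measurable_indic.
have g20 p : 0 <= (gauss2 p * \1_(A ord0) p)%:E.
  by rewrite lee_fin mulr_ge0 ?gauss2_ge0.
transitivity (\int[lebesgue_measure]_x \int[lebesgue_measure]_y
    ((gauss2 (x, y) * \1_(A ord0) (x, y))%:E * K)).
  apply: eq_integral => x _; apply: eq_integral => y _.
  rewrite -ge0_integralZl//; last 2 first.
  - apply: emeasurable_funM; apply/measurable_EFinP; first exact: (@measurable_gaussd _ _ _ _ id).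
    apply: (measurableT_comp _ (@measurable_pairs _)).
    by apply: measurable_indic; apply: measurable_box => i; exact: mA.
  - by move=> t _; rewrite mule_ge0 ?lee_fin ?gaussd_ge0.
  apply: eq_integral => t _; rewrite gaussd_cons indS -!EFinM gauss2E/=; congr (_%:E).
  ring.
under eq_integral => x _.
  rewrite ge0_integralZr//; last first.
    exact: measurableT_comp m2 (measurable_pair1 _).
  over.
rewrite ge0_integralZr//; last 2 first.
- exact: (@measurable_fun_fubini_tonelli_F _ _ _ _ _ (@lebesgue_measure R) _ m2 g20).
- by move=> x _; exact: integral_ge0.
have fub := @fubini_tonelli1 _ _ _ _ _ (@lebesgue_measure R) (@lebesgue_measure R) _ m2 g20.
congr (_ * _); rewrite [RHS]integral_mkcond; apply: (etrans (esym fub)); apply: eq_integral => p _; rewrite patchE indicE.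
by case: ifP => _; rewrite ?mulr1 ?mulr0.
Qed.

End BoxLaw.

(** * Splitting off the first column *)

Section LowerGaussian.
Context {R : realType} d (T : measurableType d) (P : probability T R).
Local Notation C := R[i].

Lemma mutually_independent_comp (I I' : finType) (f : I' -> I) (D : {set I})
    (D' : {set I'}) dS (S : measurableType dS) (Y : I -> T -> S) :
  injective f -> (forall i, i \in D' -> f i \in D) ->
  mutually_independent P D Y -> mutually_independent P D' (fun i => Y (f i)).
Proof.
move=> fi fD indep J A JD mA.
(* The sets are transported along [f], with the whole space at indices outside its image. *)
pose A' k := if [pick i | f i == k] is Some i then A i else setT.
have A'f i : A' (f i) = A i.
  rewrite /A'; case: pickP => [j /eqP/fi -> //|/(_ i)]; by rewrite eqxx.
have fJD : (f @: J \subset D)%SET.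
  by apply/fintype.subsetP => _ /imsetP[i iJ ->]; apply: fD; exact: (fintype.subsetP JD).
have := indep _ A' fJD _; rewrite big_imset//=; last by move=> i j _ _; exact: fi.
rewrite (eq_bigr (fun i => P (Y (f i) @^-1` A i))); last by move=> i _; rewrite A'f.
move=> <-; last by move=> k; rewrite /A'; case: pickP.
congr (P _); apply/seteqP; split => w /= h.
  by move=> _ /imsetP[i iJ ->]; rewrite A'f; exact: h.
by move=> i iJ; rewrite -A'f; apply: h; exact: imset_f.
Qed.

Variables (n : nat) (X : T -> 'M[C]_n.+1).
Hypothesis gX : lower_triangular_gaussian P X.

Lemma lower_block_gaussian : lower_triangular_gaussian P (fun w => lower_block (X w)).
Proof.
have [tX nX iX] := gX; split.
- move=> w; apply/is_trig_mxP => i j ij; rewrite mxE.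
  by have /is_trig_mxP := tX w; apply; rewrite !lift0.
- move=> i j ji; have := nX (lift ord0 i) (lift ord0 j); rewrite !lift0 ltnS => /(_ ji).
  by rewrite (_ : (fun w => lower_block (X w) i j) = fun w => X w (lift ord0 i) (lift ord0 j));
    last by apply/funext => w; rewrite mxE.
- rewrite (_ : (fun (ij : 'I_n * 'I_n) w => reim (lower_block (X w) ij.1 ij.2)) = (fun (ij : 'I_n * 'I_n) =>
      (fun (kl : 'I_n.+1 * 'I_n.+1) w => reim (X w kl.1 kl.2))
        (lift ord0 ij.1, lift ord0 ij.2))); last first.
    by apply/funext => ij; apply/funext => w; rewrite mxE.
  apply: mutually_independent_comp iX.
    move=> [i j] [k l] /= E; congr pair; apply: (@lift_inj _ ord0).
      exact: (congr1 fst E).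
    exact: (congr1 snd E).
  by move=> ij; rewrite !inE.
Qed.

Lemma measurable_reim_entry i j : measurable_fun setT (fun w => reim (X w i j)).
Proof.
have [tX nX _] := gX; have [ji|ij] := leqP j i; first by have [] := nX i j ji.
rewrite (_ : (fun _ => _) = fun=> reim 0); first exact: measurable_cst.
by apply/funext => w; have /is_trig_mxP -> := tX w.
Qed.

Lemma cmeasurable_entry i j : cmeasurable (fun w => X w i j).
Proof.
have m := measurable_reim_entry i j; split.
  exact: (measurableT_comp (@measurable_fst _ _ _ _) m).
exact: (measurableT_comp (@measurable_snd _ _ _ _) m).
Qed.

(** All [n^2] positions are listed, including the constant zeros above the diagonal, to which the
    independence hypothesis does not refer. *)
Definition block_entries w : #|{: 'I_n * 'I_n}|.-tuple (R * R) :=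
  [tuple reim (lower_block (X w) (enum_val k).1 (enum_val k).2) | k < #|{: 'I_n * 'I_n}|].

Definition column_entries w : n.+1.-tuple (R * R) := [tuple reim (X w i ord0) | i < n.+1].

Lemma measurable_block_entries : measurable_fun setT block_entries.
Proof.
apply: measurable_mktuple => k; under eq_fun do rewrite mxE.
exact: measurable_reim_entry.
Qed.

Lemma measurable_column_entries : measurable_fun setT column_entries.
Proof. by apply: measurable_mktuple => i; exact: measurable_reim_entry. Qed.

Lemma independent_entries A B : measurable A -> measurable B ->
  P (block_entries @^-1` A `&` column_entries @^-1` B) =
  (P (block_entries @^-1` A) * P (column_entries @^-1` B))%E.
Proof.
apply: independent_boxes => //; [exact: measurable_block_entries|exact: measurable_column_entries|].
move=> {}A {}B mA mB; have [tX _ iX] := gX.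
(* [B] constrains the first column and [A] the lower right block, with indices shifted by one; the
   rest of the first row is unconstrained. *)
pose F (ij : 'I_n.+1 * 'I_n.+1) : set (R * R) :=
  if unlift ord0 ij.2 is Some j then
    if unlift ord0 ij.1 is Some i then A (enum_rank (i, j)) else setT
  else B ij.1.
have mF ij : measurable (F ij).
  by rewrite /F; case: unlift => // j; case: unlift.
pose Ev (J : {set 'I_n.+1 * 'I_n.+1}) :=
  [set w | forall ij, ij \in J -> F ij (reim (X w ij.1 ij.2))].
pose J1 : {set 'I_n.+1 * 'I_n.+1} := [set ij : 'I_n.+1 * 'I_n.+1 | (ij.2 <= ij.1)%N && (ij.2 == ord0)]%SET.
pose J2 : {set 'I_n.+1 * 'I_n.+1} := [set ij : 'I_n.+1 * 'I_n.+1 | (ij.2 <= ij.1)%N && (ij.2 != ord0)]%SET.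
have PJ (J : {set 'I_n.+1 * 'I_n.+1}) : J \subset [set ij : 'I_n.+1 * 'I_n.+1 | (ij.2 <= ij.1)%N]%SET ->
    P (Ev J) = (\prod_(ij in J) P ((fun w => reim (X w ij.1 ij.2)) @^-1` F ij))%E.
  by move=> JD; exact: iX.
have S1 : J1 \subset [set ij : 'I_n.+1 * 'I_n.+1 | (ij.2 <= ij.1)%N]%SET.
  by apply/fintype.subsetP => ij; rewrite !inE => /andP[].
have S2 : J2 \subset [set ij : 'I_n.+1 * 'I_n.+1 | (ij.2 <= ij.1)%N]%SET.
  by apply/fintype.subsetP => ij; rewrite !inE => /andP[].
have dJ : (J2 :&: J1 == finset.set0)%SET.
  by apply/eqP/setP => ij; rewrite !inE; case: eqP; rewrite /= ?andbF.
have E1 : column_entries @^-1` (box B) = Ev J1.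
  apply/seteqP; split => w /= h.
    move=> [i j]; rewrite !inE/= => /andP[_ /eqP ->]; rewrite /F/= unlift_none.
    by have := h i; rewrite tnth_mktuple.
  move=> i; rewrite tnth_mktuple; have := h (i, ord0).
  by rewrite inE/= eqxx /F/= unlift_none; exact.
have P12 : P (Ev J2 `&` Ev J1) = (P (Ev J2) * P (Ev J1))%E.
  rewrite (_ : _ `&` _ = Ev (J2 :|: J1)%SET); last first.
    apply/seteqP; split => w /= h; first by move=> ij; rewrite inE => /orP[]; apply h.
    by split=> ij ijJ; apply: h; rewrite inE ijJ ?orbT.
  rewrite !PJ ?finset.subUset ?S1 ?S2// -bigU/=; last by rewrite -setI_eq0.
  by apply: eq_bigl => ij; rewrite inE.
(* Above the diagonal the block is constantly 0. If the box contains 0 at those positions they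
   impose nothing and the event is that of [J2]; otherwise the event is empty. *)
rewrite E1; have [c|nc] := pselect (forall i j : 'I_n, (i < j)%N -> A (enum_rank (i, j)) (reim 0)).
  rewrite (_ : block_entries @^-1` _ = Ev J2)//.
  apply/seteqP; split => w /= h.
    move=> [i j]; rewrite !inE/= => /andP[].
    case: (unliftP ord0 j) => [j' ->|->]; last by rewrite eqxx.
    case: (unliftP ord0 i) => [i' ->|->] _ _; rewrite /F/= ?unlift_none liftK//.
    have := h (enum_rank (i', j')).
    by rewrite tnth_mktuple enum_rankK mxE liftK.
  move=> k; rewrite tnth_mktuple -[X in A X]enum_valK; case: (enum_val k) => i j /=.
  rewrite mxE; have [ij|ji] := ltnP i j.
    by have /is_trig_mxP -> := tX w; [exact: c|rewrite !lift0].
  have := h (lift ord0 i, lift ord0 j); rewrite inE /F/= !liftK; apply.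
  by rewrite andbT /bump !leq0n !add1n ltnS.
rewrite (_ : block_entries @^-1` _ = set0); first by rewrite set0I measure0 mul0e.
apply/seteqP; split => // w /= h; apply: nc => i j ij.
have := h (enum_rank (i, j)); rewrite tnth_mktuple enum_rankK mxE/=.
have /is_trig_mxP/(_ (lift ord0 i) (lift ord0 j)) -> // := tX w.
Qed.

Lemma column_entries_law (G : n.+1.-tuple (R * R) -> \bar R) :
  measurable_fun setT G -> (forall t, 0 <= G t)%E ->
  (\int[P]_w G (column_entries w) =
   \int[lebesgue_tuple R n.+1.*2]_t ((gaussd t)%:E * G (pairs t)))%E.
Proof.
move=> mG G0; have [_ nX iX] := gX.
transitivity (\int[P]_w ((cst 1 w)%:E * G (column_entries w)))%E.
  by apply: eq_integral => w _; rewrite mul1e.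
have mg : measurable_fun setT (@gaussd R n.+1) by exact: (@measurable_gaussd _ _ _ _ id).
have mc := measurable_column_entries.
apply: ge0_integral_transfer => //; [exact: measurable_pairs|exact: gaussd_ge0|].
apply: weighted_box_unique => //; [exact: measurable_pairs|exact: gaussd_ge0| |].
  by rewrite [ltLHS](@integral_cst _ _ _ P _ measurableT 1%E) mul1e (le_lt_trans (probability_le1 P measurableT)) ?ltry.
move=> A mA; rewrite gaussd_box//.
have mb : measurable (column_entries @^-1` (box A)).
  by rewrite -[X in measurable X]setTI; apply: mc => //; exact: measurable_box.
rewrite [LHS](@integral_cst _ _ _ P _ mb 1%E) mul1e.
have := @mutually_independent_comp _ _ (fun i : 'I_n.+1 => (i, ord0 : 'I_n.+1)) _ [set: 'I_n.+1]%SET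
  _ _ _ _ _ iX.
move=> /(_ _ _ _ A (fintype.subxx _) mA).
rewrite (_ : [set w | _] = column_entries @^-1` (box A)); last first.
  apply/seteqP; split => w /= h i; last by have := h i; rewrite tnth_mktuple.
  by rewrite tnth_mktuple; apply: h; rewrite inE.
move=> H; apply: (etrans (H _ _)).
- by move=> i j [].
- by move=> i _; rewrite inE.
rewrite (eq_bigl xpredT); last by move=> i; rewrite inE.
by apply: eq_bigr => i _; have [_ _ _ H'] := nX i ord0 (leq0n _); apply: (etrans (H' _ (mA i))); rewrite {H}.
Qed.

End LowerGaussian.

(** * Conditioning on the lower block *)

Section DensityInduction.
Local Open Scope sesquilinear_scope.
Context {R : realType}.
Local Notation C := R[i].

(** Inverse to the splitting of [X] into block and first column: it makes the matrix a function of
    two independent variables, one of which can be frozen while the other is integrated. *)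
Definition assemble n (y : #|{: 'I_n * 'I_n}|.-tuple (R * R)) (v : n.+1.-tuple (R * R)) :
    'M[C]_n.+1 :=
  let z (p : R * R) : C := (p.1 +i* p.2)%C in
  \matrix_(i, j) if unlift ord0 j is Some j' then
      if unlift ord0 i is Some i' then z (tnth y (enum_rank (i', j'))) else 0
    else z (tnth v i).

Lemma lower_block_assemble n y v v' : lower_block (@assemble n y v) = lower_block (assemble y v').
Proof. by apply/matrixP => i j; rewrite !mxE !liftK. Qed.

Lemma col0_assemble n y (t : n.+1.*2.-tuple R) : col ord0 (@assemble n y (pairs t)) = cvec t.
Proof.
apply/colP => i; rewrite !mxE unlift_none tnth_mktuple/=.
by rewrite !(tnth_nth 0).
Qed.

Lemma is_trig_assemble n y v v' : is_trig_mx (@assemble n y v) -> is_trig_mx (assemble y v').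
Proof.
move=> /is_trig_mxP h; apply/is_trig_mxP => i j ij; have := h i j ij; rewrite !mxE.
by case: (unliftP ord0 j) ij => [//|->]; rewrite ltn0.
Qed.

Lemma cmeasurable_assemble n i j :
  cmeasurable (fun p : #|{: 'I_n * 'I_n}|.-tuple (R * R) * n.+1.-tuple (R * R) =>
    assemble p.1 p.2 i j).
Proof.
have mz d (T : measurableType d) (f : T -> R * R) : measurable_fun setT f ->
    cmeasurable (fun w => ((f w).1 +i* (f w).2)%C).
  move=> mf; split.
    exact: (measurableT_comp (@measurable_fst _ _ _ _) mf).
  exact: (measurableT_comp (@measurable_snd _ _ _ _) mf).
under eq_fun do rewrite mxE.
case: (unlift ord0 j) => [j'|].
  case: (unlift ord0 i) => [i'|]; last exact: cmeasurable_cst.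
  apply: (mz _ _ (fun p : #|{: 'I_n * 'I_n}|.-tuple (R * R) * n.+1.-tuple (R * R) => tnth p.1 _)).
  by apply: measurable_tnth_comp; exact: measurable_fst.
apply: (mz _ _ (fun p : #|{: 'I_n * 'I_n}|.-tuple (R * R) * n.+1.-tuple (R * R) => tnth p.2 _)).
by apply: measurable_tnth_comp; exact: measurable_snd.
Qed.

Definition gram_eigenvalues n (A : 'M[C]_n) : n.-tuple R :=
  sval (cid (exists_ordered_eigenvalues A)).

Lemma gram_eigenvaluesP n (A : 'M[C]_n) :
  ordered_eigenvalues (A *m A^t*) (gram_eigenvalues A).
Proof. by rewrite /gram_eigenvalues; case: cid. Qed.

Lemma gram_spectral n (A : 'M[C]_n) : exists2 U : 'M[C]_n, U \is unitarymx &
  A *m A^t* = U^t* *m realdiag (gram_eigenvalues A) *m U.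
Proof.
have [U [a [Uu oa AE]]] := hermitian_spectral (gram_hermitian A).
exists U; first exact: Uu.
suff -> : gram_eigenvalues A = a by exact: AE.
apply: (@ordered_eigenvalues_inj _ _ (A *m A^t*)); first exact: gram_eigenvaluesP.
apply/ordered_eigenvaluesP; split; first exact: oa.
rewrite AE char_poly_unitary// map_rootp char_poly_trig ?diag_mx_is_trig//.
by apply: eq_bigr => i _; rewrite !mxE eqxx mulr1n.
Qed.

Lemma gram_eigenvalues_secular n (X : 'M[C]_n.+1) (U : 'M[C]_n) : is_trig_mx X ->
  U \is unitarymx ->
  lower_block X *m (lower_block X)^t* =
    U^t* *m realdiag (gram_eigenvalues (lower_block X)) *m U ->
  gram_eigenvalues X = secular_roots (gram_eigenvalues (lower_block X))
    [tuple sqn ((extend_unitary U *m col ord0 X) i 0) | i < n.+1].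
Proof.
move=> tX Uu XE; apply: (@ordered_eigenvalues_inj _ _ (X *m X^t*)).
  exact: gram_eigenvaluesP.
apply/ordered_eigenvaluesP; split; first exact: nonincr_secular_roots.
rewrite (gram_peel tX Uu XE) rootp_secular_roots// => i.
by rewrite tnth_mktuple /sqn addr_ge0// sqr_ge0.
Qed.

Lemma assemble_entries n d (T : measurableType d) (P : probability T R)
    (X : T -> 'M[C]_n.+1) : lower_triangular_gaussian P X ->
  forall w, assemble (block_entries X w) (column_entries X w) = X w.
Proof.
move=> [tX _ _] w; apply/matrixP => i j; rewrite !mxE.
case: (unliftP ord0 j) => [j' ->|->]; last by rewrite tnth_mktuple/=; case: (X w i ord0).
case: (unliftP ord0 i) => [i' ->|->]; last first.
  by have /is_trig_mxP -> := tX w.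
by rewrite tnth_mktuple enum_rankK mxE/=; case: (X w _ _).
Qed.

Lemma integral_column_gaussian n d (T : measurableType d) (P : probability T R)
    (X : T -> 'M[C]_n.+1) (f : n.+1.-tuple R -> \bar R) (w : T) :
  lower_triangular_gaussian P X -> measurable_fun setT f -> (forall l, 0 <= f l)%E ->
  let a := gram_eigenvalues (lower_block (X w)) in sdec a -> posb a ->
  (\int[P]_w' f (gram_eigenvalues (assemble (block_entries X w) (column_entries X w'))) =
   \int[lebesgue_tuple R n.+1]_l ((interlacing_kernel a l)%:E * f l))%E.
Proof.
move=> gX mf f0 a sa pa; have [tX _ _] := gX.
have asX := assemble_entries gX w.
have lbX v : lower_block (assemble (block_entries X w) v) = lower_block (X w).
  by rewrite (lower_block_assemble _ _ (column_entries X w)) asX.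
have [U Uu UE] := gram_spectral (lower_block (X w)).
rewrite (@column_entries_law _ _ _ P _ X gX
  (fun v => f (gram_eigenvalues (assemble (block_entries X w) v)))); last 2 first.
- apply: measurableT_comp mf _.
  apply: (@measurable_ordered_eigenvalues _ _ _ _ (fun v => assemble (block_entries X w) v *m (assemble (block_entries X w) v)^t*)).
    apply: cmeasurable_gram => i j; have [m1 m2] := @cmeasurable_assemble n i j.
    split.
      exact: (measurableT_comp m1 (@measurable_pair1 _ _ _ _ (block_entries X w))).
    exact: (measurableT_comp m2 (@measurable_pair1 _ _ _ _ (block_entries X w))).
  by move=> v; exact: gram_eigenvaluesP.
- by [].
rewrite -(secular_roots_law sa pa mf f0).
rewrite -(@gaussian_unitary _ _ (extend_unitary U) (fun q => f (secular_roots a q))) //; last 2 first.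
- exact: extend_unitary_unitary.
- exact: measurableT_comp mf (measurable_secular_roots a).
apply: eq_integral => t _; congr (_ * f _)%E.
have tA : is_trig_mx (assemble (block_entries X w) (pairs t)).
  by apply: (@is_trig_assemble _ _ (column_entries X w)); rewrite asX.
have UA : lower_block (assemble (block_entries X w) (pairs t)) *m
    (lower_block (assemble (block_entries X w) (pairs t)))^t* =
    U^t* *m realdiag (gram_eigenvalues (lower_block (assemble (block_entries X w) (pairs t)))) *m U.
  by rewrite lbX.
by rewrite (gram_eigenvalues_secular tA Uu UA) lbX col0_assemble.
Qed.

End DensityInduction.

(** * The density of the ordered eigenvalues *)

Section EigenvalueLaw.
Local Open Scope sesquilinear_scope.
Context {R : realType}.
Local Notation C := R[i].

Lemma ge0_integral_density d (T : measurableType d) (P : probability T R) n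
    (x : T -> n.-tuple R) (h : n.-tuple R -> R) (f : n.-tuple R -> \bar R) :
  has_density P (lebesgue_tuple R n) x h ->
  measurable_fun setT f -> (forall y, 0 <= f y)%E ->
  (\int[P]_w f (x w) = \int[lebesgue_tuple R n]_y ((h y)%:E * f y))%E.
Proof.
move=> [mx mh h0 hE] mf f0.
transitivity (\int[P]_w ((cst 1 w)%:E * f (x w)))%E.
  by apply: eq_integral => w _; rewrite mul1e.
apply: (@ge0_integral_transfer _ _ _ _ _ _ _ P (lebesgue_tuple R n) x id (cst 1) h) => //.
move=> A mA; rewrite preimage_id -hE//.
have mb : measurable (x @^-1` A) by rewrite -[X in measurable X]setTI; exact: mx.
by rewrite [LHS](@integral_cst _ _ _ P _ mb 1%E) mul1e.
Qed.

(** The induction starts at size 0, where Lebesgue measure is a Dirac mass and all products are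
    empty, so the density is 1. *)
Lemma eigenvalue_law0 d (T : measurableType d) (P : probability T R) (x : T -> 0.-tuple R) :
  has_density P (lebesgue_tuple R 0) x (@eigenvalue_density R 0).
Proof.
have xE : x = cst [tuple] by apply/funext => w; rewrite (tuple0 (x w)).
have d1 (y : 0.-tuple R) : eigenvalue_density y = 1.
  rewrite eigenvalue_densityE /vconst big_geq// /vand !big_ord0 oppr0 expR0 invr1 !mulr1.
  by rewrite (_ : sdec y && posb y)//; apply/andP; split; [apply/sdecP => -[]|apply/forallP => -[]].
split.
- by rewrite xE; exact: measurable_cst.
- exact: (@measurable_eigenvalue_density _ _ _ _ id).
- exact: eigenvalue_density_ge0.
move=> A mA; rewrite integral_mkcond [RHS]integral_lebesgue_tuple0; last first.
  rewrite (_ : (_ \_ A) = cst (((fun y => (eigenvalue_density y)%:E) \_ A) [tuple])).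
    exact: measurable_cst.
  by apply/funext => y; rewrite (tuple0 y).
rewrite patchE xE d1; case: ifPn => [|/negP]; rewrite inE => tA.
  by rewrite preimage_cst mem_set// probability_setT.
by rewrite preimage_cst memNset// measure0.
Qed.

Lemma eigenvalue_lawS n d (T : measurableType d) (P : probability T R)
    (X : T -> 'M[C]_n.+1) :
  lower_triangular_gaussian P X ->
  has_density P (lebesgue_tuple R n) (fun w => gram_eigenvalues (lower_block (X w)))
    (@eigenvalue_density R n) ->
  has_density P (lebesgue_tuple R n.+1) (fun w => gram_eigenvalues (X w))
    (@eigenvalue_density R n.+1).
Proof.
move=> gX IH; have [ma _ _ aE] := IH; have [tX _ _] := gX.
pose a w := gram_eigenvalues (lower_block (X w)).
have mX : measurable_fun setT (fun w => gram_eigenvalues (X w)).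
  apply: (@measurable_ordered_eigenvalues _ _ _ _ (fun w => X w *m (X w)^t*)).
    by apply: cmeasurable_gram => i j; exact: cmeasurable_entry gX i j.
  by move=> w; exact: gram_eigenvaluesP.
split => //.
- exact: (@measurable_eigenvalue_density _ _ _ _ id).
- exact: eigenvalue_density_ge0.
move=> B mB.
pose f (l : n.+1.-tuple R) : \bar R := (\1_B l)%:E.
have mf : measurable_fun setT f by apply/measurable_EFinP; exact: measurable_indic.
have f0 l : (0 <= f l)%E by rewrite lee_fin.
have mXB : measurable ((fun w => gram_eigenvalues (X w)) @^-1` B).
  by rewrite -[X in measurable X]setTI; exact: mX.
transitivity (\int[P]_w f (gram_eigenvalues (X w)))%E.
  by have := @integral_indic _ _ _ P _ measurableT _ mXB; rewrite setIT => <-.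
have asX w : assemble (block_entries X w) (column_entries X w) = X w.
  exact: assemble_entries gX w.
pose F (p : #|{: 'I_n * 'I_n}|.-tuple (R * R) * n.+1.-tuple (R * R)) : \bar R :=
  f (gram_eigenvalues (assemble p.1 p.2)).
have mF : measurable_fun setT F.
  apply: measurableT_comp mf _.
  apply: (@measurable_ordered_eigenvalues _ _ _ _ (fun p => assemble p.1 p.2 *m (assemble p.1 p.2)^t*)).
    by apply: cmeasurable_gram => i j; exact: cmeasurable_assemble.
  by move=> p; exact: gram_eigenvaluesP.
have [FE mFE] := integral_independent (measurable_block_entries gX)
  (measurable_column_entries gX) (independent_entries gX) mF (fun p => f0 _).
transitivity (\int[P]_w F (block_entries X w, column_entries X w))%E.
  by apply: eq_integral => w _; rewrite /F/= asX.
rewrite FE.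
(* The conditional law is known for positive strictly decreasing [b]; elsewhere the kernel has no
   controlled sign and is replaced by 0. *)
pose good (b : n.-tuple R) := sdec b && posb b.
pose H (b : n.-tuple R) (l : n.+1.-tuple R) : \bar R :=
  ((good b)%:R * interlacing_kernel b l)%:E.
have H0 b l : (0 <= H b l)%E.
  rewrite lee_fin /good; have [/andP[sb pb]|] := boolP (_ && _); last by rewrite mul0r.
  by rewrite mul1r interlacing_kernel_ge0.
pose J b := (\int[lebesgue_tuple R n.+1]_l (H b l * f l))%E.
have mH : measurable_fun setT (fun p : n.-tuple R * n.+1.-tuple R => (H p.1 p.2 * f p.2)%E).
  apply: emeasurable_funM; last by apply: measurableT_comp mf _; exact: measurable_snd.
  apply/measurable_EFinP; apply: measurable_funM.
    apply: measurable_natr_bool; apply: measurable_and.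
      by apply: measurable_sdec; exact: measurable_fst.
    by apply: measurable_posb; exact: measurable_fst.
  by apply: measurable_interlacing_kernel; [exact: measurable_fst|exact: measurable_snd].
have Hf0 p : (0 <= H p.1 p.2 * f p.2)%E by rewrite mule_ge0.
have mJ : measurable_fun setT J.
  exact: (@measurable_fun_fubini_tonelli_F _ _ _ _ _ (lebesgue_tuple R n.+1) _ mH Hf0).
have J0 b : (0 <= J b)%E by apply: integral_ge0 => l _; rewrite mule_ge0.
transitivity (\int[P]_w J (a w))%E.
  apply: ae_eq_integral => //.
    exact: (measurableT_comp mJ ma).
  have mbad : measurable [set b | ~~ good b].
    rewrite (_ : [set b | _] = good @^-1` [set false]); last first.
      by apply/seteqP; split => b /=; [move/negbTE|move=> ->].
    rewrite -[X in measurable X]setTI.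
    suff mg : measurable_fun setT good by exact: mg.
    apply: measurable_and; first exact: (@measurable_sdec _ _ _ _ id).
    exact: (@measurable_posb _ _ _ _ id).
  (* This set is null because the density of the block eigenvalues vanishes off the good tuples. *)
  exists (a @^-1` [set b | ~~ good b]); split.
  - by rewrite -[X in measurable X]setTI; exact: ma.
  - rewrite [LHS]aE//; apply: integral0_eq => b /= bad.
    by rewrite eigenvalue_densityE -[_ && _]/(good b) (negbTE bad) mul0r.
  move=> w /= nE; apply/negP => /andP[sa pa]; apply: nE => _.
  rewrite [LHS](integral_column_gaussian gX mf f0 sa pa) /J /H.
  by apply: eq_integral => l _; rewrite /good sa pa mul1r.
rewrite (ge0_integral_density IH mJ J0) integral_mkcond.
have dJ b : ((eigenvalue_density b)%:E * J b =
    \int[lebesgue_tuple R n.+1]_l ((eigenvalue_density b * interlacing_kernel b l)%:E * f l))%E.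
  have mHb : measurable_fun setT (fun l => H b l * f l)%E.
    exact: (measurableT_comp mH (measurable_pair1 b)).
  rewrite -[LHS](@ge0_integralZl _ _ _ (lebesgue_tuple R n.+1) _ measurableT _ mHb)//; last 2 first.
  - by move=> l _; exact: (Hf0 (b, l)).
  - by rewrite lee_fin eigenvalue_density_ge0.
  apply: eq_integral => l _; rewrite /H muleA; congr (_ * _)%E; rewrite -EFinM; congr (_%:E).
  rewrite /good; case: (boolP (_ && _)) => [_|h]; first by rewrite mul1r.
  by rewrite eigenvalue_densityE (negbTE h) !mul0r.
transitivity (\int[lebesgue_tuple R n]_b \int[lebesgue_tuple R n.+1]_l
    ((eigenvalue_density b * interlacing_kernel b l)%:E * f l))%E.
  by apply: eq_integral => b _; exact: dJ.
have mD : measurable_fun setT (fun p : n.-tuple R * n.+1.-tuple R =>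
    ((eigenvalue_density p.1 * interlacing_kernel p.1 p.2)%:E * f p.2)%E).
  apply: emeasurable_funM; last by apply: measurableT_comp mf _; exact: measurable_snd.
  apply/measurable_EFinP; apply: measurable_funM.
    by apply: measurable_eigenvalue_density; exact: measurable_fst.
  by apply: measurable_interlacing_kernel; [exact: measurable_fst|exact: measurable_snd].
have D0 p : (0 <= (eigenvalue_density p.1 * interlacing_kernel p.1 p.2)%:E * f p.2)%E.
  by rewrite mule_ge0// lee_fin density_kernel_ge0.
have := @fubini_tonelli _ _ _ _ R (lebesgue_tuple R n) (lebesgue_tuple R n.+1) _ mD D0.
move=> H'; apply: (etrans H'); apply: eq_integral => l _ /=.
rewrite ge0_integralZr//; last 2 first.
- apply/measurable_EFinP; apply: measurable_funM.
    exact: (@measurable_eigenvalue_density _ _ _ _ id).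
  by apply: measurable_interlacing_kernel => //; exact: measurable_cst.
- by move=> b _; rewrite lee_fin density_kernel_ge0.
rewrite integral_density_kernel /f patchE indicE.
by case: ifP => _; rewrite ?mule1 ?mule0.
Qed.

Lemma eigenvalue_law n d (T : measurableType d) (P : probability T R)
    (X : T -> 'M[C]_n) :
  lower_triangular_gaussian P X ->
  has_density P (lebesgue_tuple R n) (fun w => gram_eigenvalues (X w))
    (@eigenvalue_density R n).
Proof.
elim: n X => [|n IH] X gX; first exact: eigenvalue_law0.
by apply: eigenvalue_lawS => //; apply: IH; exact: lower_block_gaussian.
Qed.

End EigenvalueLaw.

(** * The determinantal structure *)

Section Symmetrization.
Context {R : realType}.

Lemma nonincr_sdec n (x : n.-tuple R) : nonincr x -> injective (tnth x) -> sdec x.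
Proof.
move=> nx ix; apply/sdecP => i j ij; rewrite lt_neqAle nx ?(ltnW ij)// andbT.
by apply/eqP => /ix E; rewrite E ltnn in ij.
Qed.

Lemma sdec_nonincr n (x : n.-tuple R) : sdec x -> nonincr x.
Proof.
move=> /sdecP sx i j; rewrite leq_eqVlt => /predU1P[/val_inj ->//|/sx/ltW//].
Qed.

Lemma tperm_tupleM n (s t : 'S_n) (x : n.-tuple R) :
  tperm_tuple s (tperm_tuple t x) = tperm_tuple (s * t)%g x.
Proof. by apply: eq_from_tnth => i; rewrite !tnth_mktuple permM. Qed.

Lemma tperm_tuple1 n (x : n.-tuple R) : tperm_tuple 1%g x = x.
Proof. by apply: eq_from_tnth => i; rewrite !tnth_mktuple perm1. Qed.

Lemma rootp_tperm_tuple n (s : 'S_n) (x : n.-tuple R) : rootp (tperm_tuple s x) = rootp x.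
Proof.
rewrite /rootp [RHS](reindex_inj (@perm_inj _ s))/=.
by apply: eq_bigr => i _; rewrite tnth_mktuple.
Qed.

Lemma vand_tperm_tuple n (s : 'S_n) (x : n.-tuple R) :
  vand (tperm_tuple s x) = (-1) ^+ s * vand x.
Proof.
rewrite !vand_det -det_perm -det_mulmx -row_permE; congr (\det _).
by apply/matrixP => i j; rewrite !mxE tnth_mktuple.
Qed.

Lemma vand_eq0 n (x : n.-tuple R) : ~ injective (tnth x) -> vand x = 0.
Proof.
move=> ninj; rewrite vand_det.
have [i [j [ij E]]] : exists i j, i != j /\ tnth x i = tnth x j.
  apply: contrapT => h; apply: ninj => i j E; apply/eqP/negP => /negP ij.
  by apply: h; exists i, j.
by apply: (determinant_alternate ij) => k; rewrite !mxE E.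
Qed.

(** The density freed from the ordering: both Vandermonde factors change sign under an odd
    permutation, so their product is symmetric. It is not divided by [n!], hence has total mass
    [n!]. *)
Definition sym_density n (x : n.-tuple R) : R :=
  (posb x)%:R * (vconst n * expR (- \sum_(j < n) tnth x j) * (vand x * vand (ln_tuple x))).

(** With distinct entries exactly one rearrangement is decreasing and contributes; with a repeated
    entry both sides vanish. *)
Lemma sym_densityE n (x : n.-tuple R) :
  sym_density x = \sum_(s : 'S_n) eigenvalue_density (tperm_tuple s x).
Proof.
have dE (s : 'S_n) : eigenvalue_density (tperm_tuple s x) =
    (sdec (tperm_tuple s x))%:R * sym_density x.
  rewrite eigenvalue_densityE /sym_density -mulnb natrM -mulrA.
  have -> : posb (tperm_tuple s x) = posb x.
    apply/forallP/forallP => h i; last by rewrite tnth_mktuple.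
    by have := h (s^-1%g i); rewrite tnth_mktuple permKV.
  have -> : ln_tuple (tperm_tuple s x) = tperm_tuple s (ln_tuple x).
    by apply: eq_from_tnth => i; rewrite !tnth_mktuple.
  have -> : vand (tperm_tuple s x) * vand (tperm_tuple s (ln_tuple x)) =
      vand x * vand (ln_tuple x).
    by rewrite !vand_tperm_tuple mulrACA -expr2 sqrr_sign mul1r.
  congr (_ * (_ * (_ * expR (- _) * _))).
  rewrite [RHS](reindex_inj (@perm_inj _ s))/=.
  by apply: eq_bigr => i _; rewrite tnth_mktuple.
rewrite (eq_bigr _ (fun s _ => dE s)) -mulr_suml.
have [ix|nix] := pselect (injective (tnth x)); last first.
  by rewrite /sym_density (vand_eq0 nix) !(mul0r, mulr0).
have [s ns] := exists_nonincr_perm x.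
have ss : sdec (tperm_tuple s x).
  by apply: nonincr_sdec => // i j; rewrite !tnth_mktuple => /ix/perm_inj.
rewrite (bigD1 s)//= ss big1 ?addr0 ?mul1r// => t ts.
apply/eqP; rewrite pnatr_eq0 eqb0; apply: contra ts => st.
apply/eqP/permP => i; apply: ix.
have E : tperm_tuple t x = tperm_tuple s x.
  by apply: rootp_inj; [exact: sdec_nonincr|exact: sdec_nonincr|rewrite !rootp_tperm_tuple].
by have := congr1 (fun y => tnth y i) E; rewrite !tnth_mktuple.
Qed.

Lemma sym_density_ge0 n (x : n.-tuple R) : 0 <= sym_density x.
Proof. by rewrite sym_densityE sumr_ge0// => s _; exact: eigenvalue_density_ge0. Qed.

Lemma integral_sym_density n (F : n.-tuple R -> \bar R) :
  measurable_fun setT F -> (forall t, 0 <= F t)%E ->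
  (\int[lebesgue_tuple R n]_t ((sym_density t)%:E * F t) =
   \int[lebesgue_tuple R n]_t
     ((eigenvalue_density t)%:E * \sum_(s : 'S_n) F (tperm_tuple s t)))%E.
Proof.
move=> mF F0.
have mperm s := @measurable_tperm_tuple R n s.
have md : measurable_fun setT (@eigenvalue_density R n).
  exact: (@measurable_eigenvalue_density _ _ _ _ id).
have mds (s : 'S_n) : measurable_fun setT
    (fun t => (eigenvalue_density (tperm_tuple s t))%:E * F t)%E.
  by apply: emeasurable_funM => //; apply/measurable_EFinP; exact: measurableT_comp md (mperm s).
have mfs (s : 'S_n) : measurable_fun setT
    (fun t => (eigenvalue_density t)%:E * F (tperm_tuple s t))%E.
  apply: emeasurable_funM; first exact/measurable_EFinP.
  exact: measurableT_comp mF (mperm s).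
have p0 (s u : 'S_n) t : [set: n.-tuple R] t ->
    (0 <= (eigenvalue_density (tperm_tuple s t))%:E * F (tperm_tuple u t))%E.
  by move=> _; rewrite mule_ge0// lee_fin eigenvalue_density_ge0.
transitivity (\sum_(s : 'S_n) \int[lebesgue_tuple R n]_t
    ((eigenvalue_density (tperm_tuple s t))%:E * F t))%E.
  rewrite -ge0_integral_sum//; last first.
    by move=> s t _; rewrite -[X in F X]tperm_tuple1; exact: p0.
  apply: eq_integral => t _; rewrite sym_densityE -sumEFin ge0_sume_distrl// => s _.
  by rewrite lee_fin eigenvalue_density_ge0.
transitivity (\sum_(s : 'S_n) \int[lebesgue_tuple R n]_t
    ((eigenvalue_density t)%:E * F (tperm_tuple s t)))%E; last first.
  rewrite -ge0_integral_sum//; last first.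
    by move=> s t _; rewrite -[X in eigenvalue_density X]tperm_tuple1; exact: p0.
  apply: eq_integral => t _; rewrite ge0_sume_distrr// => s _; exact: F0.
(* Substituting [tperm_tuple s t] in the term of [s^-1] moves the permutation from the density to
   [F]. *)
rewrite (reindex_inj invg_inj)/=; apply: eq_bigr => s _.
rewrite -(@ge0_integral_perm R n s)//; last first.
  by move=> t; rewrite -[X in F X]tperm_tuple1; exact: p0.
by apply: eq_integral => t _; rewrite tperm_tupleM mulVg tperm_tuple1.
Qed.

End Symmetrization.

(** * The two families of functions and their integrability *)

Section Biorthogonal.
Context {R : realType}.
Notation mu := (@lebesgue_measure R).

Lemma exprn_le_expR k (y : R) : 0 <= y -> y ^+ k <= k`!%:R * expR y.
Proof.
move=> y0; have := @expR_ge1Dxn R y k.-1 y0; case: k => [|k] /= h.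
  by rewrite expr0 fact0 mul1r (le_trans _ (expR_ge1Dx y))// lerDl.
rewrite mulrC -ler_pdivrMr ?ltr0n ?fact_gt0// (le_trans _ h)// lerDr.
exact: ler01.
Qed.

(* The signs make the determinants of [phi i] and [psi j] positive multiples of
   [vand x] and [vand (ln_tuple x)], in which factors are [x_i - x_j] for i < j. *)
Definition phi (i : nat) (x : R) : R := posi x * ((- x) ^+ i * expR (- (x / 2))).
Definition psi (j : nat) (x : R) : R := posi x * ((- ln x) ^+ j * expR (- (x / 2))).

Lemma measurable_phi i : measurable_fun setT (phi i).
Proof.
apply: measurable_funM; first exact: measurable_posi.
apply: measurable_funM; first by apply: measurable_funX; exact: oppr_measurable.
apply: measurableT_comp => //; apply: measurableT_comp => //.
by apply: measurable_funM.
Qed.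

Lemma measurable_psi j : measurable_fun setT (psi j).
Proof.
apply: measurable_funM; first exact: measurable_posi.
apply: measurable_funM.
  by apply: measurable_funX; apply: measurableT_comp => //; exact: measurable_ln.
apply: measurableT_comp => //; apply: measurableT_comp => //.
by apply: measurable_funM.
Qed.

(** After [x = y^2] the factor [y] absorbs the logarithm, since the [j]-th power of its modulus is
    at most [j! (y + 1/y)]. The remaining power of [1 + y^2] is bounded by a constant times
    [exp((1 + y^2)/2)], and [(1 - y)^2 >= 0] bounds the total exponent by [1 - y]. *)
Let phi_psi_bound i j (y : R) : 0 < y ->
  (y *+ 2) * ((y ^+ 2) ^+ i * `|ln (y ^+ 2)| ^+ j * expR (- y ^+ 2)) <=
  (2 * 2 ^+ j * j`!%:R * (2 ^+ i.+1 * i.+1`!%:R) * expR 1) * expR (- y).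
Proof.
move=> y0.
have L : `|ln y| ^+ j * y <= j`!%:R * (1 + y ^+ 2).
  apply: (@le_trans _ _ (j`!%:R * (y + y^-1) * y)).
    apply: ler_wpM2r; first exact: ltW.
    apply: le_trans (exprn_le_expR j (normr_ge0 _)) _; apply: ler_wpM2l => //.
    have [l0|l0] := leP 0 (ln y).
      by rewrite ger0_norm// lnK ?posrE// lerDl invr_ge0 ltW.
    by rewrite ltr0_norm// expRN lnK ?posrE// lerDr ltW.
  by rewrite -mulrA mulrDl mulVf ?gt_eqF// -expr2 addrC.
have Y : (y ^+ 2) ^+ i * (1 + y ^+ 2) <= (2 ^+ i.+1 * i.+1`!%:R) * expR ((1 + y ^+ 2) / 2).
  have z0 : 0 <= 1 + y ^+ 2 by rewrite addr_ge0// sqr_ge0.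
  apply: (@le_trans _ _ ((1 + y ^+ 2) ^+ i.+1)).
    rewrite [X in _ <= X]exprSr ler_wpM2r// lerXn2r ?nnegrE ?sqr_ge0// lerDr.
    exact: ler01.
  have -> : (1 + y ^+ 2) ^+ i.+1 = 2 ^+ i.+1 * ((1 + y ^+ 2) / 2) ^+ i.+1.
    by rewrite -exprMn mulrC divfK// pnatr_eq0.
  rewrite -mulrA ler_wpM2l ?exprn_ge0// exprn_le_expR// divr_ge0//.
have E : expR ((1 + y ^+ 2) / 2) * expR (- y ^+ 2) <= expR 1 * expR (- y).
  rewrite -!expRD ler_expR; have := sqr_ge0 (1 - y); lra.
have lnE : `|ln (y ^+ 2)| ^+ j = 2 ^+ j * `|ln y| ^+ j.
  by rewrite lnXn// -[ln y *+ 2]mulr_natl normrM exprMn ger0_norm.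
rewrite lnE.
have e0 : 0 <= expR (- y ^+ 2) by exact: expR_ge0.
have -> : y *+ 2 * ((y ^+ 2) ^+ i * (2 ^+ j * `|ln y| ^+ j) * expR (- y ^+ 2)) =
    (2 * 2 ^+ j) * ((y ^+ 2) ^+ i * expR (- y ^+ 2)) * (`|ln y| ^+ j * y).
  by rewrite -mulr_natl; ring.
have c0 : 0 <= 2 * 2 ^+ j :> R by rewrite mulr_ge0// exprn_ge0.
apply: (@le_trans _ _ ((2 * 2 ^+ j) * ((y ^+ 2) ^+ i * expR (- y ^+ 2)) * (j`!%:R * (1 + y ^+ 2)))).
  apply: ler_wpM2l L; apply: mulr_ge0 => //; apply: mulr_ge0 => //.
  by rewrite exprn_ge0// sqr_ge0.
have -> : (2 * 2 ^+ j) * ((y ^+ 2) ^+ i * expR (- y ^+ 2)) * (j`!%:R * (1 + y ^+ 2)) =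
    (2 * 2 ^+ j * j`!%:R) * (((y ^+ 2) ^+ i * (1 + y ^+ 2)) * expR (- y ^+ 2)).
  by move: (j`!%:R) => F; ring.
have -> : 2 * 2 ^+ j * j`!%:R * (2 ^+ i.+1 * i.+1`!%:R) * expR 1 * expR (- y) =
    (2 * 2 ^+ j * j`!%:R) * ((2 ^+ i.+1 * i.+1`!%:R) * (expR 1 * expR (- y))).
  by rewrite !mulrA.
apply: ler_wpM2l; first by rewrite mulr_ge0.
apply: (le_trans (ler_wpM2r e0 Y)).
rewrite -[X in X <= _]mulrA; apply: ler_wpM2l; last exact: E.
by rewrite mulr_ge0// exprn_ge0.
Qed.

Lemma integrable_phi_psi i j :
  mu.-integrable setT (EFin \o (fun x => phi i x * psi j x)).
Proof.
apply/integrableP; split.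
  apply/measurable_EFinP; apply: measurable_funM; [exact: measurable_phi|exact: measurable_psi].
pose f (x : R) : \bar R := (`|x| ^+ i * `|ln x| ^+ j * expR (- x))%:E.
have mf : measurable_fun setT f.
  apply/measurable_EFinP; apply: measurable_funM.
    apply: measurable_funM; apply: measurable_funX; first exact: normr_measurable.
    apply: measurableT_comp; [exact: normr_measurable|exact: measurable_ln].
  by apply: measurableT_comp => //; exact: oppr_measurable.
have f0 x : (0 <= f x)%E by rewrite lee_fin !mulr_ge0// exprn_ge0.
rewrite (_ : (fun x => _) = (fun x => ((posi x)%:E * f x)%E)); last first.
  apply/funext => x /=; rewrite -EFinM /phi /psi /posi.
  case: ifP => _; last by rewrite !mul0r normr0.
  rewrite !mul1r !normrM !normrX !normrN !(ger0_norm (expR_ge0 _)) mulrACA -expRD.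
  by rewrite -opprD -splitr.
(* The substitution [x = y^2] brings in a factor [2y] that tames the logarithm at 0, and leaves an
   integrand dominated by a multiple of [exp(-y)]. *)
rewrite -(ge0_integral_posi_sqr mf f0).
pose C : R := (2 * 2 ^+ j * j`!%:R * (2 ^+ i.+1 * i.+1`!%:R) * expR 1).
have C0 : 0 <= C by rewrite !mulr_ge0 ?expR_ge0 ?exprn_ge0.
apply: (@le_lt_trans _ _ (\int[mu]_x (C%:E * (posi x * expR (- x))%:E))%E).
  apply: ge0_le_integral => //.
  - by move=> x _; rewrite mule_ge0// lee_fin /posi; case: ifP => [x0|]; rewrite ?mul0r// mul1r mulrn_wge0// ltW.
  - apply: emeasurable_funM.
      apply/measurable_EFinP; apply: measurable_funM; first exact: measurable_posi.
      by apply: (@measurable_funD _ _ _ _ id id); exact: measurable_id.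
    by apply: measurableT_comp mf _; exact: (@measurable_funX _ _ _ _ id).
  - apply/measurable_EFinP; apply: measurable_funM => //; apply: measurable_funM; first exact: measurable_posi.
    by apply: measurableT_comp => //; exact: oppr_measurable.
  - move=> x _; rewrite /f -!EFinM lee_fin /posi; case: ifP => [x0|_]; last by rewrite !mul0r mulr0.
    rewrite !mul1r (ger0_norm (sqr_ge0 x)); exact: phi_psi_bound.
rewrite ge0_integralZl//; last 2 first.
- apply/measurable_EFinP; apply: measurable_funM; first exact: measurable_posi.
  by apply: measurableT_comp => //; exact: oppr_measurable.
- by move=> x _; rewrite lee_fin mulr_ge0 ?expR_ge0// /posi; case: ifP.
by rewrite integral_posi_exp mule1 ltry.
Qed.

End Biorthogonal.

(** * The kernel and its reproducing property *)

Section Kernel.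
Context {R : realType} (n : nat).
Notation mu := (@lebesgue_measure R).

(** Rows belong to [psi] and columns to [phi], so that this is the integral of
    [psi_col x *m phi_row x]. *)
Definition gram_mx : 'M[R]_n :=
  \matrix_(j, i) fine (\int[mu]_x (phi i x * psi j x)%:E)%E.
Definition phi_mx m (t : m.-tuple R) : 'M[R]_(m, n) := \matrix_(a, i) phi i (tnth t a).
Definition psi_mx m (t : m.-tuple R) : 'M[R]_(n, m) := \matrix_(j, b) psi j (tnth t b).
Definition phi_row (x : R) : 'rV[R]_n := \row_i phi i x.
Definition psi_col (x : R) : 'cV[R]_n := \col_j psi j x.

(** By cyclicity, the integrand is the trace of [N] times [psi_col x *m phi_row x]. *)
Lemma integral_bilinear (N : 'M[R]_n) :
  (\int[mu]_x ((phi_row x *m N *m psi_col x) 0 0)%:E = (\tr (N *m gram_mx))%:E)%E.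
Proof.
have NE x : ((phi_row x *m N *m psi_col x) 0 0)%:E =
    (\sum_(i < n) \sum_(j < n) (N i j)%:E * (phi i x * psi j x)%:E)%E.
  under [RHS]eq_bigr => i _ do under eq_bigr => j _ do rewrite -EFinM.
  under [RHS]eq_bigr => i _ do rewrite sumEFin.
  rewrite sumEFin; congr EFin; rewrite mxE exchange_big/=; apply: eq_bigr => j _.
  rewrite !mxE mulr_suml; apply: eq_bigr => i _; rewrite !mxE.
  by rewrite [phi i x * N i j]mulrC -mulrA.
under eq_integral do rewrite NE.
have ii i j : mu.-integrable setT (fun x => (N i j)%:E * (phi i x * psi j x)%:E)%E.
  exact: (integrableZl measurableT (N i j) (integrable_phi_psi i j)).
rewrite integral_sum//; last by move=> i; apply: integrable_sum.
rewrite /mxtrace -sumEFin; apply: eq_bigr => i _.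
rewrite integral_sum// !mxE -sumEFin; apply: eq_bigr => j _.
rewrite (integralZl measurableT (integrable_phi_psi i j)) EFinM mxE fineK//.
exact: (integral_fune_fin_num measurableT (integrable_phi_psi i j)).
Qed.

(* Andreief's identity. *)
Lemma integral_det_phi_psi :
  (\int[lebesgue_tuple R n]_t (\det (phi_mx t) * \det (psi_mx t))%:E =
   (n`!%:R * \det gram_mx)%:E)%E.
Proof.
(* Only the determinant of [phi_mx] is expanded: for each [s], its product with the other one is
   again a determinant, [phi (s a)] being multiplied into row [a]. Every [s] contributes the same
   Gram determinant. *)
pose g (s : 'S_n) (a j : 'I_n) (x : R) : R := phi (s a) x * psi j x.
have ig s a j : mu.-integrable setT (EFin \o g s a j) by exact: integrable_phi_psi.
have dE t : (\det (phi_mx t) * \det (psi_mx t))%:E =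
    (\sum_(s : 'S_n) ((-1) ^+ s)%:E * (\det (\matrix_(a, j) g s a j (tnth t a)))%:E)%E.
  under [RHS]eq_bigr => s _ do rewrite -EFinM.
  rewrite sumEFin; congr EFin; rewrite [X in X * _]/determinant mulr_suml.
  apply: eq_bigr => s _; rewrite -mulrA; congr (_ * _).
  rewrite -(det_tr (psi_mx t)) -det_scale_rows; congr (\det _).
  by apply/matrixP => a j; rewrite !mxE; congr (_ * _).
under eq_integral do rewrite dE.
have idet s := @integral_det R n (g s) (ig s).
rewrite integral_sum//; last first.
  by move=> s; exact: (integrableZl measurableT ((-1) ^+ s) (idet s).1).
transitivity (\sum_(s : 'S_n) (\det gram_mx)%:E)%E; last first.
  by rewrite sumEFin sumr_const card_Sn mulr_natl.
apply: eq_bigr => s _; rewrite (integralZl measurableT (idet s).1) (idet s).2 -EFinM.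
congr EFin; rewrite (_ : \matrix_(a, j) _ = row_perm s gram_mx^T); last first.
  by apply/matrixP => a j; rewrite !mxE.
by rewrite row_permE det_mulmx det_perm det_tr mulrA -expr2 sqrr_sign mul1r.
Qed.

(** The weight [exp(-x)] is shared equally between [phi] and [psi], and both carry the indicator of
    positivity. *)
Lemma sym_density_det (t : n.-tuple R) :
  sym_density t = @vconst R n * (\det (phi_mx t) * \det (psi_mx t)).
Proof.
have dphi : \det (phi_mx t) =
    (\prod_(a < n) (posi (tnth t a) * expR (- (tnth t a / 2)))) * vand t.
  rewrite vand_det -det_scale_rows; congr (\det _); apply/matrixP => a i.
  by rewrite !mxE /phi mulrAC mulrA mulrAC.
have dpsi : \det (psi_mx t) =
    (\prod_(a < n) (posi (tnth t a) * expR (- (tnth t a / 2)))) * vand (ln_tuple t).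
  rewrite vand_det -det_scale_rows -det_tr; congr (\det _); apply/matrixP => a i.
  by rewrite !mxE /psi tnth_mktuple mulrAC mulrA mulrAC.
have posiE : \prod_(a < n) posi (tnth t a) = (posb t)%:R.
  rewrite /posi; have [/forallP p|/forallPn[i ni]] := boolP (posb t).
    by rewrite big1// => a _; rewrite p.
  by rewrite (bigD1 i)//= (negbTE ni) mul0r.
have eE : \prod_(a < n) (posi (tnth t a) * expR (- (tnth t a / 2)) *
    (posi (tnth t a) * expR (- (tnth t a / 2)))) =
    (posb t)%:R * expR (- \sum_(a < n) tnth t a).
  rewrite -posiE -sumrN expR_sum -big_split/=; apply: eq_bigr => a _.
  rewrite mulrACA -expRD -opprD -splitr; congr (_ * _).
  by rewrite /posi; case: ifP; rewrite ?mulr1 ?mulr0.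
rewrite dphi dpsi mulrACA -big_split/= eE /sym_density.
by rewrite -!mulrA [RHS]mulrCA.
Qed.

(** Supplied by [vconst_det_gram] from the total probability; it makes the Gram matrix invertible
    and fixes the normalization. *)
Hypothesis mass : @vconst R n * \det gram_mx = 1.

Definition eig_kernel (x y : R) : R := (phi_row x *m invmx gram_mx *m psi_col y) 0 0.
Definition kernel_mx m (t : m.-tuple R) : 'M[R]_m :=
  \matrix_(a, b) eig_kernel (tnth t a) (tnth t b).

Let gram_unit : gram_mx \in unitmx.
Proof.
rewrite unitmxE unitfE; apply/eqP => d0; move/eqP: mass.
by rewrite d0 mulr0 eq_sym oner_eq0.
Qed.

Lemma kernel_mxE m (t : m.-tuple R) :
  kernel_mx t = phi_mx t *m invmx gram_mx *m psi_mx t.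
Proof.
apply/matrixP => a b; rewrite mxE /eig_kernel [LHS]mxE [RHS]mxE.
apply: eq_bigr => j _; rewrite [in RHS]mxE; congr (_ * _); last by rewrite !mxE.
by rewrite !mxE; apply: eq_bigr => i _; rewrite !mxE.
Qed.

Lemma det_kernel_mx_max (t : n.-tuple R) : \det (kernel_mx t) = sym_density t.
Proof.
have d0 : \det gram_mx != 0 by rewrite -unitfE -unitmxE.
rewrite kernel_mxE !det_mulmx det_inv sym_density_det.
have -> : @vconst R n = (\det gram_mx)^-1 by rewrite -[LHS](mulfK d0) mass mul1r.
by rewrite mulrAC mulrC.
Qed.

(** The matrix factors through dimension [n], so its rank is less than its size. *)
Lemma det_kernel_mx_gt m (t : m.-tuple R) : (n < m)%N -> \det (kernel_mx t) = 0.
Proof.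
move=> nm; apply/eqP/negPn; rewrite -unitfE -unitmxE -row_full_unit -col_leq_rank -ltnNge.
rewrite kernel_mxE -mulmxA; apply: leq_ltn_trans nm.
by apply: leq_trans (mxrankM_maxl _ _) _; exact: rank_leq_col.
Qed.

(** The Schur formula makes the determinant a bilinear expression in the functions of the new point.
    Its integral is the trace of [\det A] times the identity of size [n], minus the trace of
    [\adj A *m A], of size [m]. *)
Lemma integral_det_kernel_cons m (t : m.-tuple R) :
  (\int[mu]_x (\det (kernel_mx [tuple of x :: t]))%:E =
   ((n%:R - m%:R) * \det (kernel_mx t))%:E)%E.
Proof.
set A := kernel_mx t; set M := invmx gram_mx.
have dE x : \det (kernel_mx [tuple of x :: t]) =
    (phi_row x *m (\det A *: M - M *m psi_mx t *m \adj A *m phi_mx t *m M) *m psi_col x) 0 0.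
  have -> : kernel_mx [tuple of x :: t] = block_mx ((eig_kernel x x)%:M : 'M[R]_1)
      (phi_row x *m M *m psi_mx t) (phi_mx t *m M *m psi_col x) A :> 'M[R]_(1 + m).
    have l0 : (ord0 : 'I_m.+1) = lshift m (ord0 : 'I_1) by exact: val_inj.
    apply/matrixP => a b; rewrite mxE.
    case: (unliftP ord0 a) => [a' ->|->]; case: (unliftP ord0 b) => [b' ->|->].
    - rewrite !tnthS -!rshift1 block_mxEdr mxE//.
    - rewrite tnthS tnth0 -rshift1 l0 block_mxEdl.
      rewrite /eig_kernel [LHS]mxE [RHS]mxE; apply: eq_bigr => j _; congr (_ * _).
      by rewrite !mxE; apply: eq_bigr => i _; rewrite !mxE.
    - rewrite tnthS tnth0 -rshift1 l0 block_mxEur.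
      rewrite /eig_kernel [LHS]mxE [RHS]mxE; apply: eq_bigr => j _; congr (_ * _).
      by rewrite !mxE.
    - by rewrite tnth0 l0 block_mxEul mxE eqxx mulr1n.
  rewrite [LHS]det_schur mulmxBr mulmxBl [RHS]mxE [X in _ = _ + X]mxE; congr (_ - _).
    by rewrite -scalemxAr -scalemxAl [RHS]mxE mulrC.
  by rewrite !mulmxA.
under eq_integral do rewrite dE.
rewrite integral_bilinear; congr EFin.
have MG : M *m gram_mx = 1%:M by exact: mulVmx.
rewrite mulmxBl linearB/= -scalemxAl MG linearZ/= mxtrace1.
rewrite -(mulmxA _ M gram_mx) MG mulmx1 -(mulmxA _ (\adj A)) mxtrace_mulC -!mulmxA.
rewrite (_ : _ *m _ = \adj A *m A); last by rewrite /A kernel_mxE -!mulmxA.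
by rewrite mul_adj_mx mxtrace_scalar mulrBl !mulr_natl mulr_natr.
Qed.

(** Downward induction from [m = n], where this is the symmetric density: integrating out one point
    multiplies by the positive factor [n - m]. Beyond [n] the determinant is 0. *)
Lemma det_kernel_mx_ge0 m (t : m.-tuple R) : 0 <= \det (kernel_mx t).
Proof.
have [nm|] := ltnP n m; first by rewrite det_kernel_mx_gt.
move=> mn; have [k kE] : exists k, n = (m + k)%N by exists (n - m)%N; rewrite subnKC.
elim: k m t kE {mn} => [|k IH] m t kE.
  have E : m = n by rewrite kE addn0.
  by move: t; rewrite E => t; rewrite det_kernel_mx_max sym_density_ge0.
have := integral_det_kernel_cons t.
have -> : n%:R - m%:R = k.+1%:R :> R by rewrite kE natrD addrC addKr.
move=> E; rewrite -(@pmulr_rge0 _ k.+1%:R)// -lee_fin -E.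
by apply: integral_ge0 => x _; rewrite lee_fin IH// kE addSnnS.
Qed.

Lemma measurable_det_kernel_mx d (T : measurableType d) m (f : T -> m.-tuple R) :
  measurable_fun setT f -> measurable_fun setT (fun w => \det (kernel_mx (f w))).
Proof.
move=> mf; rewrite /determinant; apply: measurable_sum => s.
apply: measurable_funM; first exact: measurable_cst.
apply: measurable_prod => a _; under eq_fun do rewrite mxE.
rewrite /eig_kernel; under eq_fun do rewrite mxE.
apply: measurable_sum => j; apply: measurable_funM; last first.
  under eq_fun do rewrite mxE.
  by apply: measurableT_comp (@measurable_psi R j) _; exact: measurable_tnth_comp.
under eq_fun do rewrite mxE.
apply: measurable_sum => i; apply: measurable_funM; last exact: measurable_cst.
under eq_fun do rewrite mxE.
by apply: measurableT_comp (@measurable_phi R i) _; exact: measurable_tnth_comp.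
Qed.

End Kernel.

(** * Counting extensions of injections *)

Section Injections.
Context {R : realType} (I : finType) (m : nat).

Definition ffrest (s : {ffun 'I_m.+1 -> I}) : {ffun 'I_m -> I} :=
  [ffun a => s (lift ord0 a)].

Let ffcons (v : I) (s : {ffun 'I_m -> I}) : {ffun 'I_m.+1 -> I} :=
  [ffun a => if unlift ord0 a is Some b then s b else v].

(** The value at the additional point can be any of the [#|I| - m] elements outside the image. *)
Lemma sum_injections (H : {ffun 'I_m -> I} -> \bar R) : (forall s, 0 <= H s)%E ->
  (\sum_(s : {ffun 'I_m.+1 -> I} | injectiveb s) H (ffrest s) =
   (#|I| - m)%:R%:E * \sum_(s : {ffun 'I_m -> I} | injectiveb s) H s)%E.
Proof.
move=> H0.
have rest_inj (s : {ffun 'I_m.+1 -> I}) : injectiveb s -> injectiveb (ffrest s).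
  move=> /injectiveP si; apply/injectiveP => a b; rewrite !ffunE => /si.
  exact: lift_inj.
rewrite (partition_big ffrest (fun s => injectiveb s))//= ge0_sume_distrr//.
apply: eq_bigr => s' /injectiveP s'i.
rewrite (eq_bigr (fun=> H s')); last by move=> s /andP[_ /eqP ->].
have restK v : ffrest (ffcons v s') = s'.
  by apply/ffunP => a; rewrite !ffunE liftK.
have cardE : #|[set s : {ffun 'I_m.+1 -> I} | injectiveb s && (ffrest s == s')]%SET| = (#|I| - m)%N.
  rewrite (_ : [set s | _]%SET = (ffcons^~ s') @: [set v | v \notin codom s']%SET).
    rewrite card_imset; last first.
      by move=> v w /ffunP/(_ ord0); rewrite !ffunE unlift_none.
    have := cardC (mem (codom s')); rewrite card_codom// card_ord => <-.
    by rewrite addKn; apply: eq_card => v; rewrite !inE.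
  apply/setP => s; rewrite inE; apply/andP/imsetP => [[/injectiveP si /eqP sE]|[v]].
    exists (s ord0).
      rewrite inE; apply/codomP => -[b]; rewrite -sE ffunE => /si/eqP.
      by rewrite (negbTE (neq_lift _ _)).
    apply/ffunP => a; rewrite ffunE; case: (unliftP ord0 a) => [b ->|-> //].
    by rewrite -sE ffunE.
  rewrite inE => vs ->; rewrite restK eqxx; split=> //; apply/injectiveP => a b.
  rewrite !ffunE; case: (unliftP ord0 a) => [a' ->|->]; case: (unliftP ord0 b) => [b' ->|->] //.
  - by move=> /s'i ->.
  - by move=> E; rewrite -E codom_f in vs.
  - by move=> E; rewrite E codom_f in vs.
rewrite (eq_bigl (fun s => s \in [set s : {ffun 'I_m.+1 -> I} | injectiveb s && (ffrest s == s')]%SET));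
  last by move=> s; rewrite !inE.
by rewrite sumr_const cardE mule_natl.
Qed.

End Injections.

(** * Correlation functions *)

Section Correlation.
Context {R : realType} d (T : measurableType d) (P : probability T R) (n : nat).
Variable lam : T -> n.-tuple R.
Hypothesis law : has_density P (lebesgue_tuple R n) lam (@eigenvalue_density R n).
Notation kernel_mx := (@kernel_mx R n).

Let mlam : measurable_fun setT lam. Proof. by have [] := law. Qed.

(** The integral of [sym_density] computed twice: it is [n!] because each of the orderings carries
    the total probability, and [n!] times the left-hand side by Andreief's identity. *)
Lemma vconst_det_gram : @vconst R n * \det (@gram_mx R n) = 1.
Proof.
have mE := @measurable_eigenvalue_density R _ _ n.
have mS : measurable_fun setT (@sym_density R n).
  rewrite (_ : @sym_density R n = fun t => \sum_(s : 'S_n) eigenvalue_density (tperm_tuple s t)).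
    by apply: measurable_sum => s; apply: mE; exact: measurable_tperm_tuple.
  by apply/funext => t; rewrite sym_densityE.
have SE : (\int[lebesgue_tuple R n]_t (sym_density t)%:E = n`!%:R%:E)%E.
  transitivity (\int[lebesgue_tuple R n]_t ((sym_density t)%:E * cst 1%E t))%E.
    by apply: eq_integral => t _; rewrite mule1.
  rewrite integral_sym_density//.
  transitivity (\int[P]_w (cst (n`!%:R%:E) w))%E.
    rewrite -(ge0_integral_density law)//; last 2 first.
    - by under eq_fun do rewrite sumEFin; exact: measurable_cst.
    - by move=> t; rewrite sume_ge0.
    by apply: eq_integral => w _; rewrite sumEFin sumr_const card_Sn.
  rewrite [LHS](@integral_cst _ _ _ P _ measurableT (n`!%:R)%:E).
  by apply: (etrans (congr1 (mule _) (probability_setT P))); rewrite mule1.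
have v0 := @vconst_gt0 R n; have f0 : (n`!%:R : R) != 0 by rewrite pnatr_eq0 -lt0n fact_gt0.
have := @integral_det_phi_psi R n.
rewrite (eq_integral (fun t => (((@vconst R n)^-1)%R%:E * (sym_density t)%:E)%E)); last first.
  by move=> t _; rewrite -EFinM sym_density_det mulKf// gt_eqF.
rewrite ge0_integralZl//; last 3 first.
- exact/measurable_EFinP.
- by move=> t _; rewrite lee_fin sym_density_ge0.
- by rewrite lee_fin invr_ge0 ltW.
rewrite SE -EFinM => -[E]; apply: (mulfI f0).
by rewrite mulrCA -E mulrA mulfV ?gt_eqF// mul1r mulr1.
Qed.

(** Downward induction on [m] from the symmetrized density at [m = n]. For a function that ignores
    its first argument, the statement for [m + 1] points acquires the factor [n - m] on both sides:
    from extending injections on the left, from integrating out a point on the right. *)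
Lemma correlation m k (F : m.-tuple R -> \bar R) : (m + k = n)%N ->
  measurable_fun setT F -> (forall t, 0 <= F t)%E ->
  (\int[P]_w (\sum_(s : {ffun 'I_m -> 'I_n} | injectiveb s)
      F [tuple tnth (lam w) (s a) | a < m]) =
   \int[lebesgue_tuple R m]_t ((\det (kernel_mx t))%:E * F t))%E.
Proof.
elim: k m F => [|k IH] m F mkn mF F0.
  have E : m = n by rewrite -mkn addn0.
  move: F mF F0; rewrite {}E => F mF F0.
  under [RHS]eq_integral do rewrite (det_kernel_mx_max vconst_det_gram).
  rewrite integral_sym_density// -(ge0_integral_density law)//; last 2 first.
  - apply: emeasurable_sum => s; apply: measurableT_comp mF _.
    exact: measurable_tperm_tuple.
  - by move=> t; rewrite sume_ge0.
  apply: eq_integral => w _.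
  (* Injections of ['I_n] into itself are the permutations; the default of [insubd] is not met on
     them. *)
  rewrite (reindex_onto (fun s : 'S_n => pval s) (fun s : {ffun 'I_n -> 'I_n} => insubd (1%g : 'S_n) s))/=; last first.
    by move=> s si; exact: insubdK.
  apply: eq_big => [s|s _]; first by rewrite valKd eqxx andbT; exact: (valP s).
  congr F; apply: eq_from_tnth => i; rewrite !tnth_mktuple.
  by rewrite -[pval s]/(val s) pvalE.
pose F' (t : m.+1.-tuple R) : \bar R := F [tuple of behead t].
have mF' : measurable_fun setT F' by apply: measurableT_comp mF _; exact: measurable_behead.
have F'0 t : (0 <= F' t)%E by exact: F0.
have D0 := det_kernel_mx_ge0 vconst_det_gram.
have mD p : measurable_fun setT (fun t : p.-tuple R => \det (kernel_mx t)).
  by apply: measurable_det_kernel_mx; exact: measurable_id.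
have c0 : 0 < k.+1%:R :> R by rewrite ltr0n.
have nmk : (n - m = k.+1)%N by rewrite -mkn addKn.
have := IH m.+1 F'; rewrite addSnnS => /(_ mkn mF' F'0).
have mG : measurable_fun setT (fun t : m.+1.-tuple R => ((\det (kernel_mx t))%:E * F' t)%E).
  by apply: emeasurable_funM => //; apply/measurable_EFinP; exact: mD.
rewrite [X in _ = X -> _]integral_lebesgue_tupleS2//; last first.
  by move=> t; rewrite mule_ge0// lee_fin D0.
rewrite [X in _ = X -> _](_ : _ = (k.+1%:R%:E * \int[lebesgue_tuple R m]_t ((\det (kernel_mx t))%:E * F t))%E); last first.
  rewrite -ge0_integralZl//; last 2 first.
  - by apply: emeasurable_funM => //; apply/measurable_EFinP; exact: mD.
  - by move=> t _; rewrite mule_ge0// lee_fin D0.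
  apply: eq_integral => t _.
  transitivity (\int[@lebesgue_measure R]_x ((\det (kernel_mx [tuple of x :: t]))%:E * F t))%E.
    by apply: eq_integral => x _; congr (_ * F _)%E; exact: val_inj.
  rewrite ge0_integralZr//; last 2 first.
  - by apply/measurable_EFinP; exact: (measurableT_comp (mD _) (measurable_tuple_cons1 t)).
  - by move=> x _; rewrite lee_fin D0.
  rewrite [X in (X * _)%E](integral_det_kernel_cons vconst_det_gram) muleA -EFinM.
  by rewrite -natrB ?nmk// -mkn leq_addr.
rewrite [X in X = _ -> _](_ : _ = (k.+1%:R%:E * \int[P]_w (\sum_(s : {ffun 'I_m -> 'I_n} | injectiveb s)
      F [tuple tnth (lam w) (s a) | a < m]))%E); last first.
  rewrite -ge0_integralZl//; last 2 first.
  - under eq_fun do rewrite big_mkcond.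
    apply: emeasurable_sum => s; have [si|/negbTE si] := boolP (injectiveb s); last first.
      exact: measurable_cst.
    apply: measurableT_comp mF _.
    by apply: measurable_mktuple => a; exact: measurable_tnth_comp.
  - by move=> w _; rewrite sume_ge0.
  apply: eq_integral => w _.
  have := @sum_injections R 'I_n m (fun s => F [tuple tnth (lam w) (s a) | a < m]) (fun=> F0 _).
  rewrite card_ord nmk => <-; apply: eq_bigr => s _; congr F.
  by apply: eq_from_tnth => a; rewrite tnth_behead -lift0 !tnth_mktuple ffunE inord_val.
move=> /(congr1 (fun z => (k.+1%:R^-1)%:E * z)%E).
by rewrite !muleA -EFinM mulVf ?gt_eqF// !mul1e.
Qed.

End Correlation.

Local Open Scope sesquilinear_scope.

Theorem theorem3 (R : realType) (d : measure_display) (T : measurableType d)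
    (P : probability T R) (n : nat) (X : T -> 'M[R[i]]_n)
    (lambda : T -> n.-tuple R) :
  (0 < n)%N ->
  lower_triangular_gaussian P X ->
  (forall w : T, ordered_eigenvalues (X w *m (X w)^t*) (lambda w)) ->
  has_density P (lebesgue_tuple R n) lambda (@eigenvalue_density R n) /\
  determinantal P (fun (i : 'I_n) (w : T) => tnth (lambda w) i).
Proof.
move=> _ gX lX.
have lE : lambda = fun w => gram_eigenvalues (X w).
  by apply/funext => w; exact: ordered_eigenvalues_inj (lX w) (gram_eigenvaluesP (X w)).
have law : has_density P (lebesgue_tuple R n) lambda (@eigenvalue_density R n).
  by rewrite lE; exact: eigenvalue_law.
have [ml _ _ LE] := law.
split => //; split.
  split; first by move=> i; exact: measurable_tnth_comp.
  have mbad : measurable [set b : n.-tuple R | ~~ posb b].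
    rewrite (_ : [set b | _] = (@posb R n) @^-1` [set false]); last first.
      by apply/seteqP; split => b /=; [move/negbTE|move=> ->].
    rewrite -[X in measurable X]setTI.
    have mp : measurable_fun setT (@posb R n) by exact: (@measurable_posb _ _ _ _ id).
    exact: mp.
  (* Almost sure positivity: the density vanishes off the positive orthant. *)
  exists (lambda @^-1` [set b | ~~ posb b]); split.
  - by rewrite -[X in measurable X]setTI; exact: ml.
  - rewrite LE//; apply: integral0_eq => b /= /negbTE pb.
    by rewrite eigenvalue_densityE pb andbF mul0r.
  - by move=> w /= nE; apply/negP => /forallP.
exists (@eig_kernel R n) => m m0.
have mass := vconst_det_gram law.
have mD : measurable_fun setT (fun t : m.-tuple R => \det (kernel_mx n t)).
  by apply: measurable_det_kernel_mx; exact: measurable_id.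
split.
- exact: measurable_funTS mD.
- by move=> y _; exact: det_kernel_mx_ge0 mass _ _.
move=> B mB _; rewrite [RHS]integral_mkcond.
transitivity (\int[lebesgue_tuple R m]_t ((\det (kernel_mx n t))%:E * (\1_B t)%:E))%E; last first.
  by apply: eq_integral => t _; rewrite patchE indicE; case: ifP; rewrite ?mule1 ?mule0.
have [mn|nm] := leqP m n.
  rewrite -(@correlation _ _ _ _ _ _ law m (n - m) (fun t => (\1_B t)%:E)) ?subnKC//.
    by apply: eq_integral => w _; rewrite sumEFin.
  by apply/measurable_EFinP; exact: measurable_indic.
(* With more than [n] points there is no injection into ['I_n], and on the other side the kernel
   matrix is singular. *)
rewrite integral0_eq; last first.
  move=> w _; rewrite big_pred0// => s; apply/negP => /injectiveP/leq_card.
  by rewrite !card_ord leqNgt nm.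
by rewrite integral0_eq// => t _; rewrite det_kernel_mx_gt ?mul0e.
Qed.
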